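(* Let $n\ge1$ and let $g_n$ be a strictly positive function on $W^n$ with $P^n_tg_n=e^{ct}g_n$ for all $t\ge0$, and assume $\hat g_n=\Lambda_{n,n}g_n$ is finite on $W^n$. Then $\hat g_n$ is a strictly positive eigenfunction of $\hat P^n_t$ with eigenvalue $e^{ct}$, and for all $t\ge0$ $$\hat P^{n,\hat g_n}_t\Lambda^{g_n}_{n,n}=\Lambda^{g_n}_{n,n}\mathsf Q^{n,n,g_n}_t,\qquad \hat P^{n,\hat g_n}_t\Lambda^{g_n}_{n,n}=\Lambda^{g_n}_{n,n}P^{n,g_n}_t,$$ where in the second identity $\Lambda^{g_n}_{n,n}$ is viewed as a kernel from $W^n$ to $W^n$ (acting on functions of $y$ only). Moreover, if the Markov process $(X,Y)$ on $W^{n,n}$ with semigroup $\mathsf Q^{n,n,g_n}_t$ is started from $\Lambda^{g_n}_{n,n}(x,\cdot)$, then $X$ is a Markov process with semigroup $\hat P^{n,\hat g_n}_t$ started at $x$, and for each fixed $T\ge0$ the conditional law of $(X(T),Y(T))$ given $X(T)$ is $\Lambda^{g_n}_{n,n}(X(T),\cdot)$.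
   Context: Let $I=\mathbb N=\{0,1,2,\dots\}$ or $I=\mathbb Z$. Let $\lambda,\mu:I\to[0,\infty)$ with $\lambda(x)>0$ and $\mu(x)>0$ for all $x\in I$, except that $\mu(0)=0$ when $I=\mathbb N$. Put $\pi(0)=1$, $\pi(x)=\prod_{i=1}^{x}\lambda(i-1)/\mu(i)$ for $x\ge1$ and $\pi(x)=\prod_{i=1}^{-x}\mu(x+i)/\lambda(x+i-1)$ for $x\le-1$. Assume $\pm\infty$ are natural boundaries: if $I=\mathbb N$, $\sum_{j\ge0}\frac{1}{\lambda(j)\pi(j)}\sum_{i=0}^{j}\pi(i)=\infty$ and $\sum_{j\ge0}\frac{1}{\lambda(j)\pi(j)}\sum_{i>j}\pi(i)=\infty$; if $I=\mathbb Z$, $\sum_{j\ge1}\frac{1}{\lambda(j)\pi(j)}\sum_{i=1}^{j}\pi(i)=\infty$, $\sum_{j\ge1}\pi(j)\sum_{i=1}^{j-1}\frac{1}{\lambda(i)\pi(i)}=\infty$, $\sum_{j\le-1}\frac{1}{\lambda(j)\pi(j)}\sum_{i=j+1}^{-1}\pi(i)=\infty$, $\sum_{j\le -1}\pi(j)\sum_{i=j}^{-1}\frac{1}{\lambda(i)\pi(i)}=\infty$. The $\mathcal D$-chain is the continuous-time Markov chain on $I$ jumping $x\to x+1$ at rate $\lambda(x)$ and $x\to x-1$ at rate $\mu(x)$; $p_t(x,y)$ denotes its transition probabilities. Its Siegmund dual, the $\hat{\mathcal D}$-chain, has rates $\hat\lambda(x)=\mu(x+1)$ (for $x\to x+1$)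 and $\hat\mu(x)=\lambda(x)$ (for $x\to x-1$); when $I=\mathbb N$ it lives on $\{-1,0,1,\dots\}$ and is absorbed at $-1$. $\hat p_t(x,y)$, $x,y\in I$, denotes its transition probabilities restricted to $I$ (equivalently, those of the chain killed at $-1$; in particular $\hat p_t(-1,\cdot)=0$ on $I$), and $\hat P_t\mathbf 1_{[y,\infty)}(x)=\sum_{w\ge y}\hat p_t(x,w)$. $W^n=\{x\in I^n:x_1<\dots<x_n\}$; for $x\in W^{n}$, $W^{n,n}(x)=\{y\in W^n:y_1\le x_1<y_2\le x_2<\dots<y_n\le x_n\}$; $W^{n,n}=\{(x,y):x\in W^n,y\in W^{n,n}(x)\}$. Karlin–McGregor kernels: $P^n_t(x,y)=\det(p_t(x_i,y_j))_{i,j=1}^n$, $\hat P^n_t(x,y)=\det(\hat p_t(x_i,y_j))_{i,j=1}^n$ on $W^n$. $\Lambda_{n,n}(x,y)=\prod_{i=1}^n\pi(y_i)\mathbf 1(y\in W^{n,n}(x))$. For $(x,y),(x',y')\in W^{n,n}$ and $t\ge0$, $\mathsf q^{n,n}_t((x,y),(x',y'))$ is the determinant of the $2n\times2n$ block matrix $\begin{pmatrix}\mathsf A&\mathsf B\\ \mathsf C&\mathsf D\end{pmatrix}$ with $\mathsf A_{ij}=\hat p_t(x_i,x'_j)$, $\mathsf B_{ij}=\pi(y'_j)\big(\hat P_t\mathbf 1_{[y'_j,\infty)}(x_i)-\mathbf 1(j\le i)\big)$, $\mathsf C_{ij}=\pi(y_i)^{-1}\big(\hat p_t(y_i,x'_j)-\hat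 p_t(y_i-1,x'_j)\big)$, $\mathsf D_{ij}=p_t(y_i,y'_j)$ ($1\le i,j\le n$). It is a sub-Markov semigroup kernel on $W^{n,n}$, denoted $\mathsf Q^{n,n}_t$. Doob transforms: for a kernel semigroup $K_t$ with strictly positive eigenfunction $h$, $K_th=e^{ct}h$, set $K^h_t(a,b)=e^{-ct}h(b)K_t(a,b)/h(a)$; in particular $\mathsf Q^{n,n,g_n}_t((x,y),(x',y'))=e^{-ct}\frac{g_n(y')}{g_n(y)}\mathsf q^{n,n}_t((x,y),(x',y'))$. The Markov kernel $\Lambda^{g_n}_{n,n}$ from $W^n$ to $W^{n,n}$ is $\Lambda^{g_n}_{n,n}(x,(x,y))=\frac{1}{\hat g_n(x)}\prod_{i=1}^n\pi(y_i)g_n(y)$ for $y\in W^{n,n}(x)$ (zero otherwise). *)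

(* Defs.v *)
From Stdlib Require Import Reals ZArith List Bool.
From Stdlib Require Import ClassicalEpsilon.
Import ListNotations.
Open Scope R_scope.

Definition inI (isN : bool) (z : Z) : bool := if isN then Z.leb 0 z else true.

(* Finite sums / products over integer intervals [a,b] (empty if b < a). *)
Fixpoint sum_from (a : Z) (k : nat) (f : Z -> R) : R :=
  match k with O => 0 | S k' => f a + sum_from (a + 1)%Z k' f end.
Fixpoint prod_from (a : Z) (k : nat) (f : Z -> R) : R :=
  match k with O => 1 | S k' => f a * prod_from (a + 1)%Z k' f end.
Definition sumZ (a b : Z) (f : Z -> R) : R := sum_from a (Z.to_nat (b - a + 1)) f.
Definition prodZ (a b : Z) (f : Z -> R) : R := prod_from a (Z.to_nat (b - a + 1)) f.

Definition piZ (lam mu : Z -> R) (x : Z) : R :=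
  if Z.leb 0 x then prodZ 1 x (fun i => lam (i - 1)%Z / mu i)
  else prodZ 1 (- x) (fun i => mu (x + i)%Z / lam (x + i - 1)%Z).

Definition rates_ok (isN : bool) (lam mu : Z -> R) : Prop :=
  (forall x, inI isN x = true -> 0 < lam x) /\
  (forall x, inI isN x = true -> (isN = true -> x <> 0%Z) -> 0 < mu x) /\
  (isN = true -> mu 0%Z = 0).

(* "sum = +infinity" for series of nonnegative terms, expressed as
   unboundedness of the (finite) partial sums. *)
Definition natural_boundaries (isN : bool) (lam mu : Z -> R) : Prop :=
  let pi := piZ lam mu in
  let w := fun j => / (lam j * pi j) in
  if isN then
    (forall B, exists N, sumZ 0 N (fun j => w j * sumZ 0 j pi) > B) /\
    (forall B, exists N M, sumZ 0 N (fun j => w j * sumZ (j + 1) (j + M) pi) > B)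
  else
    (forall B, exists N, sumZ 1 N (fun j => w j * sumZ 1 j pi) > B) /\
    (forall B, exists N, sumZ 1 N (fun j => pi j * sumZ 1 (j - 1) w) > B) /\
    (forall B, exists N, sumZ (- N) (-1) (fun j => w j * sumZ (j + 1) (-1) pi) > B) /\
    (forall B, exists N, sumZ (- N) (-1) (fun j => pi j * sumZ j (-1) w) > B).

(* Transition functions of nearest-neighbour chains on I.
   up x = rate x -> x+1, down x = rate x -> x-1; a jump leaving I is a
   killing (values outside I are taken to be 0).                        *)
Definition ext (isN : bool) (f : Z -> R) (z : Z) : R :=
  if inI isN z then f z else 0.

Definition gen (isN : bool) (up down : Z -> R) (f : Z -> R) (x : Z) : R :=
  up x * (ext isN f (x + 1) - f x) + down x * (ext isN f (x - 1) - f x).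

Definition bw_sol (isN : bool) (up down : Z -> R) (q : R -> Z -> Z -> R) : Prop :=
  (forall x y, inI isN x = true -> inI isN y = true ->
     q 0 x y = if Z.eq_dec x y then 1 else 0) /\
  (forall t x y, 0 <= t -> inI isN x = true -> inI isN y = true -> 0 <= q t x y) /\
  (forall x y, inI isN x = true -> inI isN y = true ->
     forall eps, 0 < eps -> exists d, 0 < d /\
       forall t, 0 < t < d -> Rabs (q t x y - q 0 x y) < eps) /\
  (forall t x y, 0 < t -> inI isN x = true -> inI isN y = true ->
     derivable_pt_lim (fun s => q s x y) t (gen isN up down (fun z => q t z y) x)).

(* The transition probabilities of the (minimal) chain with these rates:
   the minimal nonnegative solution of the backward equations. *)
Definition is_chain_tf (isN : bool) (up down : Z -> R) (q : R -> Z -> Z -> R) : Prop :=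
  bw_sol isN up down q /\
  (forall q', bw_sol isN up down q' ->
     forall t x y, 0 <= t -> inI isN x = true -> inI isN y = true -> q t x y <= q' t x y).

Definition is_D_tf isN lam mu p := is_chain_tf isN lam mu p.
(* Transition probabilities of the dual chain restricted to I (killed at -1
   when I = N): up rate mu(x+1), down rate lam(x). *)
Definition is_Dhat_tf isN (lam mu : Z -> R) phat :=
  is_chain_tf isN (fun x => mu (x + 1)%Z) lam phat.

Definition phat_ext isN (phat : R -> Z -> Z -> R) t x y : R :=
  if inI isN x then phat t x y else 0.

Definition sum_list {T} (f : T -> R) (l : list T) : R := fold_right Rplus 0 (map f l).

Definition has_sum {T : Type} (A : T -> Prop) (f : T -> R) (l : R) : Prop :=
  forall eps, 0 < eps -> exists F : list T,
    NoDup F /\ Forall A F /\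
    forall G : list T, NoDup G -> Forall A G -> incl F G ->
      Rabs (sum_list f G - l) < eps.

(* The value of a sum (used only for sums that converge). *)
Definition tsum {T : Type} (A : T -> Prop) (f : T -> R) : R :=
  epsilon (inhabits 0) (fun l => has_sum A f l).

Definition Phat_tail isN (phat : R -> Z -> Z -> R) t x y : R :=
  tsum (fun w => inI isN w = true /\ (y <= w)%Z) (fun w => phat t x w).

(* Weyl chambers; points of I^n are lists of length n (0-based indices). *)
Fixpoint incrb (l : list Z) : bool :=
  match l with
  | a :: ((b :: _) as t) => Z.ltb a b && incrb t
  | _ => true
  end.

Definition Wb (isN : bool) (n : nat) (x : list Z) : bool :=
  Nat.eqb (length x) n && forallb (inI isN) x && incrb x.

Fixpoint interlaceb (x y : list Z) : bool :=
  match x, y with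
  | [], [] => true
  | [x1], [y1] => Z.leb y1 x1
  | x1 :: ((x2 :: _) as xt), y1 :: ((y2 :: _) as yt) =>
      Z.leb y1 x1 && Z.ltb x1 y2 && interlaceb xt yt
  | _, _ => false
  end.

Definition Wnnb (isN : bool) (n : nat) (x y : list Z) : bool :=
  Wb isN n x && Wb isN n y && interlaceb x y.

Definition Wnn_pair (isN : bool) (n : nat) (xy : list Z * list Z) : Prop :=
  Wnnb isN n (fst xy) (snd xy) = true.

Fixpoint sumN (k : nat) (f : nat -> R) : R :=
  match k with O => 0 | S k' => sumN k' f + f k' end.

Fixpoint det (n : nat) (M : nat -> nat -> R) : R :=
  match n with
  | O => 1
  | S m => sumN (S m) (fun j =>
             (-1) ^ j * M O j *
             det m (fun i k => M (S i) (if Nat.ltb k j then k else S k)))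
  end.

Definition xi (x : list Z) (i : nat) : Z := nth i x 0%Z.

Definition KM (n : nat) (q : R -> Z -> Z -> R) (t : R) (x y : list Z) : R :=
  det n (fun i j => q t (xi x i) (xi y j)).

Definition prodpi (lam mu : Z -> R) (y : list Z) : R :=
  fold_right (fun z acc => piZ lam mu z * acc) 1 y.

Definition qnn isN (lam mu : Z -> R) (p phat : R -> Z -> Z -> R) (n : nat) (t : R)
    (xy xy' : list Z * list Z) : R :=
  let '(x, y) := xy in let '(x', y') := xy' in
  let pi := piZ lam mu in
  let A i j := phat t (xi x i) (xi x' j) in
  let B i j := pi (xi y' j) *
                 (Phat_tail isN phat t (xi x i) (xi y' j) - if Nat.leb j i then 1 else 0) in
  let C i j := / pi (xi y i) *
                 (phat_ext isN phat t (xi y i) (xi x' j)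
                  - phat_ext isN phat t (xi y i - 1)%Z (xi x' j)) in
  let D i j := p t (xi y i) (xi y' j) in
  det (2 * n) (fun i j =>
    if Nat.ltb i n then (if Nat.ltb j n then A i j else B i (j - n)%nat)
    else (if Nat.ltb j n then C (i - n)%nat j else D (i - n)%nat (j - n)%nat)).

Definition PnG (n : nat) (p : R -> Z -> Z -> R) (c : R) (g : list Z -> R) t x y : R :=
  exp (- c * t) * g y * KM n p t x y / g x.

Definition QnnG isN lam mu p phat n (c : R) (g : list Z -> R) t
    (xy xy' : list Z * list Z) : R :=
  exp (- c * t) * g (snd xy') / g (snd xy) * qnn isN lam mu p phat n t xy xy'.

Definition LamG isN lam mu n (g hg : list Z -> R) (x : list Z) (ab : list Z * list Z) : R :=
  if list_eq_dec Z.eq_dec x (fst ab) then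
    (if Wnnb isN n x (snd ab) then prodpi lam mu (snd ab) * g (snd ab) / hg x else 0)
  else 0.

(* Finite-dimensional distributions along a path (increments ss). *)
Fixpoint pathQ (K : R -> list Z * list Z -> list Z * list Z -> R) (ss : list R)
    (x0 y0 : list Z) (xs ys : list (list Z)) : R :=
  match ss, xs, ys with
  | s :: ss', x1 :: xs', y1 :: ys' => K s (x0, y0) (x1, y1) * pathQ K ss' x1 y1 xs' ys'
  | _, _, _ => 1
  end.

Fixpoint pathP (K : R -> list Z -> list Z -> R) (ss : list R) (x0 : list Z)
    (xs : list (list Z)) : R :=
  match ss, xs with
  | s :: ss', x1 :: xs' => K s x0 x1 * pathP K ss' x1 xs'
  | _, _ => 1
  end.

(* Main.v *)
(* Let [F t x y] be the hat-chain tail [sum_(w >= y) phat t x w] and [G t y x]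
   the distribution function [sum_(z <= x) p t y z].  Siegmund duality says
   [F t x y = G t y x]: as functions of [x] both are bounded solutions of the
   backward equation of the hat-chain with the same initial value, and natural
   boundaries provide Lyapunov functions which make bounded solutions unique.
   Summing [det (phat t x_i z_j)] over the [z] interlacing with a fixed [y'],
   or [det (p t y'_j y_i)] over the [y] interlacing with a fixed [x], is a
   multilinear operation whose result is in both cases [det (F t x_i y'_j)] up to
   unimodular row or column operations; with reversibility this gives
   [Phat^n Lambda = Lambda P^n].  The same summation over [y] turns the
   2n x 2n block determinant into a block triangular one, which gives the
   intertwining with [Q^(n,n)].  The path statement follows by summing out the
   [y]-coordinates one after the other.  Since [p] is only known as the minimal
   solution of the backward equation, its symmetry and sub-stochasticity come
   from identifying it with the limit of killed finite chains. *)

From mathcomp Require all_boot all_algebra Rstruct.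
From Coquelicot Require Import Coquelicot.
Require Import Defs.
From Stdlib Require Import Reals ZArith List Bool Lia Lra Classical ClassicalEpsilon Permutation.
Import ListNotations.
Open Scope R_scope.

(** * Unconditional sums *)

(** Two obstacles shape the argument. The function [g] may be unbounded and [qnn] is a determinant
    with entries of both signs, so every exchange of sums needs a justification. For the
    Karlin-McGregor kernels it is nonnegativity, obtained from a maximum principle on the Weyl
    chamber; for [qnn] it is an absolute bound by a permanent, proportional to the weight of the
    target [y'] and therefore summable along the rest of a path. The second obstacle is that the
    backward equation does not say how [p] varies with its target. Killed finite chains are
    symmetric with respect to [pi], so they satisfy a forward equation, but they lose mass at both
    ends; the distribution function and its difference with the total mass have derivatives that
    bracket the flux, and conservation of mass gives both the same increments in the limit. The
    boundary conditions fall into two groups: one makes Feller's double sums for the D-chain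
    diverge, the other, read through the dual reversing measure [1 / (lam pi)], those for the dual
    chain. *)

Definition eqdec {T : Type} (x y : T) : {x = y} + {x <> y} :=
  excluded_middle_informative (x = y).

Definition decb (P : Prop) : bool := if excluded_middle_informative P then true else false.

Lemma decb_true (P : Prop) : decb P = true <-> P.
Proof. unfold decb. destruct (excluded_middle_informative P); split; intros; congruence || auto. Qed.

Lemma sum_list_cons {T} (f : T -> R) x l : sum_list f (x :: l) = f x + sum_list f l.
Proof. reflexivity. Qed.

Lemma sum_list_app {T} (f : T -> R) l l' : sum_list f (l ++ l') = sum_list f l + sum_list f l'.
Proof.
  induction l; simpl; [unfold sum_list; simpl; lra|].
  rewrite !sum_list_cons, IHl; lra.
Qed.

Lemma sum_list_ext {T} (f g : T -> R) l :
  (forall x, In x l -> f x = g x) -> sum_list f l = sum_list g l.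
Proof.
  intros H. induction l; [reflexivity|].
  rewrite !sum_list_cons, IHl; [|intros; apply H; right; auto].
  rewrite (H a); [reflexivity|left; auto].
Qed.

Lemma sum_list_le {T} (f g : T -> R) l :
  (forall x, In x l -> f x <= g x) -> sum_list f l <= sum_list g l.
Proof.
  intros H. induction l; [apply Rle_refl|].
  rewrite !sum_list_cons. apply Rplus_le_compat; [apply H; left; auto|].
  apply IHl; intros; apply H; right; auto.
Qed.

Lemma sum_list_plus {T} (f g : T -> R) l :
  sum_list (fun x => f x + g x) l = sum_list f l + sum_list g l.
Proof. induction l; [unfold sum_list; simpl; lra|]. rewrite !sum_list_cons, IHl; lra. Qed.

Lemma sum_list_scal {T} (f : T -> R) k l :
  sum_list (fun x => k * f x) l = k * sum_list f l.
Proof. induction l; [unfold sum_list; simpl; lra|]. rewrite !sum_list_cons, IHl; lra. Qed.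

Lemma sum_list_const {T} k (l : list T) : sum_list (fun _ => k) l = INR (length l) * k.
Proof.
  induction l; [unfold sum_list; simpl; lra|].
  rewrite sum_list_cons, IHl. change (length (a :: l)) with (S (length l)). rewrite S_INR. lra.
Qed.

Lemma sum_list_zero {T} (f : T -> R) l : (forall x, In x l -> f x = 0) -> sum_list f l = 0.
Proof.
  intros H. rewrite (sum_list_ext f (fun _ => 0)); [|auto]. rewrite sum_list_const. lra.
Qed.

Lemma sum_list_nonneg {T} (f : T -> R) l : (forall x, In x l -> 0 <= f x) -> 0 <= sum_list f l.
Proof.
  intros H. rewrite <- (sum_list_zero (fun _ : T => 0) l); [|auto]. apply sum_list_le; auto.
Qed.

Lemma sum_list_Rabs {T} (f : T -> R) l : Rabs (sum_list f l) <= sum_list (fun x => Rabs (f x)) l.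
Proof.
  induction l; [unfold sum_list; simpl; rewrite Rabs_R0; lra|].
  rewrite !sum_list_cons. eapply Rle_trans; [apply Rabs_triang|]. lra.
Qed.

Lemma sum_list_perm {T} (f : T -> R) l l' : Permutation l l' -> sum_list f l = sum_list f l'.
Proof.
  induction 1; rewrite ?sum_list_cons; lra.
Qed.

Lemma sum_list_map {T U} (f : U -> R) (h : T -> U) l :
  sum_list f (map h l) = sum_list (fun x => f (h x)) l.
Proof. unfold sum_list. rewrite map_map. reflexivity. Qed.

Lemma sum_list_flat_map {T U} (f : U -> R) (h : T -> list U) l :
  sum_list f (flat_map h l) = sum_list (fun x => sum_list f (h x)) l.
Proof. induction l; [reflexivity|]. simpl. rewrite sum_list_app, IHl. reflexivity. Qed.

Lemma sum_list_filter_split {T} (f : T -> R) (b : T -> bool) l :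
  sum_list f l = sum_list f (filter b l) + sum_list f (filter (fun x => negb (b x)) l).
Proof.
  induction l; [unfold sum_list; simpl; lra|].
  simpl. destruct (b a); simpl; rewrite !sum_list_cons, IHl; lra.
Qed.

Lemma sum_list_filter_zero {T} (f : T -> R) (b : T -> bool) l :
  (forall x, In x l -> b x = false -> f x = 0) -> sum_list f (filter b l) = sum_list f l.
Proof.
  intros H. rewrite (sum_list_filter_split f b l).
  rewrite (sum_list_zero f (filter (fun x => negb (b x)) l)); [lra|].
  intros x Hx. apply filter_In in Hx. destruct Hx as [Hx Hb]. apply H; auto.
  now apply Bool.negb_true_iff.
Qed.

Lemma incl_permutation {T} (F G : list T) :
  NoDup F -> incl F G -> exists D, Permutation G (F ++ D).
Proof.
  revert G. induction F as [|a F IH]; intros G HF Hi.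
  - exists G. apply Permutation_refl.
  - inversion HF; subst.
    destruct (in_split a G) as (G1 & G2 & ->); [apply Hi; left; auto|].
    destruct (IH (G1 ++ G2)) as [D HD]; auto.
    + intros x Hx. assert (Hx' : In x (G1 ++ a :: G2)) by (apply Hi; right; auto).
      apply in_app_or in Hx'. apply in_or_app.
      destruct Hx' as [|[<-|]]; auto. contradiction.
    + exists D. eapply Permutation_trans; [apply Permutation_sym, Permutation_middle|].
      simpl. constructor. exact HD.
Qed.

Lemma sum_list_incl {T} (f : T -> R) F G :
  NoDup F -> incl F G -> (forall x, In x G -> 0 <= f x) -> sum_list f F <= sum_list f G.
Proof.
  intros HF Hi Hf. destruct (incl_permutation F G HF Hi) as [D HD].
  rewrite (sum_list_perm f _ _ HD), sum_list_app.
  assert (0 <= sum_list f D); [|lra].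
  apply sum_list_nonneg. intros x Hx. apply Hf.
  eapply Permutation_in; [apply Permutation_sym; exact HD|]. apply in_or_app; auto.
Qed.

Definition lunion {T} (F G : list T) : list T := nodup eqdec (F ++ G).

Lemma lunion_spec {T} (A : T -> Prop) F G : Forall A F -> Forall A G ->
  NoDup (lunion F G) /\ Forall A (lunion F G) /\ incl F (lunion F G) /\ incl G (lunion F G).
Proof.
  intros HF HG. unfold lunion. repeat split.
  - apply NoDup_nodup.
  - apply Forall_forall. intros x Hx. apply nodup_In in Hx.
    rewrite Forall_forall in HF, HG. apply in_app_or in Hx. destruct Hx; auto.
  - intros x Hx. apply nodup_In. apply in_or_app; auto.
  - intros x Hx. apply nodup_In. apply in_or_app; auto.
Qed.

Lemma Forall_filter {T} (A : T -> Prop) b l : Forall A l -> Forall A (filter b l).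
Proof.
  rewrite !Forall_forall. intros H x Hx. apply filter_In in Hx. apply H; tauto.
Qed.

Lemma has_sum_unique {T} (A : T -> Prop) f l1 l2 :
  has_sum A f l1 -> has_sum A f l2 -> l1 = l2.
Proof.
  intros H1 H2. apply NNPP. intros Hne.
  assert (He : 0 < Rabs (l1 - l2) / 2).
  { assert (0 < Rabs (l1 - l2)) by (apply Rabs_pos_lt; lra). lra. }
  destruct (H1 _ He) as (F1 & _ & HF1 & H1'). destruct (H2 _ He) as (F2 & _ & HF2 & H2').
  destruct (lunion_spec A F1 F2 HF1 HF2) as (N & HA & I1 & I2).
  specialize (H1' _ N HA I1). specialize (H2' _ N HA I2).
  set (s := sum_list f (lunion F1 F2)) in *.
  assert (Rabs (l1 - l2) <= Rabs (s - l1) + Rabs (s - l2)); [|lra].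
  replace (l1 - l2) with (- (s - l1) + (s - l2)) by ring.
  eapply Rle_trans; [apply Rabs_triang|]. rewrite Rabs_Ropp. lra.
Qed.

Lemma has_sum_ext {T} (A B : T -> Prop) f g l :
  (forall x, A x <-> B x) -> (forall x, A x -> f x = g x) -> has_sum A f l -> has_sum B g l.
Proof.
  intros HAB Hfg H eps He. destruct (H eps He) as (F & N & HF & HG).
  exists F. split; auto. split; [eapply Forall_impl; [|exact HF]; intros; now apply HAB|].
  intros G NG AG IG. assert (AG' : Forall A G) by (eapply Forall_impl; [|exact AG]; intros; now apply HAB).
  rewrite <- (sum_list_ext f g); auto.
  rewrite Forall_forall in AG'. intros; apply Hfg; auto.
Qed.

Lemma has_sum_eq {T} (A : T -> Prop) f g l :
  (forall x, A x -> f x = g x) -> has_sum A f l -> has_sum A g l.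
Proof. intros H. now apply has_sum_ext. Qed.

Lemma has_sum_plus {T} (A : T -> Prop) f g l m :
  has_sum A f l -> has_sum A g m -> has_sum A (fun x => f x + g x) (l + m).
Proof.
  intros Hf Hg eps He.
  destruct (Hf (eps / 2)) as (F1 & _ & HF1 & H1); [lra|].
  destruct (Hg (eps / 2)) as (F2 & _ & HF2 & H2); [lra|].
  destruct (lunion_spec A F1 F2 HF1 HF2) as (N & HA & I1 & I2).
  exists (lunion F1 F2). split; auto. split; auto. intros G NG AG IG.
  rewrite sum_list_plus.
  specialize (H1 G NG AG (incl_tran I1 IG)). specialize (H2 G NG AG (incl_tran I2 IG)).
  replace (_ + _ - _) with ((sum_list f G - l) + (sum_list g G - m)) by ring.
  eapply Rle_lt_trans; [apply Rabs_triang|]. lra.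
Qed.

Lemma has_sum_scal {T} (A : T -> Prop) f k l :
  has_sum A f l -> has_sum A (fun x => k * f x) (k * l).
Proof.
  intros Hf eps He.
  assert (Hk : 0 < Rabs k + 1) by (pose proof (Rabs_pos k); lra).
  destruct (Hf (eps / (Rabs k + 1))) as (F1 & N1 & HF1 & H1).
  { apply Rdiv_lt_0_compat; auto. }
  exists F1. split; auto. split; auto. intros G NG AG IG.
  rewrite sum_list_scal. specialize (H1 G NG AG IG).
  rewrite <- Rmult_minus_distr_l, Rabs_mult.
  apply Rle_lt_trans with ((Rabs k) * (eps / (Rabs k + 1))).
  - apply Rmult_le_compat_l; [apply Rabs_pos|lra].
  - apply Rlt_le_trans with ((Rabs k + 1) * (eps / (Rabs k + 1))).
    + apply Rmult_lt_compat_r; [apply Rdiv_lt_0_compat; auto|lra].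
    + right. field. lra.
Qed.

Lemma has_sum_zero {T} (A : T -> Prop) : has_sum A (fun _ => 0) 0.
Proof.
  intros eps He. exists []. split; [constructor|]. split; [constructor|]. intros G _ _ _.
  rewrite sum_list_zero; auto. rewrite Rminus_0_r, Rabs_R0. exact He.
Qed.

Lemma has_sum_sumN {T} (A : T -> Prop) (f : nat -> T -> R) l k :
  (forall j, (j < k)%nat -> has_sum A (f j) (l j)) ->
  has_sum A (fun x => sumN k (fun j => f j x)) (sumN k l).
Proof.
  induction k; intros H; simpl; [apply has_sum_zero|].
  apply has_sum_plus; [apply IHk; intros; apply H; lia|apply H; lia].
Qed.

Lemma has_sum_finite {T} (A : T -> Prop) f L :
  NoDup L -> (forall x, A x <-> In x L) -> has_sum A f (sum_list f L).
Proof.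
  intros N HL eps He. exists L. split; auto.
  split; [apply Forall_forall; intros; now apply HL|].
  intros G NG AG IG. rewrite (sum_list_perm f G L).
  - rewrite Rminus_diag, Rabs_R0. exact He.
  - apply NoDup_Permutation; auto. intros x. split; [|apply IG].
    rewrite Forall_forall in AG. intros; apply HL; auto.
Qed.

Lemma has_sum_sup {T} (A : T -> Prop) f l :
  (forall x, A x -> 0 <= f x) ->
  (forall G, NoDup G -> Forall A G -> sum_list f G <= l) ->
  (forall eps, 0 < eps -> exists G, NoDup G /\ Forall A G /\ l - eps < sum_list f G) ->
  has_sum A f l.
Proof.
  intros Hf Hb Hs eps He. destruct (Hs eps He) as (F & NF & AF & HF).
  exists F. split; auto. split; auto. intros G NG AG IG.
  assert (sum_list f F <= sum_list f G).
  { apply sum_list_incl; auto. rewrite Forall_forall in AG. auto. }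
  specialize (Hb G NG AG). apply Rabs_def1; lra.
Qed.

(** Absolute summability with an explicit bound, the condition under which signed sums are
    exchanged. *)
Definition abs_bounded {T} (A : T -> Prop) (f : T -> R) (B : R) : Prop :=
  forall G, NoDup G -> Forall A G -> sum_list (fun x => Rabs (f x)) G <= B.

Lemma abs_bounded_nonneg {T} (A : T -> Prop) f B : abs_bounded A f B -> 0 <= B.
Proof. intros H. apply (H []); constructor. Qed.

Lemma abs_bounded_le {T} (A : T -> Prop) f g B :
  (forall x, A x -> Rabs (f x) <= Rabs (g x)) -> abs_bounded A g B -> abs_bounded A f B.
Proof.
  intros H HB G NG AG. eapply Rle_trans; [|apply (HB G NG AG)].
  apply sum_list_le. rewrite Forall_forall in AG. intros; apply H; auto.
Qed.

Lemma abs_bounded_sub {T} (A B : T -> Prop) f M :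
  (forall x, A x -> B x) -> abs_bounded B f M -> abs_bounded A f M.
Proof.
  intros H HB G NG AG. apply HB; auto. eapply Forall_impl; [|exact AG]; auto.
Qed.

Lemma abs_bounded_scal {T} (A : T -> Prop) f k B :
  abs_bounded A f B -> abs_bounded A (fun x => k * f x) (Rabs k * B).
Proof.
  intros H G NG AG. rewrite (sum_list_ext _ (fun x => Rabs k * Rabs (f x)))
    by (intros; apply Rabs_mult).
  rewrite sum_list_scal. apply Rmult_le_compat_l; [apply Rabs_pos|auto].
Qed.

Lemma nonneg_summable {T} (A : T -> Prop) f B :
  (forall x, A x -> 0 <= f x) ->
  (forall G, NoDup G -> Forall A G -> sum_list f G <= B) -> exists l, has_sum A f l.
Proof.
  intros Hf HB.
  destruct (completeness (fun s => exists G, NoDup G /\ Forall A G /\ s = sum_list f G)) as [l [Hu Hl]].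
  - exists B. intros s (G & NG & AG & ->). auto.
  - exists 0, []. repeat split; constructor.
  - exists l. apply has_sum_sup; auto.
    + intros G NG AG. apply Hu. exists G; auto.
    + intros eps He. apply NNPP. intros Hn.
      assert (l <= l - eps); [|lra]. apply Hl. intros s (G & NG & AG & ->).
      apply Rnot_lt_le. intros Hlt. apply Hn. exists G; auto.
Qed.

Lemma abs_bounded_summable {T} (A : T -> Prop) f B :
  abs_bounded A f B -> exists l, has_sum A f l.
Proof.
  intros H.
  assert (Hp : forall g, (forall x, 0 <= g x <= Rabs (f x)) -> exists l, has_sum A g l).
  { intros g Hg. apply (nonneg_summable A g B); [intros; apply Hg|].
    intros G NG AG. eapply Rle_trans; [|apply (H G NG AG)]. apply sum_list_le; intros; apply Hg. }
  destruct (Hp (fun x => Rmax (f x) 0)) as [l1 H1].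
  { intros x. unfold Rmax, Rabs. destruct (Rle_dec _ _), (Rcase_abs _); lra. }
  destruct (Hp (fun x => Rmax (- f x) 0)) as [l2 H2].
  { intros x. unfold Rmax, Rabs. destruct (Rle_dec _ _), (Rcase_abs _); lra. }
  exists (l1 + (-1) * l2).
  eapply has_sum_ext; [reflexivity| |apply has_sum_plus; [exact H1|apply has_sum_scal; exact H2]].
  intros x _. simpl. unfold Rmax. repeat destruct (Rle_dec _ _); lra.
Qed.

(** Unconditional convergence in [R] is absolute: a finite set disjoint from a set [F] adapted to
    tolerance 1 has sum at most 2 in modulus. This applies separately where [f] is nonnegative and
    where it is negative, whence the 4. *)
Lemma has_sum_abs_bounded {T} (A : T -> Prop) f l :
  has_sum A f l -> exists B, abs_bounded A f B.
Proof.
  intros H. destruct (H 1 Rlt_0_1) as (F & NF & AF & HF).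
  assert (Hpart : forall D, NoDup D -> Forall A D -> (forall x, In x D -> ~ In x F) ->
            Rabs (sum_list f D) <= 2).
  { intros D ND AD HD.
    assert (N : NoDup (F ++ D)).
    { apply NoDup_app; auto. intros x Hx Hx'. apply (HD x); auto. }
    assert (AA : Forall A (F ++ D)) by (apply Forall_app; auto).
    pose proof (HF _ N AA (incl_appl _ (incl_refl F))) as H1.
    pose proof (HF _ NF AF (incl_refl F)) as H2. rewrite sum_list_app in H1.
    replace (sum_list f D) with ((sum_list f F + sum_list f D - l) - (sum_list f F - l)) by ring.
    unfold Rminus at 1. eapply Rle_trans; [apply Rabs_triang|]. rewrite Rabs_Ropp. lra. }
  exists (sum_list (fun x => Rabs (f x)) F + 4). intros G NG AG.
  set (D := filter (fun x => negb (decb (In x F))) G).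
  assert (HDF : forall x, In x D -> ~ In x F).
  { intros x Hx Hx'. apply filter_In in Hx. destruct Hx as [_ Hx].
    apply <- decb_true in Hx'. rewrite Hx' in Hx. discriminate. }
  assert (ND : NoDup D) by now apply NoDup_filter.
  assert (AD : Forall A D) by now apply Forall_filter.
  rewrite (sum_list_filter_split _ (fun x => decb (In x F)) G). fold D.
  apply Rplus_le_compat.
  - apply sum_list_incl; [now apply NoDup_filter| |intros; apply Rabs_pos].
    intros x Hx. apply filter_In in Hx. now apply decb_true.
  - set (b := fun x => decb (0 <= f x)).
    rewrite (sum_list_filter_split _ b D).
    pose proof (Hpart (filter b D) (NoDup_filter _ ND) (Forall_filter _ _ _ AD)) as P1.
    pose proof (Hpart (filter (fun x => negb (b x)) D) (NoDup_filter _ ND) (Forall_filter _ _ _ AD)) as P2.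
    assert (P1' := P1 (fun x Hx => HDF x (proj1 (proj1 (filter_In _ _ _) Hx)))).
    assert (P2' := P2 (fun x Hx => HDF x (proj1 (proj1 (filter_In _ _ _) Hx)))).
    rewrite (sum_list_ext (fun x => Rabs (f x)) f (filter b D)).
    2: { intros x Hx. apply filter_In in Hx. destruct Hx as [_ Hx]. unfold b in Hx.
         apply -> decb_true in Hx. now apply Rabs_pos_eq. }
    rewrite (sum_list_ext (fun x => Rabs (f x)) (fun x => -1 * f x) (filter _ D)).
    2: { intros x Hx. apply filter_In in Hx. destruct Hx as [_ Hx].
         assert (~ 0 <= f x). { intros Hc. apply <- decb_true in Hc. unfold b in Hx. rewrite Hc in Hx. discriminate. }
         rewrite Rabs_left; lra. }
    rewrite sum_list_scal.
    apply Rabs_le_between in P1'. apply Rabs_le_between in P2'. lra.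
Qed.

Lemma has_sum_upper {T} (A : T -> Prop) f l B :
  has_sum A f l -> (forall G, NoDup G -> Forall A G -> sum_list f G <= B) -> l <= B.
Proof.
  intros H HB. apply Rnot_lt_le. intros Hlt.
  destruct (H (l - B)) as (F & NF & AF & HF); [lra|].
  specialize (HF F NF AF (incl_refl F)). specialize (HB F NF AF).
  apply Rabs_def2 in HF. lra.
Qed.

Lemma has_sum_partial_le {T} (A : T -> Prop) f l G :
  (forall x, A x -> 0 <= f x) -> has_sum A f l -> NoDup G -> Forall A G -> sum_list f G <= l.
Proof.
  intros Hf H NG AG. apply Rnot_lt_le. intros Hlt.
  destruct (H (sum_list f G - l)) as (F & NF & AF & HF); [lra|].
  destruct (lunion_spec A F G AF AG) as (N & HA & I1 & I2).
  specialize (HF _ N HA I1). apply Rabs_def2 in HF.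
  assert (sum_list f G <= sum_list f (lunion F G)); [|lra].
  apply sum_list_incl; auto. rewrite Forall_forall in HA; auto.
Qed.

Lemma has_sum_nonneg_abs_bounded {T} (A : T -> Prop) f l :
  (forall x, A x -> 0 <= f x) -> has_sum A f l -> abs_bounded A f l.
Proof.
  intros Hf H G NG AG. rewrite (sum_list_ext _ f).
  - now apply (has_sum_partial_le A).
  - intros x Hx. apply Rabs_right, Rle_ge, Hf. rewrite Forall_forall in AG; auto.
Qed.

Lemma has_sum_reindex {T U} (A : T -> Prop) (B : U -> Prop) (phi : T -> U) (psi : U -> T) f l :
  (forall a, A a -> B (phi a) /\ psi (phi a) = a) ->
  (forall b, B b -> A (psi b) /\ phi (psi b) = b) ->
  has_sum B f l -> has_sum A (fun a => f (phi a)) l.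
Proof.
  intros HA HB H eps He. destruct (H eps He) as (F & NF & AF & HF).
  rewrite Forall_forall in AF.
  assert (Inj : forall (V W : Type) (P : V -> Prop) (h : V -> W) (k : W -> V) l,
     (forall v, P v -> k (h v) = v) -> Forall P l -> NoDup l -> NoDup (map h l)).
  { intros V W P h k L Hk HL NL. induction NL; simpl; constructor.
    - intros Hin. apply in_map_iff in Hin. destruct Hin as (y & Hy & Hin).
      inversion HL; subst. rewrite Forall_forall in H4.
      assert (y = x); [|congruence]. rewrite <- (Hk y), <- (Hk x) by auto. congruence.
    - inversion HL; subst; auto. }
  exists (map psi F). split; [apply (Inj _ _ B psi phi); auto; [apply HB|now apply Forall_forall]|].
  split. { apply Forall_forall. intros x Hx. apply in_map_iff in Hx. destruct Hx as (u & <- & Hu). now apply HB, AF. }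
  intros G NG AG IG. rewrite <- (sum_list_map f phi). apply HF.
  - apply (Inj _ _ A phi psi); auto. apply HA.
  - apply Forall_forall. rewrite Forall_forall in AG. intros x Hx. apply in_map_iff in Hx.
    destruct Hx as (a & <- & Ha). now apply HA, AG.
  - intros u Hu. apply in_map_iff. exists (psi u). split; [now apply HB, AF|].
    apply IG. apply in_map; auto.
Qed.

Lemma has_sum_support {T} (A B : T -> Prop) f l :
  (forall x, A x -> B x) -> (forall x, B x -> ~ A x -> f x = 0) ->
  has_sum A f l -> has_sum B f l.
Proof.
  intros HAB H0 H eps He. destruct (H eps He) as (F & NF & AF & HF).
  exists F. split; auto. split; [eapply Forall_impl; [|exact AF]; auto|].
  intros G NG BG IG. rewrite Forall_forall in BG, AF.
  rewrite <- (sum_list_filter_zero f (fun x => decb (A x)) G).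
  - apply HF; [now apply NoDup_filter| |].
    + apply Forall_forall. intros x Hx. apply filter_In in Hx. now apply decb_true.
    + intros x Hx. apply filter_In. split; [auto|]. apply decb_true; auto.
  - intros x Hx Hb. apply H0; auto. intros Ha. apply <- decb_true in Ha. congruence.
Qed.

Lemma has_sum_singleton {T} (A : T -> Prop) f a :
  A a -> (forall x, A x -> x <> a -> f x = 0) -> has_sum A f (f a).
Proof.
  intros Ha H0. apply (has_sum_support (fun x => x = a)).
  - intros; subst; auto.
  - auto.
  - replace (f a) with (sum_list f [a]) by (unfold sum_list; simpl; ring).
    apply has_sum_finite; [repeat constructor; auto|]. intros x; simpl. intuition.
Qed.

Definition sigma_set {T U} (A : T -> Prop) (B : T -> U -> Prop) (ab : T * U) : Prop :=
  A (fst ab) /\ B (fst ab) (snd ab).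

Lemma NoDup_flat_map_pair {T U} (H : list T) (K : T -> list U) :
  NoDup H -> (forall a, In a H -> NoDup (K a)) ->
  NoDup (flat_map (fun a => map (pair a) (K a)) H).
Proof.
  intros NH. induction NH; intros HK; simpl; [constructor|].
  apply NoDup_app.
  - specialize (HK x (or_introl eq_refl)).
    clear -HK. induction HK; simpl; constructor; auto.
    intros Hin. apply in_map_iff in Hin. destruct Hin as (y & Hy & Hin). congruence.
  - apply IHNH. intros; apply HK; right; auto.
  - intros [a b] H1 H2. apply in_map_iff in H1. destruct H1 as (b' & Hb & _).
    apply in_flat_map in H2. destruct H2 as (a' & Ha' & H2). apply in_map_iff in H2.
    destruct H2 as (b'' & Hb'' & _). congruence.
Qed.

(** Fubini from the double sum to the iterated one. The outer partial sum over [G] is compared with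
    the sum over a finite set of pairs that nearly exhausts each fibre over [G] and still contains
    [F]. *)
Lemma has_sum_sigma_outer {T U} (A : T -> Prop) (B : T -> U -> Prop) (f : T * U -> R) g L :
  has_sum (sigma_set A B) f L ->
  (forall a, A a -> has_sum (B a) (fun b => f (a, b)) (g a)) ->
  has_sum A g L.
Proof.
  intros H Hg eps He. destruct (H (eps / 2)) as (F & NF & AF & HF); [lra|].
  rewrite Forall_forall in AF.
  exists (nodup eqdec (map fst F)). split; [apply NoDup_nodup|]. split.
  { apply Forall_forall. intros a Ha. apply nodup_In in Ha. apply in_map_iff in Ha.
    destruct Ha as (x & <- & Hx). apply (AF x Hx). }
  intros G NG AG IG. rewrite Forall_forall in AG.
  (* An equal share of [eps / 2] for each fibre; the [+ 1] covers an empty [G]. *)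
  set (d := eps / (2 * (INR (length G) + 1))).
  pose proof (pos_INR (length G)) as HG0.
  assert (Hd : 0 < d) by (apply Rdiv_lt_0_compat; lra).
  assert (HK : forall a, exists K, In a G -> NoDup K /\ Forall (B a) K /\
             (forall b, In (a, b) F -> In b K) /\ Rabs (sum_list (fun b => f (a, b)) K - g a) < d).
  { intros a. destruct (classic (In a G)) as [Ha|Ha]; [|exists []; tauto].
    destruct (Hg a (AG a Ha) d Hd) as (K0 & NK0 & AK0 & HK0).
    set (Fa := map snd (filter (fun x => decb (fst x = a)) F)).
    assert (HFa : Forall (B a) Fa).
    { apply Forall_forall. intros b Hb. apply in_map_iff in Hb. destruct Hb as ([a' b'] & <- & Hb).
      apply filter_In in Hb. destruct Hb as [Hb1 Hb2]. apply -> decb_true in Hb2. simpl in *; subst.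
      apply (AF _ Hb1). }
    destruct (lunion_spec (B a) K0 Fa AK0 HFa) as (N & HA & I1 & I2).
    exists (lunion K0 Fa). intros _. split; auto. split; auto. split.
    - intros b Hb. apply I2. apply in_map_iff. exists (a, b). split; auto.
      apply filter_In. split; auto. now apply decb_true.
    - apply HK0; auto. }
  set (K := fun a => epsilon (inhabits (@nil U)) (fun K => In a G -> NoDup K /\ Forall (B a) K /\
             (forall b, In (a, b) F -> In b K) /\ Rabs (sum_list (fun b => f (a, b)) K - g a) < d)).
  assert (HKs : forall a, In a G -> NoDup (K a) /\ Forall (B a) (K a) /\
             (forall b, In (a, b) F -> In b (K a)) /\ Rabs (sum_list (fun b => f (a, b)) (K a) - g a) < d).
  { intros a Ha. apply (epsilon_spec (inhabits (@nil U)) _ (HK a) Ha). }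
  set (P := flat_map (fun a => map (pair a) (K a)) G).
  assert (HP : Rabs (sum_list f P - L) < eps / 2).
  { apply HF.
    - apply NoDup_flat_map_pair; auto. intros; now apply HKs.
    - apply Forall_forall. intros x Hx. apply in_flat_map in Hx. destruct Hx as (a & Ha & Hx).
      apply in_map_iff in Hx. destruct Hx as (b & <- & Hb). split; simpl; auto.
      destruct (HKs a Ha) as (_ & HB & _). rewrite Forall_forall in HB; auto.
    - intros [a b] Hx. apply in_flat_map. exists a.
      assert (Ha : In a G).
      { apply IG. apply nodup_In. apply in_map_iff. exists (a, b); auto. }
      split; auto. apply in_map. apply HKs; auto. }
  assert (HD : Rabs (sum_list f P - sum_list g G) <= INR (length G) * d).
  { unfold P. rewrite sum_list_flat_map.
    replace (_ - _) with (sum_list (fun a => sum_list f (map (pair a) (K a)) + -1 * g a) G)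
      by (rewrite sum_list_plus, sum_list_scal; ring).
    eapply Rle_trans; [apply sum_list_Rabs|]. rewrite <- (sum_list_const d G).
    apply sum_list_le. intros a Ha. rewrite sum_list_map.
    destruct (HKs a Ha) as (_ & _ & _ & Hlt).
    replace (_ + _) with (sum_list (fun b => f (a, b)) (K a) - g a) by ring. lra. }
  assert (HGd : INR (length G) * d < eps / 2).
  { apply Rlt_le_trans with ((INR (length G) + 1) * d).
    - apply Rmult_lt_compat_r; lra.
    - right. unfold d. field. lra. }
  replace (sum_list g G - L) with (- (sum_list f P - sum_list g G) + (sum_list f P - L)) by ring.
  eapply Rle_lt_trans; [apply Rabs_triang|]. rewrite Rabs_Ropp. lra.
Qed.

Lemma sigma_abs_bounded {T U} (A : T -> Prop) (B : T -> U -> Prop) (f : T * U -> R) h M :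
  (forall a, A a -> abs_bounded (B a) (fun b => f (a, b)) (h a)) ->
  abs_bounded A h M -> abs_bounded (sigma_set A B) f M.
Proof.
  intros Hin Hout G NG AG. rewrite Forall_forall in AG.
  set (H := nodup eqdec (map fst G)).
  set (K := fun a => map snd (filter (fun x => decb (fst x = a)) G)).
  assert (AH : Forall A H).
  { apply Forall_forall. intros a Ha. apply nodup_In, in_map_iff in Ha.
    destruct Ha as (x & <- & Hx). apply (AG x Hx). }
  assert (HK : forall a, NoDup (K a) /\ Forall (B a) (K a)).
  { intros a. split.
    - unfold K. clear -NG. induction NG as [|x G Hn NG IH]; simpl; [constructor|].
      destruct (decb (fst x = a)) eqn:E; auto. simpl. constructor; auto.
      apply -> decb_true in E. intros Hi. apply in_map_iff in Hi. destruct Hi as (y & Hy & Hi).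
      apply filter_In in Hi. destruct Hi as [Hi Hf]. apply -> decb_true in Hf.
      apply Hn. destruct x, y; simpl in *; congruence.
    - apply Forall_forall. intros b Hb. apply in_map_iff in Hb. destruct Hb as ([a' b'] & <- & Hb).
      apply filter_In in Hb. destruct Hb as [Hb1 Hb2]. apply -> decb_true in Hb2. simpl in *; subst.
      apply (AG _ Hb1). }
  apply Rle_trans with (sum_list (fun x => Rabs (f x)) (flat_map (fun a => map (pair a) (K a)) H)).
  - apply sum_list_incl; auto; [|intros; apply Rabs_pos].
    intros [a b] Hx. apply in_flat_map. exists a. split.
    + apply nodup_In, in_map_iff. exists (a, b); auto.
    + apply in_map. apply in_map_iff. exists (a, b). split; auto. apply filter_In. split; auto.
      now apply decb_true.
  - rewrite sum_list_flat_map. eapply Rle_trans; [|apply (Hout H (NoDup_nodup _ _) AH)].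
    apply sum_list_le. intros a Ha. rewrite Forall_forall in AH. rewrite sum_list_map.
    eapply Rle_trans; [|apply Rle_abs]. apply Hin; auto; apply HK.
Qed.

(** Absolute boundedness gives the double sum some value, and summing it along fibres identifies
    this value as [L]. *)
Lemma has_sum_sigma {T U} (A : T -> Prop) (B : T -> U -> Prop) (f : T * U -> R) g M L :
  abs_bounded (sigma_set A B) f M ->
  (forall a, A a -> has_sum (B a) (fun b => f (a, b)) (g a)) ->
  has_sum A g L -> has_sum (sigma_set A B) f L.
Proof.
  intros Hb Hg HL. destruct (abs_bounded_summable _ _ _ Hb) as [L' HL'].
  rewrite (has_sum_unique A g L L'); auto. eapply has_sum_sigma_outer; eauto.
Qed.

Lemma has_sum_sigma_nonneg {T U} (A : T -> Prop) (B : T -> U -> Prop) (f : T * U -> R) g L :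
  (forall a b, A a -> B a b -> 0 <= f (a, b)) ->
  (forall a, A a -> has_sum (B a) (fun b => f (a, b)) (g a)) ->
  has_sum A g L -> has_sum (sigma_set A B) f L.
Proof.
  intros Hf Hg HL.
  assert (Hg0 : forall a, A a -> 0 <= g a).
  { intros a Ha. apply (has_sum_partial_le (B a) _ _ []) in Hg; auto; constructor. }
  eapply has_sum_sigma; eauto.
  apply (sigma_abs_bounded A B f g L).
  - intros a Ha. apply has_sum_nonneg_abs_bounded; auto.
  - apply has_sum_nonneg_abs_bounded; auto.
Qed.

Lemma has_sum_swap {T U} (A : T -> Prop) (B : T -> U -> Prop) (f : T * U -> R) L :
  has_sum (sigma_set A B) f L ->
  has_sum (fun ba : U * T => A (snd ba) /\ B (snd ba) (fst ba)) (fun ba => f (snd ba, fst ba)) L.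
Proof.
  apply (has_sum_reindex (fun ba : U * T => A (snd ba) /\ B (snd ba) (fst ba)) (sigma_set A B)
     (fun ba => (snd ba, fst ba)) (fun ab => (snd ab, fst ab)) f L).
  - intros [b a] [H1 H2]; simpl in *; split; [split|]; auto.
  - intros [a b] [H1 H2]; simpl in *; split; [split|]; auto.
Qed.

Lemma tsum_has_sum {T} (A : T -> Prop) f l : has_sum A f l -> tsum A f = l.
Proof.
  intros H. apply (has_sum_unique A f); auto.
  apply (epsilon_spec (inhabits 0) (fun l => has_sum A f l)). exists l; auto.
Qed.

Lemma has_sum_disjoint_union {T} (A B C : T -> Prop) f l m :
  (forall x, A x -> ~ B x) -> (forall x, C x <-> A x \/ B x) ->
  has_sum A f l -> has_sum B f m -> has_sum C f (l + m).
Proof.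
  intros Hdis HC HA HB.
  assert (H : forall (P : T -> Prop) k, (forall x, P x -> C x) -> has_sum P f k ->
     has_sum C (fun x => if decb (P x) then f x else 0) k).
  { intros P k HP Hk. apply (has_sum_support P); auto.
    - intros x _ Hx. destruct (decb (P x)) eqn:E; auto. now apply -> decb_true in E.
    - apply (has_sum_eq _ f); auto. intros x Hx. now rewrite (proj2 (decb_true _) Hx). }
  apply (has_sum_eq _ (fun x => (if decb (A x) then f x else 0) + (if decb (B x) then f x else 0))).
  - intros x Hx. destruct (decb (A x)) eqn:EA, (decb (B x)) eqn:EB; try ring.
    + apply -> decb_true in EA. apply -> decb_true in EB. now apply Hdis in EA.
    + exfalso. apply HC in Hx. destruct Hx as [Hx|Hx]; apply <- decb_true in Hx; congruence.
  - apply has_sum_plus; apply H; auto; intros; apply HC; auto.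
Qed.

Lemma has_sum_diff {T} (A B : T -> Prop) f l m : (forall x, B x -> A x) ->
  has_sum A f l -> has_sum B f m -> has_sum (fun x => A x /\ ~ B x) f (l - m).
Proof.
  intros HBA HA HB. destruct (has_sum_abs_bounded _ _ _ HA) as [M HM].
  destruct (abs_bounded_summable (fun x => A x /\ ~ B x) f M) as [k Hk].
  { apply (abs_bounded_sub _ A); auto. tauto. }
  replace (l - m) with k; auto.
  enough (l = k + m) by lra. apply (has_sum_unique A f); auto.
  apply (has_sum_disjoint_union (fun x => A x /\ ~ B x) B); auto; [tauto|].
  intros x. specialize (HBA x). destruct (classic (B x)); tauto.
Qed.

(** * Determinants *)

Module DetBridge.
Import all_boot all_algebra Rstruct.
Import GRing.Theory.
Local Open Scope ring_scope.

Definition mx n (M : nat -> nat -> R) : 'M[R]_n := \matrix_(i < n, j < n) M i j.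

Lemma sumN_big k (f : nat -> R) : sumN k f = \sum_(i < k) f i.
Proof.
elim: k => [|k IH]; first by rewrite big_ord0.
by rewrite big_ord_recr /= IH.
Qed.

(** The column skipping of the Laplace expansion is [bump]. The identification gives [det] the
    transposition, multiplicativity and alternation of [\det]. *)
Lemma det_mx n (M : nat -> nat -> R) : det n M = \det (mx n M).
Proof.
elim: n M => [|n IH] M; first by rewrite det_mx00.
rewrite (expand_det_row _ ord0).
transitivity (sumN n.+1 (fun j => (pow (Ropp 1%R) j * M O j *
             det n (fun i k => M i.+1 (if Nat.ltb k j then k else k.+1)))%R)); first by [].
rewrite sumN_big; apply: eq_bigr => j _.
rewrite IH /cofactor mxE /= RpowE add0n [RHS]mulrA.
transitivity ((-1) ^+ j * M 0%N j * \det (mx n (fun i k => M i.+1 (if Nat.ltb k j then k else k.+1)))); first by [].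
rewrite [in LHS](mulrC _ (M _ _)); congr (_ * _ * \det _); apply/matrixP => i k; rewrite !mxE /=; congr (M _ _).
rewrite /bump; case: Nat.ltb_spec => /ssrnat.leP.
  by rewrite ltnNge; case: (j <= k)%N.
by move=> ->.
Qed.

Lemma det_tr n (M : nat -> nat -> R) : det n (fun i j => M j i) = det n M.
Proof.
rewrite !det_mx -det_tr; congr (\det _); apply/matrixP => i j; by rewrite !mxE.
Qed.

Lemma det_equal_rows n (M : nat -> nat -> R) i1 i2 :
  (i1 < n)%coq_nat -> (i2 < n)%coq_nat -> i1 <> i2 ->
  (forall j, (j < n)%coq_nat -> M i1 j = M i2 j) -> det n M = 0.
Proof.
move=> /ssrnat.ltP h1 /ssrnat.ltP h2 ne H; rewrite det_mx.
apply: (determinant_alternate (i1 := Ordinal h1) (i2 := Ordinal h2)).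
  by apply/eqP => -[].
by move=> j; rewrite !mxE /=; apply: H; apply/ssrnat.ltP.
Qed.

(** The backward difference operator acting on rows. *)
Definition dn n : 'M[R]_n :=
  \matrix_(i < n, j < n) ((i == j)%:R - (i == j.+1 :> nat)%:R).

Lemma det_dn n : \det (dn n) = 1.
Proof.
have H : is_trig_mx (dn n).
  apply/is_trig_mxP => i j lij; rewrite mxE.
  have -> : (i == j) = false by apply/negbTE; rewrite neq_ltn lij.
  have -> : (i == j.+1 :> nat) = false.
    by apply/negbTE; rewrite neq_ltn ltnS (ltnW lij).
  by rewrite subrr.
rewrite (det_trig H) big1 // => i _; rewrite mxE eqxx.
have -> : (i == i.+1 :> nat) = false by apply/negbTE; rewrite neq_ltn ltnSn.
by rewrite subr0.
Qed.

Lemma dn_mul n p (A : 'M[R]_(n, p)) i j :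
  (dn n *m A) i j = A i j - (if i == 0 :> nat then 0 else \sum_(k < n | k == i.-1 :> nat) A k j).
Proof.
rewrite mxE.
transitivity (\sum_k ((i == k)%:R * A k j - (i == k.+1 :> nat)%:R * A k j)).
  by apply: eq_bigr => k _; rewrite mxE mulrBl.
rewrite sumrB; congr (_ - _).
  rewrite (bigD1 i) //= eqxx mul1r big1 ?addr0 // => k; rewrite eq_sym => /negbTE ->.
  by rewrite mul0r.
case: eqP => [i0|/eqP i0].
  by rewrite big1 // => k _; rewrite i0 mul0r.
rewrite [RHS]big_mkcond /=; apply: eq_bigr => k _.
rewrite -{1}(prednK (n := i)) ?lt0n // eqSS eq_sym; case: eqP => _; by rewrite ?mul1r ?mul0r.
Qed.

(** Sums of [p] over the interval between consecutive [x]-coordinates are such differences of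
    distribution functions, so this evaluates the sum over interlacing [y]. *)
Lemma det_rowdiff n (M : nat -> nat -> R) :
  det n (fun i j => (M i j - (if Nat.eqb i 0 then 0 else M i.-1 j))%R) = det n M.
Proof.
rewrite !det_mx -[RHS]mul1r -{1}(det_dn n) -det_mulmx; congr (\det _).
apply/matrixP => i j; rewrite dn_mul !mxE.
congr (_ - _); case: (i == 0 :> nat) / eqP => [->|i0] //=.
case: Nat.eqb_spec => // _.
have h : (i.-1 < n)%N by apply: leq_ltn_trans (leq_pred _) _.
rewrite (big_pred1 (Ordinal h)) ?mxE // => k; by rewrite -val_eqE.
Qed.

(* Left multiplication by the difference matrix [dn] inverts the lower
   triangular matrix of ones, so after subtracting [dn] times the top block
   rows the bottom left block vanishes and the bottom right one is [1]. *)
Lemma det_block_rowdiff n (A F : nat -> nat -> R) :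
  det (2 * n)%coq_nat (fun i j =>
    if Nat.ltb i n then
      (if Nat.ltb j n then A i j else (F i (j - n)%coq_nat - (if Nat.leb (j - n)%coq_nat i then 1 else 0))%R)
    else
      (if Nat.ltb j n then (A (i - n)%coq_nat j - (if Nat.eqb (i - n)%coq_nat 0 then 0 else A (i - n)%coq_nat.-1 j))%R
       else (F (i - n)%coq_nat (j - n)%coq_nat
             - (if Nat.eqb (i - n)%coq_nat 0 then 0 else F (i - n)%coq_nat.-1 (j - n)%coq_nat))%R)) = det n A.
Proof.
set M := (fun i j => _).
rewrite (_ : (2 * n)%coq_nat = (n + n)%N); last by rewrite -[LHS]/(2 * n)%N mul2n addnn.
rewrite !det_mx.
pose T : 'M[R]_n := \matrix_(i, j) (j <= i)%:R.
have hT : dn n *m T = 1%:M.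
  apply/matrixP => i j; rewrite dn_mul !mxE; case: eqP => [i0|/eqP i0].
    by rewrite subr0 i0 leqn0 -(inj_eq val_inj) /= i0 eq_sym.
  have h : (i.-1 < n)%N by apply: leq_ltn_trans (leq_pred _) _.
  rewrite (big_pred1 (Ordinal h)); last by move=> k; rewrite /= -val_eqE.
  rewrite mxE /= -(inj_eq val_inj) /= -[in LHS](prednK (n := i)) ?lt0n // leq_eqVlt ltnS.
  rewrite -[in RHS](prednK (n := i)) ?lt0n // [RHS]/= eq_sym.
  case: eqP => [<-|] /=; last by rewrite subrr.
  by rewrite ltnn subr0.
have hM : mx (n + n) M = block_mx (mx n A) (mx n F - T) (dn n *m mx n A) (dn n *m mx n F).
  apply/matrixP => i j.
  have hs (k : 'I_n) : Nat.ltb k n by apply/Nat.ltb_spec0; apply/ssrnat.ltP.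
  have hr (k : 'I_n) : Nat.ltb (n + k)%N n = false.
    by apply/Nat.ltb_spec0 => /ssrnat.ltP; rewrite ltnNge leq_addr.
  have hk (k : 'I_n) : (n + k - n)%coq_nat = k by rewrite -[LHS]/(n + k - n)%N addKn.
  have hd (B : nat -> nat -> R) (k l : 'I_n) : (dn n *m mx n B) k l =
       (B k l - (if Nat.eqb k 0 then 0 else B k.-1 l))%R.
    rewrite dn_mul !mxE; congr (_ - _); case: (k == 0 :> nat) / eqP => [->|k0] //=.
    case: Nat.eqb_spec => // _.
    have h : (k.-1 < n)%N by apply: leq_ltn_trans (leq_pred _) _.
    rewrite (big_pred1 (Ordinal h)) ?mxE // => m; by rewrite -val_eqE.
  rewrite -[i]splitK -[j]splitK.
  case: (split i) => k; case: (split j) => l /=;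
    rewrite ?block_mxEul ?block_mxEur ?block_mxEdl ?block_mxEdr ?hd mxE /M /= ?hs ?hr ?hk ?mxE //.
  congr (_ - _); case: Nat.leb_spec0 => /ssrnat.leP; first by move=> ->.
  by move=> /negbTE ->.
have -> : \det (mx (n + n) M) =
   \det (block_mx 1%:M 0 (- dn n) 1%:M *m mx (n + n) M).
  by rewrite det_mulmx det_lblock !det1 !mul1r.
rewrite hM mulmx_block !mul0mx !mul1mx !addr0.
rewrite (_ : - dn n *m mx n A + dn n *m mx n A = 0); last by rewrite mulNmx addNr.
rewrite (_ : - dn n *m (mx n F - T) + dn n *m mx n F = 1%:M); last first.
  by rewrite mulmxBr !mulNmx hT opprK addrAC addNr add0r.
by rewrite det_ublock det1 mulr1.
Qed.

(** The transpose of [dn] takes differences with the next row, as needed for tails over the interval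
    from one [y]-coordinate to the next. *)
Lemma det_rowdiff_up n (M : nat -> nat -> R) :
  det n (fun i j => (M i j - (if Nat.eqb i.+1 n then 0 else M i.+1 j))%R) = det n M.
Proof.
rewrite !det_mx -[RHS]mul1r -{1}(det_dn n) -(matrix.det_tr (dn n)) -det_mulmx; congr (\det _).
apply/matrixP => i j; rewrite mxE [RHS]mxE.
transitivity (\sum_k ((i == k)%:R * mx n M k j - (k == i.+1 :> nat)%:R * mx n M k j)).
  rewrite sumrB.
  congr (_ - _).
    rewrite (bigD1 i) //= eqxx mul1r big1 ?addr0 ?mxE // => k; rewrite eq_sym => /negbTE ->.
    by rewrite mul0r.
  case: Nat.eqb_spec => [hn|/eqP hn].
    rewrite big1 // => k _.
    have -> : (k == i.+1 :> nat) = false by apply/negbTE; rewrite neq_ltn hn ltn_ord.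
    by rewrite mul0r.
  have h : (i.+1 < n)%N by rewrite ltn_neqAle hn ltn_ord.
  rewrite (bigD1 (Ordinal h)) //= eqxx mul1r big1 ?addr0 ?mxE // => k.
  by rewrite -(inj_eq val_inj) /= => /negbTE ->; rewrite mul0r.
by apply: eq_bigr => k _; rewrite !mxE mulrBl eq_sym.
Qed.

End DetBridge.

Lemma sumN_ext k f g : (forall j, (j < k)%nat -> f j = g j) -> sumN k f = sumN k g.
Proof. induction k; intros H; simpl; auto. rewrite IHk, H; auto with arith. Qed.

Lemma sumN_le k f g : (forall j, (j < k)%nat -> f j <= g j) -> sumN k f <= sumN k g.
Proof. induction k; intros H; simpl; [lra|]. apply Rplus_le_compat; auto with arith. Qed.

Lemma sumN_plus k f g : sumN k (fun j => f j + g j) = sumN k f + sumN k g.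
Proof. induction k; simpl; [lra|]. rewrite IHk; lra. Qed.

Lemma sumN_scal k c f : sumN k (fun j => c * f j) = c * sumN k f.
Proof. induction k; simpl; [lra|]. rewrite IHk; lra. Qed.

Lemma sumN_zero k f : (forall j, (j < k)%nat -> f j = 0) -> sumN k f = 0.
Proof. induction k; intros H; simpl; [lra|]. rewrite IHk, H; auto with arith; lra. Qed.

Lemma sumN_nonneg k f : (forall j, (j < k)%nat -> 0 <= f j) -> 0 <= sumN k f.
Proof. intros H. rewrite <- (sumN_zero k (fun _ => 0)) by auto. now apply sumN_le. Qed.

Lemma sumN_Rabs k f : Rabs (sumN k f) <= sumN k (fun j => Rabs (f j)).
Proof.
  induction k; simpl; [rewrite Rabs_R0; lra|].
  eapply Rle_trans; [apply Rabs_triang|]. lra.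
Qed.

Lemma sumN_first k f : sumN (S k) f = f O + sumN k (fun j => f (S j)).
Proof. induction k; simpl in *; [lra|]. rewrite IHk. lra. Qed.

Lemma sumN_exchange k l f :
  sumN k (fun i => sumN l (fun j => f i j)) = sumN l (fun j => sumN k (fun i => f i j)).
Proof.
  induction k; simpl.
  - symmetry. apply sumN_zero; auto.
  - rewrite IHk, <- sumN_plus. reflexivity.
Qed.

(* Laplace expansion with signs [s ^ j]: the determinant for [s = -1], the
   permanent for [s = 1]. *)
Fixpoint gdet (s : R) (n : nat) (M : nat -> nat -> R) : R :=
  match n with
  | O => 1
  | S m => sumN (S m) (fun j =>
             s ^ j * M O j *
             gdet s m (fun i k => M (S i) (if Nat.ltb k j then k else S k)))
  end.

Lemma gdet_S s m M : gdet s (S m) M =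
  sumN (S m) (fun j => s ^ j * M O j *
             gdet s m (fun i k => M (S i) (if Nat.ltb k j then k else S k))).
Proof. reflexivity. Qed.

Lemma det_gdet n M : det n M = gdet (-1) n M.
Proof.
  revert M. induction n; intros M; [reflexivity|].
  rewrite gdet_S. simpl det. apply (sumN_ext (S n)).
  intros j _. rewrite IHn. reflexivity.
Qed.

Lemma skip_lt k j m : (k < m)%nat -> ((if Nat.ltb k j then k else S k) < S m)%nat.
Proof. destruct (Nat.ltb_spec k j); lia. Qed.

Lemma gdet_ext s n M M' :
  (forall i j, (i < n)%nat -> (j < n)%nat -> M i j = M' i j) -> gdet s n M = gdet s n M'.
Proof.
  revert M M'. induction n; intros M M' H; [reflexivity|].
  rewrite !gdet_S. apply sumN_ext. intros j Hj. rewrite H; auto with arith. f_equal.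
  apply IHn. intros i k Hi Hk. apply H; [lia|]. now apply skip_lt.
Qed.

Lemma det_ext n M M' :
  (forall i j, (i < n)%nat -> (j < n)%nat -> M i j = M' i j) -> det n M = det n M'.
Proof. rewrite !det_gdet. apply gdet_ext. Qed.

Definition row_set (M : nat -> nat -> R) (k : nat) (r : nat -> R) (i j : nat) : R :=
  if Nat.eqb i k then r j else M i j.

Lemma det_row_set_linear n M k a b r r' : (k < n)%nat ->
  det n (row_set M k (fun j => a * r j + b * r' j)) =
  a * det n (row_set M k r) + b * det n (row_set M k r').
Proof.
  rewrite !det_gdet. revert M k r r'. induction n; intros M k r r' Hk; [lia|].
  rewrite !gdet_S, <- !sumN_scal, <- sumN_plus. apply sumN_ext. intros j Hj.
  destruct k as [|k]; [unfold row_set; simpl Nat.eqb; cbv iota; ring|].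
  pose proof (IHn (fun i k0 => M (S i) (if Nat.ltb k0 j then k0 else S k0)) k
    (fun k0 => r (if Nat.ltb k0 j then k0 else S k0))
    (fun k0 => r' (if Nat.ltb k0 j then k0 else S k0)) ltac:(lia)) as E.
  unfold row_set in *. simpl Nat.eqb. cbv iota. rewrite E. ring.
Qed.

Lemma det_row_set_id n M k : det n (row_set M k (M k)) = det n M.
Proof.
  apply det_ext. intros i j _ _. unfold row_set.
  destruct (Nat.eqb_spec i k); subst; auto.
Qed.

Lemma derivable_pt_lim_sumN k (f : nat -> R -> R) (f' : nat -> R) t :
  (forall j, (j < k)%nat -> derivable_pt_lim (f j) t (f' j)) ->
  derivable_pt_lim (fun s => sumN k (fun j => f j s)) t (sumN k f').
Proof.
  induction k; intros H; simpl; [apply derivable_pt_lim_const|].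
  apply (derivable_pt_lim_plus (fun s => sumN k (fun j => f j s)) (f k)); auto with arith.
Qed.

Lemma det_derive n (M : R -> nat -> nat -> R) M' t :
  (forall i j, (i < n)%nat -> (j < n)%nat ->
     derivable_pt_lim (fun s => M s i j) t (M' i j)) ->
  derivable_pt_lim (fun s => det n (M s)) t
    (sumN n (fun k => det n (row_set (M t) k (M' k)))).
Proof.
  revert M M'. induction n; intros M M' H; [apply derivable_pt_lim_const|].
  set (mn := fun (j : nat) (A : nat -> nat -> R) (i k : nat) =>
               A (S i) (if Nat.ltb k j then k else S k)).
  assert (Hd : forall A, det (S n) A = sumN (S n) (fun j => (-1) ^ j * A O j * det n (mn j A)))
    by reflexivity.
  replace (sumN (S n) _) with (sumN (S n) (fun j =>
     ((-1) ^ j * M' O j) * det n (mn j (M t)) +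
     ((-1) ^ j * M t O j) * sumN n (fun k => det n (row_set (mn j (M t)) k (mn j M' k))))).
  - apply (derivable_pt_lim_sumN (S n) (fun j s => (-1) ^ j * M s O j * det n (mn j (M s)))).
    intros j Hj.
    apply (derivable_pt_lim_mult (fun s => (-1) ^ j * M s O j) (fun s => det n (mn j (M s)))).
    + apply derivable_pt_lim_scal. apply H; lia.
    + apply (IHn (fun s => mn j (M s)) (mn j M')). intros i k Hi Hk. apply H; [lia|].
      now apply skip_lt.
  - rewrite sumN_plus. symmetry. rewrite sumN_first. symmetry. f_equal.
    rewrite (sumN_ext (S n) (fun j => (-1) ^ j * M t 0%nat j * _)
        (fun j => sumN n (fun k => (-1) ^ j * M t 0%nat j * det n (row_set (mn j (M t)) k (mn j M' k)))))
        by (intros; symmetry; apply sumN_scal).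
    rewrite sumN_exchange. apply sumN_ext. intros k _. rewrite Hd. apply sumN_ext.
    intros j _. unfold row_set, mn. simpl Nat.eqb. reflexivity.
Qed.

Definition weight (f : Z -> R) (l : list Z) : R := fold_right (fun z acc => f z * acc) 1 l.

Fixpoint prodN (k : nat) (a : nat -> R) : R :=
  match k with O => 1 | S k' => a O * prodN k' (fun i => a (S i)) end.

Lemma prodN_weight f l : prodN (length l) (fun i => f (xi l i)) = weight f l.
Proof. induction l as [|z l IH]; simpl; [reflexivity|]. now rewrite <- IH. Qed.

(** In a block matrix the weights act on the last [n] rows or columns only; the first [k] carry the
    factor 1. *)
Lemma prodN_tail k n b :
  prodN (k + n) (fun i => if Nat.ltb i k then 1 else b (i - k)%nat) = prodN n b.
Proof.
  induction k as [|k IH].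
  - enough (H : forall b' n, (forall i, b' i = b i) -> prodN n b' = prodN n b).
    { apply H. intros i. simpl. now rewrite Nat.sub_0_r. }
    clear n. intros b' n. revert b b'. induction n as [|n IH]; intros b b' H; simpl; [reflexivity|].
    rewrite H. f_equal. now apply IH.
  - rewrite <- IH. simpl. rewrite Rmult_1_l. reflexivity.
Qed.

Lemma det_scale_rows n a M : det n (fun i j => a i * M i j) = prodN n a * det n M.
Proof.
  revert a M. induction n as [|n IH]; intros a M; [simpl; ring|].
  rewrite !det_gdet, !gdet_S, <- sumN_scal. apply sumN_ext. intros j _.
  pose proof (IH (fun i => a (S i)) (fun i k => M (S i) (if Nat.ltb k j then k else S k))) as E.
  rewrite !det_gdet in E. rewrite E. simpl prodN. ring.
Qed.

Lemma det_scale_cols n a M : det n (fun i j => a j * M i j) = prodN n a * det n M.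
Proof.
  rewrite <- (DetBridge.det_tr _ M), <- det_scale_rows, <- DetBridge.det_tr. reflexivity.
Qed.

Lemma gdet_abs s n M : Rabs s = 1 -> Rabs (gdet s n M) <= gdet 1 n (fun i j => Rabs (M i j)).
Proof.
  intros Hs. revert M. induction n; intros M; [simpl; rewrite Rabs_R1; lra|].
  rewrite !gdet_S. eapply Rle_trans; [apply sumN_Rabs|]. apply sumN_le. intros j _.
  rewrite !Rabs_mult, <- RPow_abs, Hs, !pow1, !Rmult_1_l.
  apply Rmult_le_compat_l; [apply Rabs_pos|]. apply IHn.
Qed.

Lemma perm_nonneg n M : (forall i j, (i < n)%nat -> (j < n)%nat -> 0 <= M i j) -> 0 <= gdet 1 n M.
Proof.
  revert M. induction n; intros M H; [simpl; lra|].
  rewrite gdet_S. rewrite <- (sumN_zero (S n) (fun _ => 0)) by auto. apply sumN_le.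
  intros j Hj. rewrite pow1, Rmult_1_l. apply Rmult_le_pos; [apply H; lia|].
  apply IHn. intros i k Hi Hk. apply H; [lia|]. now apply skip_lt.
Qed.

Lemma perm_le n M M' :
  (forall i j, (i < n)%nat -> (j < n)%nat -> 0 <= M i j <= M' i j) -> gdet 1 n M <= gdet 1 n M'.
Proof.
  revert M M'. induction n; intros M M' H; [simpl; lra|].
  rewrite !gdet_S. apply sumN_le. intros j Hj. rewrite !pow1, !Rmult_1_l.
  assert (Hs : forall i k, (i < n)%nat -> (k < n)%nat ->
     0 <= M (S i) (if Nat.ltb k j then k else S k) <= M' (S i) (if Nat.ltb k j then k else S k)).
  { intros i k Hi Hk. apply H; [lia|]. now apply skip_lt. }
  apply Rmult_le_compat; [apply H; lia| |apply H; lia|apply IHn; auto].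
  apply perm_nonneg. intros. now apply Hs.
Qed.

(** * Summation of determinants over products of ranges *)

Definition box (n : nat) (A : nat -> Z -> Prop) (l : list Z) : Prop :=
  length l = n /\ forall i, (i < n)%nat -> A i (xi l i).

Lemma has_sum_prod {T U} (A : T -> Prop) (B : U -> Prop) f g l m :
  has_sum A f l -> has_sum B g m ->
  has_sum (sigma_set A (fun _ => B)) (fun ab => f (fst ab) * g (snd ab)) (l * m).
Proof.
  intros Hf Hg.
  destruct (has_sum_abs_bounded _ _ _ Hf) as [Mf HMf].
  destruct (has_sum_abs_bounded _ _ _ Hg) as [Mg HMg].
  apply (has_sum_sigma A (fun _ => B) _ (fun a => f a * m) (Mg * Mf)).
  - apply (sigma_abs_bounded _ _ _ (fun a => Mg * Rabs (f a))).
    + intros a _. simpl. rewrite (Rmult_comm Mg). now apply abs_bounded_scal.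
    + replace (Mg * Mf) with (Rabs Mg * Mf)
        by (rewrite Rabs_pos_eq; auto; eapply abs_bounded_nonneg; exact HMg).
      apply abs_bounded_scal. intros G NG AG.
      rewrite (sum_list_ext _ (fun x => Rabs (f x))) by (intros; apply Rabs_Rabsolu). auto.
  - intros a _. exact (has_sum_scal B g (f a) m Hg).
  - rewrite (Rmult_comm l). eapply has_sum_ext; [reflexivity| |apply has_sum_scal; exact Hf].
    intros; simpl; ring.
Qed.

Lemma has_sum_box_S m A f l :
  has_sum (sigma_set (A O) (fun _ => box m (fun i => A (S i)))) (fun zl => f (fst zl :: snd zl)) l ->
  has_sum (box (S m) A) f l.
Proof.
  intros H.
  apply (has_sum_reindex (box (S m) A) _ (fun l => (hd 0%Z l, tl l)) (fun zl => fst zl :: snd zl)) in H.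
  - eapply has_sum_ext; [reflexivity| |exact H]. intros [|z k] [Hl _]; [discriminate|reflexivity].
  - intros [|z k] [Hl Hk]; [discriminate|]. split; [|reflexivity].
    split; [apply (Hk O); lia|]. split; [simpl in *; lia|].
    intros i Hi. apply (Hk (S i)); lia.
  - intros [z k] [Hz [Hl Hk]]. simpl in *. split; [|reflexivity]. split; [simpl; lia|].
    intros [|i] Hi; [exact Hz|]. apply (Hk i); lia.
Qed.

(** Row [i] contains only coordinate [i] of the summation variable, so expansion along the first row
    splits the sum into products. Keeping [s] general gives permanents the same identity, hence
    absolute majorants. *)
Lemma has_sum_gdet s n A (h : nat -> Z -> nat -> R) L :
  (forall i j, (i < n)%nat -> (j < n)%nat -> has_sum (A i) (fun z => h i z j) (L i j)) ->
  has_sum (box n A) (fun l => gdet s n (fun i j => h i (xi l i) j)) (gdet s n L).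
Proof.
  revert A h L. induction n; intros A h L H.
  - apply (has_sum_singleton (box 0 A) (fun _ => 1) []).
    + split; auto. intros; lia.
    + intros [|] [Hl _] Hn; [congruence|discriminate].
  - apply has_sum_box_S. rewrite gdet_S.
    apply (has_sum_sumN _ (fun j zl => s ^ j * h O (fst zl) j *
       gdet s n (fun i k => h (S i) (xi (snd zl) i) (if Nat.ltb k j then k else S k)))).
    intros j Hj. apply (has_sum_prod _ _ (fun z => s ^ j * h O z j)
      (fun l => gdet s n (fun i k => h (S i) (xi l i) (if Nat.ltb k j then k else S k)))).
    + apply has_sum_scal. apply H; lia.
    + apply (IHn (fun i => A (S i)) (fun i z k => h (S i) z (if Nat.ltb k j then k else S k))
        (fun i k => L (S i) (if Nat.ltb k j then k else S k))).
      intros i k Hi Hk. apply H; [lia|]. now apply skip_lt.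
Qed.

(** The first [k] rows are constants of the sum; expanding along them reduces to the case without
    fixed rows. *)
Lemma has_sum_gdet_bottom s k n A M (h : nat -> Z -> nat -> R) L :
  (forall i j, (i < n)%nat -> (j < k + n)%nat -> has_sum (A i) (fun z => h i z j) (L i j)) ->
  has_sum (box n A)
    (fun l => gdet s (k + n) (fun i j =>
       if Nat.ltb i k then M i j else h (i - k)%nat (xi l (i - k)) j))
    (gdet s (k + n) (fun i j => if Nat.ltb i k then M i j else L (i - k)%nat j)).
Proof.
  revert M h L. induction k; intros M h L H.
  - eapply has_sum_ext; [reflexivity| |].
    2: { rewrite (gdet_ext s (0 + n) _ L); [now apply (has_sum_gdet s n A h L)|].
         intros; simpl. now rewrite Nat.sub_0_r. }
    intros l _. apply gdet_ext. intros; simpl. now rewrite Nat.sub_0_r.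
  - change (S k + n)%nat with (S (k + n)). rewrite gdet_S.
    apply (has_sum_sumN _ (fun j l => s ^ j * M O j * gdet s (k + n) (fun i k0 =>
       if Nat.ltb i k then M (S i) (if Nat.ltb k0 j then k0 else S k0)
       else h (i - k)%nat (xi l (i - k)) (if Nat.ltb k0 j then k0 else S k0)))).
    intros j Hj. apply has_sum_scal.
    apply (IHk (fun i k0 => M (S i) (if Nat.ltb k0 j then k0 else S k0))
      (fun i z k0 => h i z (if Nat.ltb k0 j then k0 else S k0))
      (fun i k0 => L i (if Nat.ltb k0 j then k0 else S k0))).
    intros i k0 Hi Hk. apply H; [lia|]. now apply (skip_lt k0 j (k + n)).
Qed.

(** The determinant is dominated by the permanent of the absolute values. The sum of the latter is
    again a permanent, with summed bottom rows, and permanents of nonnegative matrices are monotone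
    in the entries. *)
Lemma det_bottom_abs_bounded k n A M (h : nat -> Z -> nat -> R) C :
  (forall i j, (i < k)%nat -> (j < k + n)%nat -> Rabs (M i j) <= C) ->
  (forall i j, (i < n)%nat -> (j < k + n)%nat -> abs_bounded (A i) (fun z => h i z j) C) ->
  abs_bounded (box n A)
    (fun l => det (k + n) (fun i j =>
       if Nat.ltb i k then M i j else h (i - k)%nat (xi l (i - k)) j))
    (gdet 1 (k + n) (fun _ _ => C)).
Proof.
  intros HM Hh.
  assert (HL : forall i j, exists l, (i < n)%nat -> (j < k + n)%nat ->
    has_sum (A i) (fun z => Rabs (h i z j)) l).
  { intros i j. destruct (classic ((i < n)%nat /\ (j < k + n)%nat)) as [[Hi Hj]|Hn]; [|exists 0; tauto].
    destruct (nonneg_summable (A i) (fun z => Rabs (h i z j)) C) as [l Hl].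
    - intros; apply Rabs_pos.
    - apply Hh; auto.
    - exists l; auto. }
  set (L := fun i j => epsilon (inhabits 0) (fun l => (i < n)%nat -> (j < k + n)%nat ->
    has_sum (A i) (fun z => Rabs (h i z j)) l)).
  assert (HLs : forall i j, (i < n)%nat -> (j < k + n)%nat ->
    has_sum (A i) (fun z => Rabs (h i z j)) (L i j)).
  { intros i j Hi Hj. apply (epsilon_spec (inhabits 0) _ (HL i j)); auto. }
  pose proof (has_sum_gdet_bottom 1 k n A (fun i j => Rabs (M i j)) (fun i z j => Rabs (h i z j)) L HLs) as H.
  apply has_sum_nonneg_abs_bounded in H.
  2: { intros l _. apply perm_nonneg. intros. destruct (Nat.ltb i k); apply Rabs_pos. }
  intros G NG AG. eapply Rle_trans; [|eapply Rle_trans; [apply (H G NG AG)|]].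
  - apply sum_list_le. intros l _. rewrite det_gdet. eapply Rle_trans; [apply gdet_abs|].
    + rewrite Rabs_left; lra.
    + eapply Rle_trans; [|apply Rle_abs]. right. apply gdet_ext. intros i j _ _.
      destruct (Nat.ltb i k); reflexivity.
  - apply perm_le. intros i j Hi Hj. destruct (Nat.ltb_spec i k).
    + split; [apply Rabs_pos|auto].
    + assert (Hi' : (i - k < n)%nat) by lia. split.
      * pose proof (has_sum_partial_le (A (i - k)%nat) _ _ [] (fun x _ => Rabs_pos _) (HLs _ _ Hi' Hj)
          (NoDup_nil _) (Forall_nil _)). exact H1.
      * eapply has_sum_upper; [apply (HLs _ _ Hi' Hj)|]. apply (Hh _ _ Hi' Hj).
Qed.

(** * Maximum principles *)

Definition right_cont0 (f : R -> R) : Prop :=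
  forall eps, 0 < eps -> exists d, 0 < d /\ forall t, 0 < t < d -> Rabs (f t - f 0) < eps.

Lemma min_on_interval f T : 0 <= T -> right_cont0 f ->
  (forall t, 0 < t -> continuity_pt f t) ->
  exists m, 0 <= m <= T /\ forall t, 0 <= t <= T -> f m <= f t.
Proof.
  intros HT H0 Hc.
  (* Freezing [f] at its initial value for negative times turns continuity from the right at 0 into
     two-sided continuity. *)
  destruct (continuity_ab_min (fun t => f (Rmax 0 t)) 0 T HT) as (m & Hm & HmT).
  - intros c Hc'. intros eps He. simpl. unfold R_dist.
    destruct (Rle_lt_dec c 0) as [Hc0|Hc0].
    + assert (c = 0) by lra; subst c. destruct (H0 eps He) as (d & Hd & H).
      exists d. split; auto. intros x [_ Hx]. rewrite (Rmax_left 0 0) by lra.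
      rewrite Rminus_0_r in Hx. apply Rabs_def2 in Hx.
      unfold Rmax. destruct (Rle_dec 0 x) as [Hx0|Hx0].
      * destruct Hx0 as [Hx0|Hx0]; [apply H; lra|]. subst x.
        rewrite Rminus_diag, Rabs_R0; auto.
      * rewrite Rminus_diag, Rabs_R0; auto.
    + destruct (Hc c Hc0 eps He) as (a & Ha & H). simpl in H. unfold R_dist in H.
      exists (Rmin a c). split; [apply Rmin_glb_lt; auto|]. intros x [_ Hx].
      pose proof (Rmin_l a c). pose proof (Rmin_r a c). assert (Hx' := Hx).
      apply Rabs_def2 in Hx'.
      rewrite !Rmax_right by lra.
      destruct (Req_dec c x) as [->|Hne]; [rewrite Rminus_diag, Rabs_R0; auto|].
      apply H. split; [split; [exact I|auto]|lra].
  - exists m. split; auto. intros t Ht. specialize (Hm t Ht).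
    now rewrite !Rmax_right in Hm by lra.
Qed.

Lemma finite_argmin {X} (P : X -> Prop) (L : list X) (f : X -> R) x0 :
  (forall x, P x -> In x L) -> P x0 -> exists m, P m /\ forall y, P y -> f m <= f y.
Proof.
  intros HL H0.
  assert (H : exists m, P m /\ forall y, In y L -> P y -> f m <= f y).
  { clear HL. induction L as [|a L (m & Hm & IH)].
    - exists x0. split; auto. intros y [].
    - destruct (classic (P a /\ f a <= f m)) as [[Ha Hle]|Hn].
      + exists a. split; auto. intros y [<-|Hy] Py; [lra|]. specialize (IH y Hy Py). lra.
      + exists m. split; auto. intros y [<-|Hy] Py; auto.
        apply Rnot_lt_le. intros Hlt. apply Hn. split; auto. lra. }
  destruct H as (m & Hm & H). exists m. split; auto.
Qed.

(** At a space-time minimum of the tilted function [u + e t] at a positive time, left difference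
    quotients of [u] are at most [- e], whereas the last hypothesis on [du] forces a nonnegative
    derivative there. *)
Lemma max_principle {X} (P : X -> Prop) (L : list X) (u du : R -> X -> R) :
  (forall x, P x -> In x L) ->
  (forall x, P x -> 0 <= u 0 x) ->
  (forall x, P x -> right_cont0 (fun t => u t x)) ->
  (forall t x, 0 < t -> P x -> derivable_pt_lim (fun s => u s x) t (du t x)) ->
  (forall t x, 0 < t -> P x -> u t x < 0 -> (forall y, P y -> u t x <= u t y) -> 0 <= du t x) ->
  forall t x, 0 <= t -> P x -> 0 <= u t x.
Proof.
  intros HL H0 Hrc Hd Hmin T x HT Px. apply Rnot_lt_le. intros Hneg.
  (* Small enough that the tilted value at [(T, x)] stays negative. *)
  set (e := - u T x / (2 * (T + 1))).
  assert (He : 0 < e) by (apply Rdiv_lt_0_compat; lra).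
  assert (HeT : u T x + e * T < 0).
  { assert (e * (T + 1) = - u T x / 2) by (unfold e; field; lra). nra. }
  set (v := fun s y => u s y + e * s).
  assert (Hm : forall y, exists m, P y -> 0 <= m <= T /\ forall t, 0 <= t <= T -> v m y <= v t y).
  { intros y. destruct (classic (P y)) as [Py|]; [|exists 0; tauto].
    destruct (min_on_interval (fun t => v t y) T HT) as (m & Hm).
    - intros eps Heps. destruct (Hrc y Py (eps / 2)) as (d & Hd0 & Hd1); [lra|].
      exists (Rmin d (eps / (2 * e))). split.
      { apply Rmin_glb_lt; auto. apply Rdiv_lt_0_compat; lra. }
      intros t Ht. pose proof (Rmin_l d (eps / (2 * e))). pose proof (Rmin_r d (eps / (2 * e))).
      specialize (Hd1 t ltac:(lra)). unfold v.
      replace (_ - _) with ((u t y - u 0 y) + e * t) by ring.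
      eapply Rle_lt_trans; [apply Rabs_triang|].
      rewrite (Rabs_pos_eq (e * t)) by (apply Rmult_le_pos; lra).
      assert (Het : e * t <= e * (eps / (2 * e))) by (apply Rmult_le_compat_l; lra).
      replace (e * (eps / (2 * e))) with (eps / 2) in Het by (field; lra). lra.
    - intros t Ht. apply derivable_continuous_pt. exists (du t y + e * 1).
      apply (derivable_pt_lim_plus (fun t => u t y) (fun t => e * t)); [apply Hd; auto|].
      apply (derivable_pt_lim_scal id). apply derivable_pt_lim_id.
    - exists m; auto. }
  set (m := fun y => epsilon (inhabits 0) (fun m => P y -> 0 <= m <= T /\ forall t, 0 <= t <= T -> v m y <= v t y)).
  assert (Hms : forall y, P y -> 0 <= m y <= T /\ forall t, 0 <= t <= T -> v (m y) y <= v t y).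
  { intros y. apply (epsilon_spec (inhabits 0) _ (Hm y)). }
  destruct (finite_argmin P L (fun y => v (m y) y) x HL Px) as (z & Pz & Hz).
  destruct (Hms z Pz) as [Ht0 Htm]. set (t0 := m z) in *.
  assert (Hv : v t0 z < 0).
  { eapply Rle_lt_trans; [apply (Hz x Px)|]. eapply Rle_lt_trans; [apply (proj2 (Hms x Px) T); lra|]. exact HeT. }
  assert (Hpos : 0 < t0).
  { destruct (proj1 Ht0) as [|Heq]; auto. rewrite <- Heq in Hv. unfold v in Hv.
    specialize (H0 z Pz). lra. }
  assert (Hdu : 0 <= du t0 z).
  { apply Hmin; auto.
    - unfold v in Hv. assert (0 <= e * t0) by (apply Rmult_le_pos; lra). lra.
    - intros y Py. specialize (Hz y Py). pose proof (proj2 (Hms y Py) t0 Ht0). unfold v in *.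
      fold t0 in Hz. lra. }
  destruct (Hd t0 z Hpos Pz (e / 2) ltac:(lra)) as [d Hd'].
  (* A backward time step, short enough to stay at positive times and within the radius given by the
     derivative. *)
  set (h := - Rmin (d / 2) (t0 / 2)).
  assert (Hh : 0 < Rmin (d / 2) (t0 / 2)).
  { apply Rmin_glb_lt; [pose proof (cond_pos d)|]; lra. }
  pose proof (Rmin_l (d / 2) (t0 / 2)). pose proof (Rmin_r (d / 2) (t0 / 2)).
  specialize (Hd' h ltac:(unfold h; lra)).
  assert (Habs : Rabs h < d).
  { unfold h. rewrite Rabs_Ropp, Rabs_pos_eq by lra. pose proof (cond_pos d). lra. }
  specialize (Hd' Habs). apply Rabs_def2 in Hd'.
  assert (Hlow : v t0 z <= v (t0 + h) z) by (apply Htm; unfold h; lra).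
  unfold v in Hlow.
  assert (Hq : (u (t0 + h) z - u t0 z) / h <= - e).
  { apply Rmult_le_reg_r with (- h); [unfold h; lra|].
    replace ((u (t0 + h) z - u t0 z) / h * - h) with (- (u (t0 + h) z - u t0 z))
      by (field; unfold h; lra). nra. }
  lra.
Qed.

Lemma right_cont0_plus f g : right_cont0 f -> right_cont0 g -> right_cont0 (fun t => f t + g t).
Proof.
  intros Hf Hg eps He.
  destruct (Hf (eps / 2)) as (d1 & Hd1 & H1); [lra|].
  destruct (Hg (eps / 2)) as (d2 & Hd2 & H2); [lra|].
  exists (Rmin d1 d2). split; [apply Rmin_glb_lt; auto|]. intros t Ht.
  pose proof (Rmin_l d1 d2). pose proof (Rmin_r d1 d2).
  specialize (H1 t ltac:(lra)). specialize (H2 t ltac:(lra)).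
  replace (_ - _) with ((f t - f 0) + (g t - g 0)) by ring.
  eapply Rle_lt_trans; [apply Rabs_triang|]. lra.
Qed.

Lemma right_cont0_derivable f l : derivable_pt_lim f 0 l -> right_cont0 f.
Proof.
  intros H. assert (Hc : continuity_pt f 0) by (apply derivable_continuous_pt; exists l; auto).
  intros eps He. destruct (Hc eps He) as (a & Ha & Hx). exists a. split; auto. intros t Ht.
  apply (Hx t). split; [split; [exact I|lra]|]. simpl. unfold R_dist.
  rewrite Rminus_0_r, Rabs_pos_eq; lra.
Qed.

Lemma right_cont0_const c : right_cont0 (fun _ => c).
Proof. apply (right_cont0_derivable _ 0), derivable_pt_lim_const. Qed.

Lemma right_cont0_mult f g : right_cont0 f -> right_cont0 g -> right_cont0 (fun t => f t * g t).
Proof.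
  intros Hf Hg eps He.
  set (K := Rabs (f 0) + Rabs (g 0) + 2).
  assert (HK : 0 < K) by (unfold K; pose proof (Rabs_pos (f 0)); pose proof (Rabs_pos (g 0)); lra).
  set (e := Rmin 1 (eps / (2 * K))).
  assert (He0 : 0 < e) by (apply Rmin_glb_lt; [lra|apply Rdiv_lt_0_compat; lra]).
  destruct (Hf e He0) as (d1 & Hd1 & H1). destruct (Hg e He0) as (d2 & Hd2 & H2).
  exists (Rmin d1 d2). split; [apply Rmin_glb_lt; auto|]. intros t Ht.
  pose proof (Rmin_l d1 d2). pose proof (Rmin_r d1 d2).
  specialize (H1 t ltac:(lra)). specialize (H2 t ltac:(lra)).
  replace (_ - _) with ((f t - f 0) * (g t - g 0) + f 0 * (g t - g 0) + g 0 * (f t - f 0)) by ring.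
  eapply Rle_lt_trans; [apply Rabs_triang|].
  eapply Rle_lt_trans; [apply Rplus_le_compat_r, Rabs_triang|]. rewrite !Rabs_mult.
  pose proof (Rabs_pos (f 0)). pose proof (Rabs_pos (g 0)).
  pose proof (Rabs_pos (f t - f 0)). pose proof (Rabs_pos (g t - g 0)).
  assert (e <= 1) by apply Rmin_l.
  assert (e * K <= eps / 2).
  { apply Rle_trans with (eps / (2 * K) * K); [apply Rmult_le_compat_r; [lra|apply Rmin_r]|].
    right; field; lra. }
  assert (Rabs (f t - f 0) * Rabs (g t - g 0) <= e * 1) by (apply Rmult_le_compat; lra).
  assert (Rabs (f 0) * Rabs (g t - g 0) <= Rabs (f 0) * e) by (apply Rmult_le_compat_l; lra).
  assert (Rabs (g 0) * Rabs (f t - f 0) <= Rabs (g 0) * e) by (apply Rmult_le_compat_l; lra).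
  unfold K in *. nra.
Qed.

(** Adding [e (W + k t)] makes the function nonnegative wherever [W] exceeds [B / e], so only a
    finite set is left to [max_principle]. The conclusion follows since [e] is arbitrary. *)
Lemma lyapunov_principle {X} (P : X -> Prop) (W : X -> R) (k B : R) (u du : R -> X -> R) :
  0 <= k -> 0 <= B -> (forall x, P x -> 0 <= W x) ->
  (forall b, exists L, forall x, P x -> W x <= b -> In x L) ->
  (forall t x, 0 <= t -> P x -> - B <= u t x) ->
  (forall x, P x -> 0 <= u 0 x) ->
  (forall x, P x -> right_cont0 (fun t => u t x)) ->
  (forall t x, 0 < t -> P x -> derivable_pt_lim (fun s => u s x) t (du t x)) ->
  (forall e t x, 0 < e -> 0 < t -> P x -> u t x + e * (W x + k * t) < 0 ->
     (forall y, P y -> u t x + e * W x <= u t y + e * W y) -> 0 <= du t x + e * k) ->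
  forall t x, 0 <= t -> P x -> 0 <= u t x.
Proof.
  intros Hk HB HW Hfin HuB Hu0 Hrc Hd Hmin.
  assert (Hmain : forall e, 0 < e -> forall t x, 0 <= t -> P x -> 0 <= u t x + e * (W x + k * t)).
  { intros e He.
    assert (Hout : forall t y, 0 <= t -> P y -> B / e < W y -> 0 <= u t y + e * (W y + k * t)).
    { intros t y Ht Py Hy. specialize (HuB t y Ht Py).
      assert (B < e * W y).
      { apply Rmult_lt_compat_l with (r := e) in Hy; auto.
        replace (e * (B / e)) with B in Hy by (field; lra). lra. }
      assert (0 <= e * (k * t)) by (apply Rmult_le_pos; [lra|apply Rmult_le_pos; lra]). lra. }
    destruct (Hfin (B / e)) as [L HL].
    assert (Hin : forall t x, 0 <= t -> P x /\ W x <= B / e -> 0 <= u t x + e * (W x + k * t)).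
    { apply (max_principle (fun x => P x /\ W x <= B / e) L
        (fun t x => u t x + e * (W x + k * t)) (fun t x => du t x + e * k)).
      - intros x [Px Hx]; auto.
      - intros x [Px _]. specialize (Hu0 x Px). specialize (HW x Px).
        assert (0 <= e * W x) by (apply Rmult_le_pos; lra). lra.
      - intros x [Px _]. apply right_cont0_plus; auto.
        apply (right_cont0_derivable _ (e * (0 + k * 1))).
        apply (derivable_pt_lim_scal (fun t => W x + k * t)).
        apply (derivable_pt_lim_plus (fun _ => W x) (fun t => k * t)); [apply derivable_pt_lim_const|].
        apply (derivable_pt_lim_scal id), derivable_pt_lim_id.
      - intros t x Ht [Px _]. apply (derivable_pt_lim_plus (fun s => u s x)); auto.
        replace (e * k) with (e * (0 + k * 1)) by ring.
        apply (derivable_pt_lim_scal (fun t => W x + k * t)).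
        apply (derivable_pt_lim_plus (fun _ => W x) (fun t => k * t)); [apply derivable_pt_lim_const|].
        apply (derivable_pt_lim_scal id), derivable_pt_lim_id.
      - intros t x Ht [Px Hx] Hneg Hle. apply (Hmin e t x); auto. intros y Py.
        destruct (Rle_lt_dec (W y) (B / e)) as [Hy|Hy].
        + specialize (Hle y (conj Py Hy)). lra.
        + specialize (Hout t y (Rlt_le _ _ Ht) Py Hy). lra. }
    intros t x Ht Px. destruct (Rle_lt_dec (W x) (B / e)); auto. }
  intros t x Ht Px. apply Rnot_lt_le. intros Hneg.
  assert (HWx : 0 <= W x + k * t).
  { specialize (HW x Px). assert (0 <= k * t) by (apply Rmult_le_pos; lra). lra. }
  (* For this [e] the correction [e (W x + k t)] is at most half of [- u t x]. *)
  set (e := - u t x / (2 * (W x + k * t + 1))).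
  assert (He : 0 < e) by (apply Rdiv_lt_0_compat; lra).
  specialize (Hmain e He t x Ht Px).
  assert (e * (W x + k * t + 1) = - u t x / 2) by (unfold e; field; lra). nra.
Qed.

(** * Derivatives of limits *)

Lemma derivable_of_quadratic f d K t :
  0 < t -> 0 <= K ->
  (forall h, 0 < t + h -> Rabs (f (t + h) - f t - h * d) <= K * (h * h)) ->
  derivable_pt_lim f t d.
Proof.
  intros Ht HK H eps He.
  assert (Hd : 0 < Rmin (t / 2) (eps / (K + 1))).
  { apply Rmin_glb_lt; [lra|apply Rdiv_lt_0_compat; lra]. }
  exists (mkposreal _ Hd). intros h Hh0 Hh. simpl in Hh.
  pose proof (Rmin_l (t / 2) (eps / (K + 1))). pose proof (Rmin_r (t / 2) (eps / (K + 1))).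
  specialize (H h ltac:(apply Rabs_def2 in Hh; lra)).
  assert (Hp : 0 < Rabs h) by (apply Rabs_pos_lt; auto).
  replace ((f (t + h) - f t) / h - d) with ((f (t + h) - f t - h * d) / h) by (field; auto).
  unfold Rdiv. rewrite Rabs_mult, Rabs_inv.
  apply Rle_lt_trans with (K * Rabs h).
  - apply Rmult_le_reg_r with (Rabs h); auto.
    rewrite Rmult_assoc, Rinv_l by lra.
    replace (K * Rabs h * Rabs h) with (K * (h * h)); [lra|].
    rewrite Rmult_assoc, <- Rabs_mult, (Rabs_pos_eq (h * h)); [ring|]. nra.
  - apply Rle_lt_trans with (K * (eps / (K + 1))); [apply Rmult_le_compat_l; lra|].
    apply Rlt_le_trans with ((K + 1) * (eps / (K + 1))).
    + apply Rmult_lt_compat_r; [apply Rdiv_lt_0_compat|]; lra.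
    + right; field; lra.
Qed.

Lemma is_lim_seq_le_eventually u v (l m : R) n0 :
  (forall n, (n0 <= n)%nat -> u n <= v n) -> is_lim_seq u l -> is_lim_seq v m -> l <= m.
Proof.
  intros H Hu Hv.
  apply (is_lim_seq_le_loc u v l m); auto. exists n0. auto.
Qed.

Lemma mvt_both f f' t h : 0 < t -> 0 < t + h ->
  (forall s, 0 < s -> derivable_pt_lim f s (f' s)) ->
  exists c, 0 < c /\ Rabs (c - t) <= Rabs h /\ f (t + h) - f t = h * f' c.
Proof.
  intros Ht Hth Hd.
  destruct (Rtotal_order h 0) as [Hh|[->|Hh]].
  - destruct (MVT_cor2 f f' (t + h) t) as (c & Hc & Hct); [lra|intros; apply Hd; lra|].
    exists c. rewrite !Rabs_left by lra. repeat split; lra.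
  - exists t. rewrite Rplus_0_r, !Rminus_diag, Rabs_R0. repeat split; lra.
  - destruct (MVT_cor2 f f' t (t + h)) as (c & Hc & Hct); [lra|intros; apply Hd; lra|].
    exists c. rewrite !Rabs_right by lra. repeat split; lra.
Qed.

(* Second order Taylor bounds pass to the limit because [dn] is equi-Lipschitz,
   so neither [fn'] nor [gn'] has to converge. *)
Lemma limit_derivative (fn gn fn' gn' dn : nat -> R -> R) (f d : R -> R) (c K : R) n0 t :
  0 < t -> 0 <= K ->
  (forall n s, (n0 <= n)%nat -> 0 < s -> derivable_pt_lim (fn n) s (fn' n s)) ->
  (forall n s, (n0 <= n)%nat -> 0 < s -> derivable_pt_lim (gn n) s (gn' n s)) ->
  (forall n s, (n0 <= n)%nat -> 0 < s -> fn' n s <= dn n s <= gn' n s) ->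
  (forall n s r, (n0 <= n)%nat -> 0 < s -> 0 < r ->
     Rabs (dn n s - dn n r) <= K * Rabs (s - r)) ->
  (forall s, 0 < s -> is_lim_seq (fun n => fn n s) (f s)) ->
  (forall s, 0 < s -> is_lim_seq (fun n => gn n s) (f s + c)) ->
  is_lim_seq (fun n => dn n t) (d t) ->
  derivable_pt_lim f t (d t).
Proof.
  intros Ht HK Hf Hg Hs HL Lf Lg Ld. apply (derivable_of_quadratic f (d t) K); auto.
  intros h Hth.
  assert (Lfh : is_lim_seq (fun n => fn n (t + h) - fn n t) (f (t + h) - f t))
    by (apply is_lim_seq_minus'; auto).
  assert (Lgh : is_lim_seq (fun n => gn n (t + h) - gn n t) (f (t + h) - f t)).
  { replace (f (t + h) - f t) with ((f (t + h) + c) - (f t + c)) by ring.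
    apply is_lim_seq_minus'; auto. }
  assert (Lup : is_lim_seq (fun n => h * dn n t + K * (h * h)) (h * d t + K * (h * h))).
  { apply is_lim_seq_plus'; [|apply is_lim_seq_const].
    apply (is_lim_seq_scal_l (fun n => dn n t) h (d t)); auto. }
  assert (Llo : is_lim_seq (fun n => h * dn n t - K * (h * h)) (h * d t - K * (h * h))).
  { apply is_lim_seq_minus'; [|apply is_lim_seq_const].
    apply (is_lim_seq_scal_l (fun n => dn n t) h (d t)); auto. }
  assert (Hd : forall n c, (n0 <= n)%nat -> 0 < c -> Rabs (c - t) <= Rabs h ->
     Rabs (h * dn n c - h * dn n t) <= K * (h * h)).
  { intros n r Hn Hr Hrt. rewrite <- Rmult_minus_distr_l, Rabs_mult.
    apply Rle_trans with (Rabs h * (K * Rabs h)).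
    - apply Rmult_le_compat_l; [apply Rabs_pos|]. eapply Rle_trans; [apply HL; auto|].
      apply Rmult_le_compat_l; auto.
    - right. replace (Rabs h * (K * Rabs h)) with (K * (Rabs h * Rabs h)) by ring.
      rewrite <- Rabs_mult, Rabs_pos_eq; [ring|nra]. }
  assert (Hfc : forall n, (n0 <= n)%nat -> exists r, 0 < r /\ Rabs (r - t) <= Rabs h /\
     fn n (t + h) - fn n t = h * fn' n r).
  { intros n Hn. apply mvt_both; auto. }
  assert (Hgc : forall n, (n0 <= n)%nat -> exists r, 0 < r /\ Rabs (r - t) <= Rabs h /\
     gn n (t + h) - gn n t = h * gn' n r).
  { intros n Hn. apply mvt_both; auto. }
  assert (Hup : f (t + h) - f t <= h * d t + K * (h * h)).
  (* Multiplication by a negative [h] reverses the inequalities, so the other bracketing sequence is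
     used; in the limit both have the same increment. *)
  { destruct (Rle_lt_dec 0 h) as [Hh|Hh].
    - eapply is_lim_seq_le_eventually; [|exact Lfh|exact Lup]. intros n Hn.
      destruct (Hfc n Hn) as (r & Hr & Hrt & ->). specialize (Hd n r Hn Hr Hrt).
      apply Rabs_le_between in Hd. destruct (Hs n r Hn Hr) as [H1 _].
      apply Rmult_le_compat_l with (r := h) in H1; auto. lra.
    - eapply is_lim_seq_le_eventually; [|exact Lgh|exact Lup]. intros n Hn.
      destruct (Hgc n Hn) as (r & Hr & Hrt & ->). specialize (Hd n r Hn Hr Hrt).
      apply Rabs_le_between in Hd. destruct (Hs n r Hn Hr) as [_ H1].
      apply Rmult_le_compat_neg_l with (r := h) in H1; lra. }
  assert (Hlo : h * d t - K * (h * h) <= f (t + h) - f t).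
  { destruct (Rle_lt_dec 0 h) as [Hh|Hh].
    - eapply is_lim_seq_le_eventually; [|exact Llo|exact Lgh]. intros n Hn.
      destruct (Hgc n Hn) as (r & Hr & Hrt & ->). specialize (Hd n r Hn Hr Hrt).
      apply Rabs_le_between in Hd. destruct (Hs n r Hn Hr) as [_ H1].
      apply Rmult_le_compat_l with (r := h) in H1; auto. lra.
    - eapply is_lim_seq_le_eventually; [|exact Llo|exact Lfh]. intros n Hn.
      destruct (Hfc n Hn) as (r & Hr & Hrt & ->). specialize (Hd n r Hn Hr Hrt).
      apply Rabs_le_between in Hd. destruct (Hs n r Hn Hr) as [H1 _].
      apply Rmult_le_compat_neg_l with (r := h) in H1; lra. }
  apply Rabs_le. lra.
Qed.

Lemma increment_le f K t : 0 < t ->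
  (forall s, 0 <= s -> exists d, derivable_pt_lim f s d /\ d <= K) -> f t - f 0 <= K * t.
Proof.
  intros Ht H.
  assert (Hd : forall s, exists d, 0 <= s -> derivable_pt_lim f s d /\ d <= K).
  { intros s. destruct (Rle_dec 0 s) as [Hs|Hs]; [|exists 0; tauto].
    destruct (H s Hs) as [d Hd]. exists d; auto. }
  set (f' := fun s => epsilon (inhabits 0) (fun d => 0 <= s -> derivable_pt_lim f s d /\ d <= K)).
  assert (Hf : forall s, 0 <= s -> derivable_pt_lim f s (f' s) /\ f' s <= K)
    by (intros s; exact (epsilon_spec (inhabits 0) _ (Hd s))).
  destruct (MVT_cor2 f f' 0 t Ht) as (c & Hc & Hct); [intros c Hc; apply Hf; lra|].
  rewrite Hc, Rminus_0_r. apply Rmult_le_compat_r; [lra|]. apply Hf; lra.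
Qed.

Lemma increment_ge f K t : 0 < t ->
  (forall s, 0 <= s -> exists d, derivable_pt_lim f s d /\ K <= d) -> K * t <= f t - f 0.
Proof.
  intros Ht H. pose proof (increment_le (fun s => - f s) (- K) t Ht) as E.
  enough (- f t - - f 0 <= - K * t) by lra. apply E. intros s Hs.
  destruct (H s Hs) as (d & Hd & Hk). exists (- d). split; [now apply derivable_pt_lim_opp|lra].
Qed.

(** * Sums over integer intervals *)

Lemma sum_from_S a k f : sum_from a (S k) f = sum_from a k f + f (a + Z.of_nat k)%Z.
Proof.
  revert a. induction k; intros a.
  - simpl. rewrite Z.add_0_r. ring.
  - change (sum_from a (S (S k)) f) with (f a + sum_from (a + 1) (S k) f).
    rewrite IHk. simpl sum_from.
    replace (a + 1 + Z.of_nat k)%Z with (a + Z.of_nat (S k))%Z by lia. ring.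
Qed.

Lemma sumZ_empty a b f : (b < a)%Z -> sumZ a b f = 0.
Proof. intros H. unfold sumZ. replace (Z.to_nat (b - a + 1)) with O by lia. reflexivity. Qed.

Lemma sumZ_last a b f : (a <= b)%Z -> sumZ a b f = sumZ a (b - 1) f + f b.
Proof.
  intros H. unfold sumZ. replace (Z.to_nat (b - a + 1)) with (S (Z.to_nat (b - 1 - a + 1))) by lia.
  rewrite sum_from_S. f_equal. f_equal. lia.
Qed.

Lemma sumZ_first a b f : (a <= b)%Z -> sumZ a b f = f a + sumZ (a + 1) b f.
Proof.
  intros H. unfold sumZ. replace (Z.to_nat (b - a + 1)) with (S (Z.to_nat (b - (a + 1) + 1))) by lia.
  reflexivity.
Qed.

Lemma sumZ_ind (P : Z -> Prop) a : P (a - 1)%Z -> (forall b, (a <= b)%Z -> P (b - 1)%Z -> P b) ->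
  forall b, (a - 1 <= b)%Z -> P b.
Proof.
  intros H0 HS b Hb. replace b with (a - 1 + Z.of_nat (Z.to_nat (b - a + 1)))%Z by lia.
  induction (Z.to_nat (b - a + 1)) as [|k IH]; [now rewrite Z.add_0_r|].
  apply HS; [lia|]. replace (a - 1 + Z.of_nat (S k) - 1)%Z with (a - 1 + Z.of_nat k)%Z by lia. exact IH.
Qed.

Definition zlist (a b : Z) : list Z := map (fun k => (a + Z.of_nat k)%Z) (seq 0 (Z.to_nat (b - a + 1))).

Lemma zlist_In a b z : In z (zlist a b) <-> (a <= z <= b)%Z.
Proof.
  unfold zlist. rewrite in_map_iff. split.
  - intros (k & <- & Hk). apply in_seq in Hk. lia.
  - intros H. exists (Z.to_nat (z - a)). split; [lia|]. apply in_seq. lia.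
Qed.

Lemma zlist_NoDup a b : NoDup (zlist a b).
Proof.
  unfold zlist. apply FinFun.Injective_map_NoDup; [|apply seq_NoDup].
  intros x y H. lia.
Qed.

Lemma sumZ_list a b f : sumZ a b f = sum_list f (zlist a b).
Proof.
  unfold zlist, sumZ. generalize (Z.to_nat (b - a + 1)) as n. intros n.
  induction n as [|n IH]; [reflexivity|].
  rewrite sum_from_S, IH, seq_S, map_app, sum_list_app. unfold sum_list at 3. simpl. ring.
Qed.

Lemma sumZ_le a b f g : (forall z, (a <= z <= b)%Z -> f z <= g z) -> sumZ a b f <= sumZ a b g.
Proof. intros H. rewrite !sumZ_list. apply sum_list_le. intros z Hz. now apply H, zlist_In. Qed.

Lemma sumZ_ext a b f g : (forall z, (a <= z <= b)%Z -> f z = g z) -> sumZ a b f = sumZ a b g.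
Proof. intros H. rewrite !sumZ_list. apply sum_list_ext. intros z Hz. now apply H, zlist_In. Qed.

Lemma sumZ_zero a b f : (forall z, (a <= z <= b)%Z -> f z = 0) -> sumZ a b f = 0.
Proof. intros H. rewrite !sumZ_list. apply sum_list_zero. intros z Hz. now apply H, zlist_In. Qed.

Lemma sumZ_nonneg a b f : (forall z, (a <= z <= b)%Z -> 0 <= f z) -> 0 <= sumZ a b f.
Proof. intros H. rewrite !sumZ_list. apply sum_list_nonneg. intros z Hz. now apply H, zlist_In. Qed.

Lemma sumZ_split a m b f : (a - 1 <= m)%Z -> (m <= b)%Z -> sumZ a b f = sumZ a m f + sumZ (m + 1) b f.
Proof.
  intros Ha Hm. revert b Hm.
  enough (H : forall b, (m + 1 - 1 <= b)%Z -> sumZ a b f = sumZ a m f + sumZ (m + 1) b f)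
    by (intros; apply H; lia).
  apply (sumZ_ind (fun b => sumZ a b f = sumZ a m f + sumZ (m + 1) b f)).
  - replace (m + 1 - 1)%Z with m by lia. rewrite (sumZ_empty (m + 1)) by lia. lra.
  - intros b Hb IH. rewrite (sumZ_last a b), (sumZ_last (m + 1) b), IH by lia. lra.
Qed.

Lemma sumZ_term a b f z : (forall z, (a <= z <= b)%Z -> 0 <= f z) -> (a <= z <= b)%Z -> f z <= sumZ a b f.
Proof.
  intros H Hz. rewrite (sumZ_split a (z - 1) b), (sumZ_first _ b) by lia.
  replace (z - 1 + 1)%Z with z by lia.
  pose proof (sumZ_nonneg a (z - 1) f ltac:(intros; apply H; lia)).
  pose proof (sumZ_nonneg (z + 1) b f ltac:(intros; apply H; lia)). lra.
Qed.

Lemma sumZ_plus a b f g : sumZ a b (fun z => f z + g z) = sumZ a b f + sumZ a b g.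
Proof. rewrite !sumZ_list. apply sum_list_plus. Qed.

Lemma sumZ_scal a b k f : sumZ a b (fun z => k * f z) = k * sumZ a b f.
Proof. rewrite !sumZ_list. apply sum_list_scal. Qed.

Lemma derivable_pt_lim_sum_list {T} (l : list T) (f : T -> R -> R) (f' : T -> R) t :
  (forall x, In x l -> derivable_pt_lim (f x) t (f' x)) ->
  derivable_pt_lim (fun s => sum_list (fun x => f x s) l) t (sum_list f' l).
Proof.
  induction l as [|a l IH]; intros H; [apply derivable_pt_lim_const|].
  apply (derivable_pt_lim_plus (f a) (fun s => sum_list (fun x => f x s) l)).
  - apply H; left; auto.
  - apply IH. intros; apply H; right; auto.
Qed.

Lemma right_cont0_sum_list {T} (l : list T) (f : T -> R -> R) :
  (forall x, In x l -> right_cont0 (f x)) -> right_cont0 (fun s => sum_list (fun x => f x s) l).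
Proof.
  induction l as [|a l IH]; intros H; [exact (right_cont0_const 0)|].
  apply (right_cont0_plus (f a) (fun s => sum_list (fun x => f x s) l)).
  - apply H; left; auto.
  - apply IH. intros; apply H; right; auto.
Qed.

Lemma is_lim_seq_sum_list {T} (l : list T) (f : T -> nat -> R) (g : T -> R) :
  (forall x, In x l -> is_lim_seq (f x) (g x)) ->
  is_lim_seq (fun n => sum_list (fun x => f x n) l) (sum_list g l).
Proof.
  induction l as [|a l IH]; intros H; [apply is_lim_seq_const|].
  apply is_lim_seq_plus'; [apply H; left; auto|]. apply IH. intros; apply H; right; auto.
Qed.

(** * Nearest-neighbour chains and their truncations *)

Lemma inI_le isN y w : inI isN y = true -> (y <= w)%Z -> inI isN w = true.
Proof. unfold inI. destruct isN; auto. rewrite !Z.leb_le. lia. Qed.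

Section Chain.

Context (isN : bool) (up down : Z -> R).
Notation I x := (inI isN x = true).
Notation gen := (gen isN up down).

Definition nonneg_rates : Prop := forall x, I x -> 0 <= up x /\ 0 <= down x.

Lemma inI_succ x : I x -> I (x + 1)%Z.
Proof. intros Ix. apply (inI_le isN x); auto. lia. Qed.

Lemma ext_in f x : I x -> ext isN f x = f x.
Proof. unfold ext. now intros ->. Qed.

Lemma gen_ext f g x : I x -> (forall z, I z -> f z = g z) -> gen f x = gen g x.
Proof.
  intros Hx H. unfold Defs.gen. rewrite (H x Hx).
  assert (E : forall z, ext isN f z = ext isN g z).
  { intros z. unfold ext. destruct (inI isN z) eqn:E; auto. }
  now rewrite !E.
Qed.

Lemma gen_linear a b f g x : gen (fun z => a * f z + b * g z) x = a * gen f x + b * gen g x.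
Proof.
  unfold Defs.gen.
  assert (E : forall z, ext isN (fun z => a * f z + b * g z) z = a * ext isN f z + b * ext isN g z).
  { intros z. unfold ext. destruct (inI isN z); ring. }
  rewrite !E. ring.
Qed.

Lemma gen_sum_list {T} (l : list T) (f : T -> Z -> R) x :
  gen (fun z => sum_list (fun w => f w z) l) x = sum_list (fun w => gen (f w) x) l.
Proof.
  induction l as [|a l IH].
  - unfold Defs.gen, ext, sum_list. simpl. destruct (inI isN (x+1)), (inI isN (x-1)); ring.
  - rewrite sum_list_cons, <- IH.
    transitivity (gen (fun z => 1 * f a z + 1 * sum_list (fun w => f w z) l) x).
    + unfold Defs.gen, ext. rewrite !sum_list_cons.
      destruct (inI isN (x+1)), (inI isN (x-1)); ring.
    + rewrite gen_linear. ring.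
Qed.

(** The condition [f x <= 0] is there because a jump out of [I] meets the value 0. *)
Lemma gen_at_min f x : 0 <= up x -> 0 <= down x -> f x <= 0 ->
  (I (x + 1)%Z -> f x <= f (x + 1)%Z) -> (I (x - 1)%Z -> f x <= f (x - 1)%Z) -> 0 <= gen f x.
Proof.
  intros Hu Hd Hf H1 H2. unfold Defs.gen.
  assert (0 <= ext isN f (x + 1) - f x).
  { unfold ext. destruct (inI isN (x + 1)); [specialize (H1 eq_refl)|]; lra. }
  assert (0 <= ext isN f (x - 1) - f x).
  { unfold ext. destruct (inI isN (x - 1)); [specialize (H2 eq_refl)|]; lra. }
  assert (0 <= up x * (ext isN f (x + 1) - f x)) by now apply Rmult_le_pos.
  assert (0 <= down x * (ext isN f (x - 1) - f x)) by now apply Rmult_le_pos. lra.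
Qed.

Definition gen_norm (x : Z) : R := 2 * (Rabs (up x) + Rabs (down x)).

Lemma gen_norm_nonneg x : 0 <= gen_norm x.
Proof. unfold gen_norm. pose proof (Rabs_pos (up x)). pose proof (Rabs_pos (down x)). lra. Qed.

Lemma gen_bound f x b : I x -> (forall z, I z -> Rabs (f z) <= b) -> Rabs (gen f x) <= gen_norm x * b.
Proof.
  intros Hx H.
  assert (Hb : 0 <= b) by (specialize (H x Hx); pose proof (Rabs_pos (f x)); lra).
  assert (E : forall z, Rabs (ext isN f z - f x) <= 2 * b).
  { intros z. unfold Rminus. eapply Rle_trans; [apply Rabs_triang|]. rewrite Rabs_Ropp.
    unfold ext. specialize (H x Hx) as Hx'. destruct (inI isN z) eqn:E; [specialize (H z E); lra|].
    rewrite Rabs_R0. lra. }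
  unfold Defs.gen, gen_norm. eapply Rle_trans; [apply Rabs_triang|]. rewrite !Rabs_mult.
  pose proof (Rmult_le_compat_l _ _ _ (Rabs_pos (up x)) (E (x + 1)%Z)).
  pose proof (Rmult_le_compat_l _ _ _ (Rabs_pos (down x)) (E (x - 1)%Z)). lra.
Qed.

Lemma gen_bound_local f x b : I x -> (forall z, I z -> (x - 1 <= z <= x + 1)%Z -> Rabs (f z) <= b) ->
  Rabs (gen f x) <= gen_norm x * b.
Proof.
  intros Hx H.
  set (g := fun z => if (Z.leb (x - 1) z && Z.leb z (x + 1))%bool then f z else 0).
  assert (Hb : 0 <= b) by (specialize (H x Hx ltac:(lia)); pose proof (Rabs_pos (f x)); lra).
  replace (gen f x) with (gen g x).
  - apply gen_bound; auto. intros z Hz. unfold g.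
    destruct (Z.leb_spec (x - 1) z), (Z.leb_spec z (x + 1)); simpl; try (rewrite Rabs_R0; lra).
    apply H; auto; lia.
  - unfold Defs.gen, ext, g.
    destruct (Z.leb_spec (x - 1) x), (Z.leb_spec x (x + 1)), (Z.leb_spec (x - 1) (x + 1)),
      (Z.leb_spec (x + 1) (x + 1)), (Z.leb_spec (x - 1) (x - 1)), (Z.leb_spec (x - 1) (x + 1));
      try lia. simpl. reflexivity.
Qed.

Lemma lim_gen (f : nat -> Z -> R) (g : Z -> R) x : I x ->
  (forall z, I z -> is_lim_seq (fun n => f n z) (g z)) -> is_lim_seq (fun n => gen (f n) x) (gen g x).
Proof.
  intros Hx H. unfold Defs.gen.
  assert (E : forall z, is_lim_seq (fun n => ext isN (f n) z) (ext isN g z)).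
  { intros z. unfold ext. destruct (inI isN z) eqn:E; auto. apply is_lim_seq_const. }
  apply is_lim_seq_plus'.
  - apply (is_lim_seq_scal_l _ (up x) (ext isN g (x + 1) - g x)). apply is_lim_seq_minus'; auto.
  - apply (is_lim_seq_scal_l _ (down x) (ext isN g (x - 1) - g x)). apply is_lim_seq_minus'; auto.
Qed.

Definition bw_derivative (u : R -> Z -> R) (x : Z) : Prop :=
  forall t, 0 < t -> derivable_pt_lim (fun s => u s x) t (gen (u t) x).

Lemma bw_lipschitz (u : R -> Z -> R) x b : I x -> bw_derivative u x -> 0 <= b ->
  (forall t z, 0 <= t -> I z -> Rabs (u t z) <= b) ->
  forall s r, 0 < s -> 0 < r -> Rabs (u s x - u r x) <= gen_norm x * b * Rabs (s - r).
Proof.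
  intros Hx Hd Hb HB s r Hs Hr.
  destruct (mvt_both (fun s => u s x) (fun s => gen (u s) x) r (s - r)) as (c & Hc & _ & E); auto; [lra|].
  replace (r + (s - r)) with s in E by ring. rewrite E, Rabs_mult, Rmult_comm.
  apply Rmult_le_compat_r; [apply Rabs_pos|]. apply gen_bound; auto. intros; apply HB; lra || auto.
Qed.

Lemma bw_near0 (u : R -> Z -> R) x b : I x -> bw_derivative u x -> 0 <= b ->
  (forall t z, 0 <= t -> I z -> Rabs (u t z) <= b) -> right_cont0 (fun t => u t x) ->
  forall t, 0 < t -> Rabs (u t x - u 0 x) <= gen_norm x * b * t.
Proof.
  intros Hx Hd Hb HB Hrc t Ht. apply le_epsilon. intros eps He.
  destruct (Hrc eps He) as (d & Hd0 & H).
  assert (Hm : 0 < Rmin (d / 2) t) by (apply Rmin_glb_lt; lra).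
  set (s := Rmin (d / 2) t) in *.
  assert (s <= d / 2) by apply Rmin_l. assert (s <= t) by apply Rmin_r.
  specialize (H s ltac:(lra)).
  pose proof (bw_lipschitz u x b Hx Hd Hb HB t s Ht Hm) as HL.
  replace (u t x - u 0 x) with ((u t x - u s x) + (u s x - u 0 x)) by ring.
  eapply Rle_trans; [apply Rabs_triang|].
  rewrite (Rabs_pos_eq (t - s)) in HL by lra.
  assert (gen_norm x * b * (t - s) <= gen_norm x * b * t).
  { apply Rmult_le_compat_l; [|lra]. apply Rmult_le_pos; auto. apply gen_norm_nonneg. }
  lra.
Qed.

(** The common bound makes [v n] Lipschitz in time with a constant depending only on the site, so
    the generator applied to [v n] is equi-Lipschitz and [limit_derivative] applies with both
    bracketing sequences equal to [v]. The same estimate gives continuity at time 0. *)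
Lemma backward_limit (v : nat -> R -> Z -> R) (u : R -> Z -> R) b : 0 <= b ->
  (forall n t z, 0 <= t -> I z -> Rabs (v n t z) <= b) ->
  (forall x, I x -> exists n0, forall n, (n0 <= n)%nat -> bw_derivative (v n) x) ->
  (forall n x, I x -> right_cont0 (fun t => v n t x)) ->
  (forall t x, 0 <= t -> I x -> is_lim_seq (fun n => v n t x) (u t x)) ->
  forall x, I x -> bw_derivative u x /\ right_cont0 (fun t => u t x).
Proof.
  intros Hb HB Hd Hrc Hl x Hx. split.
  - assert (H3 : exists n0, forall z, I z -> (x - 1 <= z <= x + 1)%Z ->
       forall n, (n0 <= n)%nat -> bw_derivative (v n) z).
    { assert (He : forall z, exists n0, I z -> forall n, (n0 <= n)%nat -> bw_derivative (v n) z).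
      { intros z. destruct (inI isN z) eqn:E; [|exists O; discriminate].
        destruct (Hd z E) as [n0 H]. exists n0; auto. }
      destruct (He (x - 1)%Z) as [n1 H1]. destruct (He x) as [n2 H2]. destruct (He (x + 1)%Z) as [n3 H3].
      exists (n1 + n2 + n3)%nat. intros z Iz Hz n Hn.
      assert (z = x - 1 \/ z = x \/ z = x + 1)%Z as [->|[->| ->]] by lia;
        [apply H1|apply H2|apply H3]; auto; lia. }
    destruct H3 as [n0 H3]. intros t Ht.
    (* Up to the factor [b], one Lipschitz constant for [x] and its two neighbours, the sites that
       the generator reads. *)
    set (Q := gen_norm (x - 1) + gen_norm x + gen_norm (x + 1)).
    pose proof (gen_norm_nonneg (x - 1)). pose proof (gen_norm_nonneg x). pose proof (gen_norm_nonneg (x + 1)).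
    assert (HQ : 0 <= Q) by (unfold Q; lra).
    apply (limit_derivative (fun n s => v n s x) (fun n s => v n s x) (fun n s => gen (v n s) x)
      (fun n s => gen (v n s) x) (fun n s => gen (v n s) x) (fun s => u s x) (fun s => gen (u s) x) 0
      (gen_norm x * (Q * b)) n0); auto.
    + apply Rmult_le_pos; auto. apply Rmult_le_pos; auto.
    + intros n s Hn Hs. apply (H3 x); auto; lia.
    + intros n s Hn Hs. apply (H3 x); auto; lia.
    + intros; lra.
    + intros n s r Hn Hs Hr.
      replace (gen (v n s) x - gen (v n r) x) with (gen (fun z => 1 * v n s z + -1 * v n r z) x)
        by (rewrite gen_linear; ring).
      rewrite Rmult_assoc. apply gen_bound_local; auto. intros z Iz Hz.
      replace (1 * v n s z + -1 * v n r z) with (v n s z - v n r z) by ring.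
      eapply Rle_trans; [apply (bw_lipschitz (v n) z b); auto|].
      apply Rmult_le_compat_r; [apply Rabs_pos|]. apply Rmult_le_compat_r; auto.
      assert (z = x - 1 \/ z = x \/ z = x + 1)%Z as [->|[->| ->]] by lia; unfold Q; lra.
    + intros s Hs. apply Hl; auto; lra.
    + intros s Hs. rewrite Rplus_0_r. apply Hl; auto; lra.
    + apply lim_gen; auto. intros; apply Hl; auto; lra.
  - intros eps He. destruct (Hd x Hx) as [n0 Hn0].
    set (K := gen_norm x * b + 1).
    assert (HK : 0 < K).
    { unfold K. pose proof (Rmult_le_pos _ _ (gen_norm_nonneg x) Hb). lra. }
    exists (eps / K). split; [apply Rdiv_lt_0_compat; auto|]. intros t Ht.
    apply Rle_lt_trans with (gen_norm x * b * t).
    + assert (Hlim : is_lim_seq (fun n => Rabs (v n t x - v n 0 x)) (Rabs (u t x - u 0 x))).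
      { apply (is_lim_seq_abs _ (u t x - u 0 x)).
        apply is_lim_seq_minus'; apply Hl; auto; lra. }
      eapply (is_lim_seq_le_eventually _ _ _ _ n0); [|exact Hlim|apply is_lim_seq_const].
      intros n Hn. apply bw_near0; auto; lra.
    + apply Rle_lt_trans with ((K - 1) * t); [right; unfold K; ring|].
      apply Rlt_le_trans with (K * t); [nra|].
      apply Rle_trans with (K * (eps / K)); [apply Rmult_le_compat_l; lra|right; field; lra].
Qed.

End Chain.

(** * Truncated chains by uniformization *)

Lemma CV_radius_infinite_exp (a : nat -> R) (c : R) : 0 <= c ->
  (forall k, Rabs (a k) <= c ^ k / INR (fact k)) -> CV_radius a = p_infty.
Proof.
  intros Hc H.
  assert (Hd : forall r, 0 <= r -> CV_disk a r).
  { intros r Hr. unfold CV_disk.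
    apply (ex_series_le (K := R_AbsRing) (V := R_CompleteNormedModule)
      (fun k => Rabs (a k * r ^ k)) (fun k => (c * r) ^ k / INR (fact k))).
    - intros k. unfold norm; simpl. unfold abs; simpl. rewrite Rabs_Rabsolu, Rabs_mult, Rpow_mult_distr.
      rewrite (Rabs_pos_eq (r ^ k)) by (apply pow_le; auto).
      unfold Rdiv. replace (c ^ k * r ^ k * / INR (fact k)) with (c ^ k / INR (fact k) * r ^ k)
        by (unfold Rdiv; ring).
      apply Rmult_le_compat_r; [apply pow_le; auto|auto].
    - exists (exp (c * r)). pose proof (is_exp_Reals (c * r)) as E.
      eapply is_series_ext; [|exact E]. intros k. rewrite pow_n_pow.
      unfold scal; simpl. unfold mult; simpl. unfold Rdiv. reflexivity. }
  unfold CV_radius. destruct (Lub_Rbar_correct (CV_disk a)) as [Hub _].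
  destruct (Lub_Rbar (CV_disk a)) as [l| |]; auto; exfalso.
  - specialize (Hub (Rabs l + 1) (Hd (Rabs l + 1) ltac:(pose proof (Rabs_pos l); lra))). simpl in Hub.
    pose proof (Rle_abs l). lra.
  - apply (Hub 0). apply Hd. lra.
Qed.

Lemma PSeries_linear3 (a b c : nat -> R) (k l m t : R) :
  ex_pseries a t -> ex_pseries b t -> ex_pseries c t ->
  PSeries (fun n => k * a n + l * b n + m * c n) t =
  k * PSeries a t + l * PSeries b t + m * PSeries c t.
Proof.
  intros Ha Hb Hc.
  assert (Hs : forall (r : R) (d : nat -> R), ex_pseries d t -> ex_pseries (PS_scal r d) t).
  { intros r d Hd. apply ex_pseries_scal; auto. apply Rmult_comm. }
  rewrite <- !PSeries_scal, <- PSeries_plus, <- PSeries_plus; auto.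
  apply ex_pseries_plus; auto.
Qed.

Section Truncation.

Context (isN : bool) (up down : Z -> R) (Hr : nonneg_rates isN up down).
Notation I x := (inI isN x = true).
Notation gen := (gen isN up down).

Definition inD (N : nat) (x : Z) : bool := inI isN x && Z.leb (Z.abs x) (Z.of_nat N).

Definition rate_bound (N : nat) : R :=
  sumZ (- Z.of_nat N) (Z.of_nat N) (fun z => Rabs (up z) + Rabs (down z)).

(** The generator killed outside [inD N], shifted by [rate_bound N] times the identity; it is
    applied to functions that vanish outside [inD N]. *)
Definition step (N : nat) (f : Z -> R) (x : Z) : R :=
  if inD N x then
    (rate_bound N - up x - down x) * f x + up x * f (x + 1)%Z + down x * f (x - 1)%Z
  else 0.

(** The [(x, y)] entry of the [k]-th power of that matrix. *)
Fixpoint bpow (N : nat) (y : Z) (k : nat) (x : Z) : R :=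
  match k with
  | O => if inD N x then (if Z.eq_dec x y then 1 else 0) else 0
  | S k' => step N (bpow N y k') x
  end.

(* Transition function of the chain killed outside [inD N], by uniformization:
   the generator plus [rate_bound N] is a bounded nonnegative matrix. *)
Definition tp (N : nat) (t : R) (x y : Z) : R :=
  exp (- rate_bound N * t) * PSeries (fun k => bpow N y k x / INR (fact k)) t.

Lemma inD_I N x : inD N x = true -> I x.
Proof. unfold inD. intros H. apply andb_prop in H. tauto. Qed.

Lemma inD_abs N x : inD N x = true -> (Z.abs x <= Z.of_nat N)%Z.
Proof. unfold inD. intros H. apply andb_prop in H. apply Z.leb_le. tauto. Qed.

Lemma inD_intro N x : I x -> (Z.abs x <= Z.of_nat N)%Z -> inD N x = true.
Proof. unfold inD. intros -> H. now apply Z.leb_le. Qed.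

Lemma inD_mono N M x : (N <= M)%nat -> inD N x = true -> inD M x = true.
Proof.
  intros HNM H. apply inD_intro; [now apply (inD_I N)|]. apply inD_abs in H. lia.
Qed.

Lemma inD_false N x : I x -> inD N x = false -> (Z.of_nat N < Z.abs x)%Z.
Proof.
  intros Ix H. destruct (Z_lt_le_dec (Z.of_nat N) (Z.abs x)); auto.
  rewrite inD_intro in H; auto. discriminate.
Qed.

Lemma rate_bound_spec N x : inD N x = true -> 0 <= up x /\ 0 <= down x /\ up x + down x <= rate_bound N.
Proof.
  intros Hx. destruct (Hr x (inD_I N x Hx)) as [Hu Hd]. split; auto. split; auto.
  eapply Rle_trans; [|apply (sumZ_term _ _ (fun z => Rabs (up z) + Rabs (down z)) x)].
  - simpl. rewrite !Rabs_pos_eq by auto. lra.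
  - intros z _. pose proof (Rabs_pos (up z)). pose proof (Rabs_pos (down z)). lra.
  - apply inD_abs in Hx. lia.
Qed.

Lemma rate_bound_nonneg N : 0 <= rate_bound N.
Proof.
  apply sumZ_nonneg. intros z _. pose proof (Rabs_pos (up z)). pose proof (Rabs_pos (down z)). lra.
Qed.

Lemma bpow_out N y k x : inD N x = false -> bpow N y k x = 0.
Proof. intros H. destruct k; simpl; unfold step; now rewrite H. Qed.

Lemma bpow_out_target N y k x : inD N y = false -> bpow N y k x = 0.
Proof.
  intros Hy. revert x. induction k; intros x; simpl.
  - destruct (inD N x) eqn:E; auto. destruct (Z.eq_dec x y); auto. congruence.
  - unfold step. destruct (inD N x); auto. rewrite !IHk. ring.
Qed.

Lemma bpow_bound N y k x : 0 <= bpow N y k x <= rate_bound N ^ k.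
Proof.
  pose proof (rate_bound_nonneg N) as HC. revert x. induction k; intros x; simpl.
  - destruct (inD N x), (Z.eq_dec x y); lra.
  - unfold step. destruct (inD N x) eqn:E.
    + destruct (rate_bound_spec N x E) as (Hu & Hd & Hc).
      pose proof (IHk x) as [A1 A2]. pose proof (IHk (x + 1)%Z) as [B1 B2].
      pose proof (IHk (x - 1)%Z) as [C1 C2].
      assert (H1 : 0 <= rate_bound N - up x - down x) by lra.
      split.
      * repeat apply Rplus_le_le_0_compat; apply Rmult_le_pos; auto.
      * pose proof (Rmult_le_compat_l _ _ _ H1 A2). pose proof (Rmult_le_compat_l _ _ _ Hu B2).
        pose proof (Rmult_le_compat_l _ _ _ Hd C2). lra.
    + split; [lra|]. apply Rmult_le_pos; auto. now apply pow_le.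
Qed.

Lemma bpow_coef_bound N y x k : Rabs (bpow N y k x / INR (fact k)) <= rate_bound N ^ k / INR (fact k).
Proof.
  pose proof (bpow_bound N y k x). pose proof (INR_fact_lt_0 k).
  unfold Rdiv. assert (0 < / INR (fact k)) by now apply Rinv_0_lt_compat.
  rewrite Rabs_pos_eq; [apply Rmult_le_compat_r; lra|apply Rmult_le_pos; lra].
Qed.

Lemma bpow_radius N y x : CV_radius (fun k => bpow N y k x / INR (fact k)) = p_infty.
Proof.
  apply (CV_radius_infinite_exp _ (rate_bound N)); [apply rate_bound_nonneg|].
  apply bpow_coef_bound.
Qed.

Lemma bpow_ex N y x t : ex_pseries (fun k => bpow N y k x / INR (fact k)) t.
Proof. apply CV_radius_inside. rewrite bpow_radius. exact Logic.I. Qed.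

Lemma tp_out N t x y : inD N x = false -> tp N t x y = 0.
Proof.
  intros H. unfold tp. rewrite (PSeries_ext _ (fun _ => 0)).
  - rewrite PSeries_const_0. ring.
  - intros k. rewrite bpow_out by auto. unfold Rdiv. ring.
Qed.

Lemma tp_out_target N t x y : inD N y = false -> tp N t x y = 0.
Proof.
  intros Hy. unfold tp. rewrite (PSeries_ext _ (fun _ => 0)).
  - rewrite PSeries_const_0. ring.
  - intros k. rewrite bpow_out_target by auto. unfold Rdiv. ring.
Qed.

Lemma ext_tp N t y x : ext isN (fun z => tp N t z y) x = tp N t x y.
Proof.
  unfold ext. destruct (inI isN x) eqn:E; auto. symmetry. apply tp_out. unfold inD. now rewrite E.
Qed.

Lemma tp_0 N x y : inD N x = true -> tp N 0 x y = if Z.eq_dec x y then 1 else 0.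
Proof.
  intros H. unfold tp. rewrite PSeries_0. simpl. rewrite H, Rmult_0_r, exp_0. destruct (Z.eq_dec x y); field.
Qed.

Lemma tp_derive N t x y : inD N x = true ->
  derivable_pt_lim (fun s => tp N s x y) t (gen (fun z => tp N t z y) x).
Proof.
  intros Hx.
  set (S := fun z => PSeries (fun k => bpow N y k z / INR (fact k)) t).
  assert (HS : PSeries (PS_derive (fun k => bpow N y k x / INR (fact k))) t =
     (rate_bound N - up x - down x) * S x + up x * S (x + 1)%Z + down x * S (x - 1)%Z).
  (* Differentiation shifts the coefficients, and cancelling [k + 1] against the factorial exposes
     one application of [step]. *)
  { unfold S. rewrite <- PSeries_linear3 by apply bpow_ex.
    apply PSeries_ext. intros k. unfold PS_derive.
    change (bpow N y (Datatypes.S k) x) with (step N (bpow N y k) x). unfold step. rewrite Hx.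
    rewrite fact_simpl, mult_INR. pose proof (INR_fact_neq_0 k).
    assert (INR (Datatypes.S k) <> 0) by (apply not_0_INR; lia).
    field. auto. }
  apply is_derive_Reals. unfold tp.
  evar (d : R).
  assert (HD : is_derive (fun s => exp (- rate_bound N * s) *
     PSeries (fun k => bpow N y k x / INR (fact k)) s) t d).
  { apply (is_derive_mult (fun s => exp (- rate_bound N * s)) _ t (- rate_bound N * exp (- rate_bound N * t))).
    - auto_derive; auto. ring.
    - apply is_derive_PSeries. rewrite bpow_radius. exact Logic.I.
    - intros; apply Rmult_comm. }
  replace (gen _ x) with d; [exact HD|]. unfold d.
  rewrite HS. unfold plus, mult; simpl. unfold mult; simpl.
  unfold Defs.gen. pose proof (ext_tp N t y) as E. unfold tp in E. rewrite !E.
  fold (S x). fold (S (x + 1)%Z). fold (S (x - 1)%Z). ring.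
Qed.

Lemma tp_right_cont0 N x y : right_cont0 (fun t => tp N t x y).
Proof.
  destruct (inD N x) eqn:E.
  - eapply right_cont0_derivable. now apply tp_derive.
  - intros eps He. exists 1. split; [lra|]. intros t _. rewrite !tp_out, Rminus_diag, Rabs_R0; auto.
Qed.

(** Outside the truncation [u] is nonnegative, so a negative minimum over [inD N] is a minimum over
    all of [I], where the generator is nonnegative. *)
Lemma trunc_principle N (u du : R -> Z -> R) :
  (forall x, inD N x = true -> 0 <= u 0 x) ->
  (forall x, inD N x = true -> right_cont0 (fun t => u t x)) ->
  (forall t x, 0 < t -> inD N x = true -> derivable_pt_lim (fun s => u s x) t (du t x)) ->
  (forall t x, 0 < t -> inD N x = true -> gen (u t) x <= du t x) ->
  (forall t x, 0 <= t -> I x -> inD N x = false -> 0 <= u t x) ->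
  forall t x, 0 <= t -> I x -> 0 <= u t x.
Proof.
  intros H0 Hrc Hd Hg Hout t x Ht Ix.
  destruct (inD N x) eqn:E; [|now apply Hout].
  apply (max_principle (fun x => inD N x = true) (zlist (- Z.of_nat N) (Z.of_nat N)) u du); auto.
  - intros z Hz. apply zlist_In. apply inD_abs in Hz. lia.
  - intros s z Hs Hz Hneg Hmin. eapply Rle_trans; [|apply Hg; auto].
    assert (Hn : forall w, I w -> u s z <= u s w).
    { intros w Iw. destruct (inD N w) eqn:Ew; [auto|].
      specialize (Hout s w ltac:(lra) Iw Ew). lra. }
    destruct (Hr z (inD_I N z Hz)). apply gen_at_min; auto. lra.
Qed.

Lemma tp_nonneg N t x y : 0 <= t -> 0 <= tp N t x y.
Proof.
  intros Ht. destruct (inD N x) eqn:E; [|rewrite tp_out; auto; lra].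
  apply (trunc_principle N (fun t x => tp N t x y) (fun t x => gen (fun z => tp N t z y) x));
    auto; [| | | | |now apply (inD_I N)].
  - intros z Hz. rewrite tp_0 by auto. destruct (Z.eq_dec z y); lra.
  - intros; apply tp_right_cont0.
  - intros; now apply tp_derive.
  - intros; lra.
  - intros s z _ _ Hz. rewrite tp_out; auto; lra.
Qed.

(** The difference with [tp N] solves the backward equation inside the truncation and is nonnegative
    outside, where [tp N] vanishes. Taking for [w] the next truncation gives monotonicity in [N];
    taking a solution of the full equation shows that the limit is minimal. *)
Lemma tp_comparison N (w : R -> Z -> R) y :
  (forall x, I x -> (if Z.eq_dec x y then 1 else 0) <= w 0 x) ->
  (forall x, I x -> right_cont0 (fun t => w t x)) ->
  (forall x, inD N x = true -> bw_derivative isN up down w x) ->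
  (forall t x, 0 <= t -> I x -> 0 <= w t x) ->
  forall t x, 0 <= t -> I x -> tp N t x y <= w t x.
Proof.
  intros H0 Hrc Hd Hpos t x Ht Ix. apply Rminus_le_0.
  replace (w t x - tp N t x y) with (1 * w t x + -1 * tp N t x y) by ring.
  apply (trunc_principle N (fun t x => 1 * w t x + -1 * tp N t x y)
     (fun t x => gen (fun x => 1 * w t x + -1 * tp N t x y) x)); auto.
  - intros z Hz. rewrite tp_0 by auto. specialize (H0 z (inD_I N z Hz)). lra.
  - intros z Hz. apply right_cont0_plus; apply right_cont0_mult; try apply right_cont0_const.
    + apply Hrc. now apply (inD_I N).
    + apply tp_right_cont0.
  - intros s z Hs Hz. rewrite gen_linear.
    apply (derivable_pt_lim_plus (fun s => 1 * w s z) (fun s => -1 * tp N s z y));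
      apply derivable_pt_lim_scal; [now apply Hd|now apply tp_derive].
  - intros; lra.
  - intros s z Hs Iz Hz. rewrite tp_out by auto. specialize (Hpos s z Hs Iz). lra.
Qed.

Lemma tp_mono N t x y : 0 <= t -> I x -> tp N t x y <= tp (S N) t x y.
Proof.
  intros Ht Ix. destruct (inD N x) eqn:E; [|rewrite tp_out by auto; now apply tp_nonneg].
  destruct (inD N y) eqn:Ey; [|rewrite tp_out_target by auto; now apply tp_nonneg].
  apply (tp_comparison N (fun t x => tp (S N) t x y)); auto.
  - intros z Iz. destruct (inD (S N) z) eqn:Ez; [rewrite tp_0 by auto; lra|].
    rewrite tp_out by auto. destruct (Z.eq_dec z y); [|lra]. subst z.
    apply (inD_mono _ (S N)) in Ey; [congruence|lia].
  - intros; apply tp_right_cont0.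
  - intros z Hz s Hs. apply tp_derive. apply (inD_mono N); auto.
  - intros; now apply tp_nonneg.
Qed.

(** The constant 1 is a supersolution, since killing can only decrease it. *)
Lemma tp_sum_le_1 N t x l : 0 <= t -> I x -> NoDup l -> sum_list (fun y => tp N t x y) l <= 1.
Proof.
  intros Ht Ix Nl. apply Rminus_le_0.
  apply (trunc_principle N (fun t x => 1 - sum_list (fun y => tp N t x y) l)
     (fun t x => 0 - gen (fun x => sum_list (fun y => tp N t x y) l) x)); auto.
  - intros z Hz. rewrite (sum_list_ext _ (fun y => if Z.eq_dec z y then 1 else 0))
      by (intros; now apply tp_0).
    assert (H : forall l, NoDup l -> sum_list (fun y => if Z.eq_dec z y then 1 else 0) l <= 1).
    { clear. intros l Nl. induction Nl as [|a l Hn Nl IH]; [unfold sum_list; simpl; lra|].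
      rewrite sum_list_cons. destruct (Z.eq_dec z a) as [->|]; [|lra].
      rewrite sum_list_zero; [lra|]. intros w Hw. destruct (Z.eq_dec a w); auto. congruence. }
    specialize (H l Nl). lra.
  - intros z Hz. unfold Rminus. apply right_cont0_plus; [apply right_cont0_const|].
    eapply (right_cont0_derivable _ (- sum_list (fun y => gen (fun x => tp N 0 x y) z) l)).
    apply derivable_pt_lim_opp, derivable_pt_lim_sum_list. intros; now apply tp_derive.
  - intros s z Hs Hz. rewrite gen_sum_list.
    apply (derivable_pt_lim_minus (fun _ => 1)); [apply derivable_pt_lim_const|].
    apply (derivable_pt_lim_sum_list l (fun y s => tp N s z y)). intros; now apply tp_derive.
  - intros s z Hs Hz.
    replace (gen (fun x => 1 - _) z) with
      (gen (fun x => 1 * (fun _ => 1) x + -1 * sum_list (fun y => tp N s x y) l) z)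
      by (apply gen_ext; [now apply (inD_I N)|intros; ring]).
    rewrite gen_linear. destruct (Hr z (inD_I N z Hz)) as [Hu Hd].
    assert (gen (fun _ => 1) z <= 0); [|lra]. unfold Defs.gen, ext.
    destruct (inI isN (z + 1)), (inI isN (z - 1)); lra.
  - intros s z Hs Iz Hz. rewrite sum_list_zero; [lra|]. intros; now apply tp_out.
Qed.

Lemma tp_le_1 N t x y : 0 <= t -> I x -> tp N t x y <= 1.
Proof.
  intros Ht Ix. pose proof (tp_sum_le_1 N t x [y] Ht Ix ltac:(repeat constructor; auto)) as H.
  rewrite sum_list_cons in H. unfold sum_list in H. simpl in H. lra.
Qed.

Definition minimal_tf (t : R) (x y : Z) : R := real (Lim_seq (fun N => tp N t x y)).

Lemma minimal_tf_lim t x y : 0 <= t -> I x -> is_lim_seq (fun N => tp N t x y) (minimal_tf t x y).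
Proof.
  intros Ht Ix. apply Lim_seq_correct'. apply (ex_finite_lim_seq_incr _ 1).
  - intros; now apply tp_mono.
  - intros; now apply tp_le_1.
Qed.

Lemma tp_eventually_derivative x y : I x ->
  exists n0, forall n, (n0 <= n)%nat -> bw_derivative isN up down (fun t x => tp n t x y) x.
Proof.
  intros Ix. exists (Z.to_nat (Z.abs x)). intros n Hn t Ht. apply tp_derive.
  apply inD_intro; auto. lia.
Qed.

Lemma minimal_tf_bw_sol : bw_sol isN up down minimal_tf.
Proof.
  assert (HB : forall y x, I x -> bw_derivative isN up down (fun t x => minimal_tf t x y) x /\
     right_cont0 (fun t => minimal_tf t x y)).
  { intros y. apply (backward_limit isN up down (fun N t x => tp N t x y) _ 1); [lra| | | |].
    - intros n t z Ht Iz. rewrite Rabs_pos_eq; [now apply tp_le_1|now apply tp_nonneg].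
    - intros; now apply tp_eventually_derivative.
    - intros; apply tp_right_cont0.
    - intros; now apply minimal_tf_lim. }
  repeat split.
  - intros x y Ix Iy.
    assert (E : is_lim_seq (fun N => tp N 0 x y) (Finite (if Z.eq_dec x y then 1 else 0))).
    { apply (is_lim_seq_ext_loc (fun _ => if Z.eq_dec x y then 1 else 0)); [|apply is_lim_seq_const].
      exists (Z.to_nat (Z.abs x)). intros n Hn. symmetry. apply tp_0. apply inD_intro; auto. lia. }
    apply is_lim_seq_unique in E. unfold minimal_tf. rewrite E. reflexivity.
  - intros t x y Ht Ix Iy. pose proof (minimal_tf_lim t x y Ht Ix) as H.
    eapply (is_lim_seq_le_eventually (fun _ => 0) _ 0 _ O); [|apply is_lim_seq_const|exact H].
    intros; now apply tp_nonneg.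
  - intros x y Ix Iy. apply (HB y x Ix).
  - intros t x y Ht Ix Iy. apply (HB y x Ix). exact Ht.
Qed.

(** The truncations lie below [q] by comparison, and [q] lies below their limit because that limit
    is itself a solution. Symmetry and the mass bound of [q] are inherited through this limit. *)
Lemma chain_tf_lim q : is_chain_tf isN up down q ->
  forall t x y, 0 <= t -> I x -> I y -> is_lim_seq (fun N => tp N t x y) (q t x y).
Proof.
  intros [(Hq0 & Hpos & Hrc & Hd) Hmin] t x y Ht Ix Iy.
  replace (q t x y) with (minimal_tf t x y); [now apply minimal_tf_lim|].
  apply Rle_antisym.
  - eapply (is_lim_seq_le_eventually _ (fun _ => q t x y) _ _ O);
      [|now apply minimal_tf_lim|apply is_lim_seq_const].
    intros n _. apply (tp_comparison n (fun t x => q t x y)); auto.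
    + intros z Iz. rewrite Hq0 by auto. lra.
    + intros z Iz. exact (Hrc z y Iz Iy).
    + intros z Hz s Hs. apply Hd; auto. now apply (inD_I n).
  - apply Hmin; auto. apply minimal_tf_bw_sol.
Qed.

(** * Detailed balance *)

Section Reversible.

Context (m : Z -> R)
  (Hrev : forall x, I x -> m x * up x = m (x + 1)%Z * down (x + 1)%Z).

(** The recursion of [bpow] multiplies by the one-step matrix on the source side, this identity on
    the target side. The induction for symmetry of powers needs both. *)
Lemma bpow_right N y k x : inD N y = true ->
  bpow N y (S k) x = (rate_bound N - up y - down y) * bpow N y k x
    + up (y - 1)%Z * bpow N (y - 1) k x + down (y + 1)%Z * bpow N (y + 1) k x.
Proof.
  intros Hy. revert x. induction k; intros x.
  - simpl. unfold step. destruct (inD N x) eqn:E; [|ring].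
    destruct (Z.eq_dec x y) as [->|Hxy].
    + destruct (Z.eq_dec (y + 1) y), (Z.eq_dec (y - 1) y), (Z.eq_dec y (y - 1)), (Z.eq_dec y (y + 1)); try lia.
      destruct (inD N (y + 1)), (inD N (y - 1)); ring.
    + destruct (Z.eq_dec (x + 1) y) as [<-|H1].
      * rewrite Hy. destruct (Z.eq_dec (x - 1) (x + 1)), (Z.eq_dec x (x + 1 - 1)), (Z.eq_dec x (x + 1 + 1)); try lia.
        replace (x + 1 - 1)%Z with x by lia. destruct (inD N (x - 1)); ring.
      * destruct (Z.eq_dec x (y - 1)); [lia|]. destruct (Z.eq_dec (x - 1) y) as [<-|H2].
        -- rewrite Hy. destruct (Z.eq_dec x (x - 1 + 1)); [|lia].
           replace (x - 1 + 1)%Z with x by lia. destruct (inD N (x + 1)); ring.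
        -- destruct (Z.eq_dec x (y + 1)); [lia|]. destruct (inD N (x + 1)), (inD N (x - 1)); ring.
  - change (bpow N y (S k) x) with (step N (bpow N y k) x).
    change (bpow N y (S (S k)) x) with (step N (bpow N y (S k)) x).
    change (bpow N (y - 1) (S k) x) with (step N (bpow N (y - 1) k) x).
    change (bpow N (y + 1) (S k) x) with (step N (bpow N (y + 1) k) x).
    unfold step. destruct (inD N x); [rewrite !IHk; ring|ring].
Qed.

Lemma bpow_sym N k x y : inD N x = true -> inD N y = true ->
  m x * bpow N y k x = m y * bpow N x k y.
Proof.
  revert x y. induction k; intros x y Hx Hy.
  - simpl. rewrite Hx, Hy. destruct (Z.eq_dec x y), (Z.eq_dec y x); subst; congruence || ring.
  - rewrite (bpow_right N x k y Hx). simpl bpow. unfold step. rewrite Hx.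
    assert (H1 : m x * up x * bpow N y k (x + 1) = m y * (down (x + 1)%Z * bpow N (x + 1) k y)).
    { destruct (inD N (x + 1)) eqn:E.
      - rewrite Hrev by now apply (inD_I N).
        transitivity (down (x + 1)%Z * (m (x + 1)%Z * bpow N y k (x + 1))); [ring|].
        rewrite IHk by auto. ring.
      - rewrite bpow_out, bpow_out_target by auto. ring. }
    assert (H2 : m x * down x * bpow N y k (x - 1) = m y * (up (x - 1)%Z * bpow N (x - 1) k y)).
    { destruct (inD N (x - 1)) eqn:E.
      - replace (m x * down x) with (m (x - 1)%Z * up (x - 1)%Z).
        + transitivity (up (x - 1)%Z * (m (x - 1)%Z * bpow N y k (x - 1))); [ring|].
          rewrite IHk by auto. ring.
        + rewrite Hrev by now apply (inD_I N). replace (x - 1 + 1)%Z with x by lia. reflexivity.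
      - rewrite bpow_out, bpow_out_target by auto. ring. }
    transitivity ((rate_bound N - up x - down x) * (m x * bpow N y k x)
      + m x * up x * bpow N y k (x + 1) + m x * down x * bpow N y k (x - 1)); [ring|].
    rewrite IHk, H1, H2 by auto. ring.
Qed.

Lemma tp_sym N t x y : inD N x = true -> inD N y = true -> m x * tp N t x y = m y * tp N t y x.
Proof.
  intros Hx Hy. unfold tp.
  assert (E : forall w (a : nat -> R), w * (exp (- rate_bound N * t) * PSeries a t) =
     exp (- rate_bound N * t) * PSeries (PS_scal w a) t).
  { intros. rewrite PSeries_scal. ring. }
  rewrite !E. f_equal. apply PSeries_ext. intros k.
  unfold PS_scal, scal; simpl. unfold mult; simpl. unfold Rdiv. rewrite <- !Rmult_assoc.
  now rewrite bpow_sym.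
Qed.

Lemma chain_tf_sym q : is_chain_tf isN up down q ->
  forall t x y, 0 <= t -> I x -> I y -> m x * q t x y = m y * q t y x.
Proof.
  intros Hq t x y Ht Ix Iy.
  assert (H1 : is_lim_seq (fun N => m x * tp N t x y) (m x * q t x y)).
  { apply (is_lim_seq_scal_l (fun N => tp N t x y) (m x) (q t x y)). now apply chain_tf_lim. }
  assert (H2 : is_lim_seq (fun N => m y * tp N t y x) (m y * q t y x)).
  { apply (is_lim_seq_scal_l (fun N => tp N t y x) (m y) (q t y x)). now apply chain_tf_lim. }
  apply (is_lim_seq_ext_loc _ (fun N => m y * tp N t y x)) in H1.
  - apply is_lim_seq_unique in H1. apply is_lim_seq_unique in H2. congruence.
  - exists (Z.to_nat (Z.abs x) + Z.to_nat (Z.abs y))%nat. intros n Hn.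
    apply tp_sym; apply inD_intro; auto; lia.
Qed.

End Reversible.

Lemma chain_tf_sum_le_1 q : is_chain_tf isN up down q ->
  forall t x l, 0 <= t -> I x -> Forall (fun y => I y) l -> NoDup l ->
  sum_list (fun y => q t x y) l <= 1.
Proof.
  intros Hq t x l Ht Ix Hl Nl. rewrite Forall_forall in Hl.
  eapply (is_lim_seq_le_eventually (fun N => sum_list (fun y => tp N t x y) l) (fun _ => 1) _ _ O).
  - intros; now apply tp_sum_le_1.
  - apply is_lim_seq_sum_list. intros; apply chain_tf_lim; auto.
  - apply is_lim_seq_const.
Qed.

Lemma chain_tf_bounds q : is_chain_tf isN up down q ->
  forall t x y, 0 <= t -> I x -> I y -> 0 <= q t x y <= 1.
Proof.
  intros Hq t x y Ht Ix Iy. split; [now apply Hq|].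
  pose proof (chain_tf_sum_le_1 q Hq t x [y] Ht Ix ltac:(auto) ltac:(repeat constructor; auto)) as H.
  rewrite sum_list_cons in H. unfold sum_list in H. simpl in H. lra.
Qed.

Lemma chain_tf_mass q (Hq : is_chain_tf isN up down q) A t x :
  (forall z, A z -> I z) -> 0 <= t -> I x ->
  has_sum A (q t x) (tsum A (q t x)) /\ 0 <= tsum A (q t x) <= 1.
Proof.
  intros HA Ht Ix.
  assert (Hpos : forall z, A z -> 0 <= q t x z) by (intros; now apply Hq; auto).
  assert (Hle : forall G, NoDup G -> Forall A G -> sum_list (q t x) G <= 1).
  { intros G NG AG. apply (chain_tf_sum_le_1 q Hq t x G); auto. eapply Forall_impl; [|exact AG]; auto. }
  destruct (nonneg_summable A (q t x) 1 Hpos Hle) as [l Hl].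
  rewrite (tsum_has_sum _ _ _ Hl). split; auto. split.
  - exact (has_sum_partial_le A _ _ [] Hpos Hl (NoDup_nil _) (Forall_nil _)).
  - exact (has_sum_upper A _ _ _ Hl Hle).
Qed.

Lemma chain_tf_mass_0 q (Hq : is_chain_tf isN up down q) A x :
  (forall z, A z -> I z) -> I x -> tsum A (q 0 x) = if decb (A x) then 1 else 0.
Proof.
  intros HA Ix. apply tsum_has_sum. pose proof (proj1 (proj1 Hq)) as H0.
  assert (Hz : forall z, A z -> z <> x -> q 0 x z = 0).
  { intros z Az Hne. rewrite H0 by auto. destruct (Z.eq_dec x z); congruence. }
  destruct (decb (A x)) eqn:E.
  - replace 1 with (q 0 x x) by (rewrite H0 by auto; destruct (Z.eq_dec x x); congruence).
    apply has_sum_singleton; auto. now apply -> decb_true in E.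
  - apply (has_sum_eq _ (fun _ => 0)); [|apply has_sum_zero]. intros z Az. symmetry. apply Hz; auto.
    intros ->. apply <- decb_true in Az. congruence.
Qed.

End Truncation.

(** Dominated convergence over finite windows that move with [n]: a finite set carrying most of [a]
    eventually lies inside the window, and [a] bounds the remainder. *)
Lemma monotone_sum_lim {T} (A : T -> Prop) (a_ : nat -> T -> R) (a : T -> R) (E : nat -> list T) L :
  (forall n x, A x -> 0 <= a_ n x <= a x) ->
  (forall x, A x -> is_lim_seq (fun n => a_ n x) (a x)) ->
  (forall n, NoDup (E n) /\ Forall A (E n)) ->
  (forall x, A x -> exists n0, forall n, (n0 <= n)%nat -> In x (E n)) ->
  has_sum A a L -> is_lim_seq (fun n => sum_list (a_ n) (E n)) L.
Proof.
  intros Ha Hlim HE Hex HL. apply is_lim_seq_spec. intros eps. simpl.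
  destruct (HL (eps / 2)) as (F & NF & AF & HF); [pose proof (cond_pos eps); lra|].
  specialize (HF F NF AF (incl_refl F)). apply Rabs_def2 in HF. rewrite Forall_forall in AF.
  assert (HlF : is_lim_seq (fun n => sum_list (a_ n) F) (sum_list a F)).
  { apply (is_lim_seq_sum_list F (fun x n => a_ n x) a). auto. }
  apply is_lim_seq_spec in HlF. destruct (HlF (pos_div_2 eps)) as [n1 Hn1]. simpl in Hn1.
  assert (Hin : exists n0, forall n, (n0 <= n)%nat -> incl F (E n)).
  { clear -AF Hex. induction F as [|b F IH]; [exists O; intros n _ x []|].
    destruct IH as [n0 H0]; [intros; apply AF; right; auto|].
    destruct (Hex b (AF b (or_introl eq_refl))) as [n1 H1].
    exists (n0 + n1)%nat. intros n Hn x [<-|Hx]; [apply H1; lia|apply (H0 n); auto; lia]. }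
  destruct Hin as [n2 Hn2]. exists (n1 + n2)%nat. intros n Hn.
  specialize (Hn1 n ltac:(lia)). specialize (Hn2 n ltac:(lia)).
  destruct (HE n) as [NE AE]. pose proof AE as AE'. rewrite Forall_forall in AE.
  apply Rabs_def2 in Hn1.
  assert (sum_list (a_ n) F <= sum_list (a_ n) (E n)).
  { apply sum_list_incl; auto. intros; apply Ha; auto. }
  assert (sum_list (a_ n) (E n) <= sum_list a (E n)) by (apply sum_list_le; intros; apply Ha; auto).
  assert (sum_list a (E n) <= L).
  { apply (has_sum_partial_le A); auto. intros x Hx. specialize (Ha n x Hx). lra. }
  apply Rabs_def1; lra.
Qed.

Lemma sumZ_telescope f a b : (a - 1 <= b)%Z -> sumZ a b (fun z => f z - f (z - 1)%Z) = f b - f (a - 1)%Z.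
Proof.
  revert b. apply (sumZ_ind (fun b => sumZ a b (fun z => f z - f (z - 1)%Z) = f b - f (a - 1)%Z)).
  - rewrite sumZ_empty by lia. ring.
  - intros b Hb IH. rewrite sumZ_last, IH by auto. ring.
Qed.

(** The expected value of [V] grows at most linearly in time while [V] tends to infinity at the
    ends, which rules out explosion. The normalisation by 1 makes [V x + t] the relevant bound. *)
Definition lyapunov (isN : bool) (up down V : Z -> R) : Prop :=
  (forall x, inI isN x = true -> 0 <= V x) /\
  (forall x, inI isN x = true -> gen isN up down V x <= 1) /\
  (forall b, exists N : nat, forall x, inI isN x = true -> (Z.of_nat N < Z.abs x)%Z -> b <= V x).

(** * Uniqueness of bounded solutions and conservation of mass *)

Section Lyapunov.

Context (isN : bool) (up down : Z -> R) (Hr : nonneg_rates isN up down).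
Context (V : Z -> R) (HV : lyapunov isN up down V).
Notation I x := (inI isN x = true).
Notation gen := (gen isN up down).

Lemma gen_const_le k x : I x -> 0 <= k -> gen (fun _ => k) x <= 0.
Proof.
  intros Ix Hk. destruct (Hr x Ix) as [Hu Hd]. unfold Defs.gen, ext.
  destruct (inI isN (x + 1)), (inI isN (x - 1)); nra.
Qed.

Lemma bounded_nonneg (u : R -> Z -> R) b : 0 <= b ->
  (forall t x, 0 <= t -> I x -> Rabs (u t x) <= b) ->
  (forall x, I x -> 0 <= u 0 x) ->
  (forall x, I x -> right_cont0 (fun t => u t x)) ->
  (forall x, I x -> bw_derivative isN up down u x) ->
  forall t x, 0 <= t -> I x -> 0 <= u t x.
Proof.
  intros Hb HB H0 Hrc Hd. destruct HV as (V0 & Vgen & Vinf).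
  apply (lyapunov_principle (fun x => I x) V 1 b u (fun t x => gen (u t) x)); auto; try lra.
  - intros c. destruct (Vinf (c + 1)) as [N HN].
    exists (zlist (- Z.of_nat N) (Z.of_nat N)). intros x Ix Hx. apply zlist_In.
    destruct (Z_lt_le_dec (Z.of_nat N) (Z.abs x)); [|lia]. specialize (HN x Ix l). lra.
  - intros t x Ht Ix. specialize (HB t x Ht Ix). apply Rabs_le_between in HB. lra.
  - intros t x Ht Ix. now apply Hd.
  - intros e t x He Ht Ix Hneg Hmin.
    (* With the constant [e t] included the value at [x] is known to be negative, as [gen_at_min]
       requires. The generator of a nonnegative constant is at most 0, so this term is dropped
       afterwards. *)
    assert (Hge : 0 <= gen (fun z => 1 * (1 * u t z + e * V z) + (e * t) * 1) x).
    { destruct (Hr x Ix). apply gen_at_min; auto; [lra| |].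
      - intros Iy. specialize (Hmin _ Iy). lra.
      - intros Iy. specialize (Hmin _ Iy). lra. }
    rewrite (gen_linear isN up down 1 (e * t) (fun z => 1 * u t z + e * V z) (fun _ => 1)) in Hge.
    rewrite gen_linear in Hge.
    pose proof (gen_const_le 1 x Ix ltac:(lra)) as Hc. specialize (Vgen x Ix).
    assert (e * gen V x <= e * 1) by (apply Rmult_le_compat_l; lra).
    assert (0 <= e * t) by (apply Rmult_le_pos; lra).
    assert (e * t * gen (fun _ => 1) x <= 0) by nra. lra.
Qed.

Lemma bounded_unique (u v : R -> Z -> R) b : 0 <= b ->
  (forall t x, 0 <= t -> I x -> Rabs (u t x) <= b) ->
  (forall t x, 0 <= t -> I x -> Rabs (v t x) <= b) ->
  (forall x, I x -> u 0 x = v 0 x) ->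
  (forall x, I x -> right_cont0 (fun t => u t x)) ->
  (forall x, I x -> right_cont0 (fun t => v t x)) ->
  (forall x, I x -> bw_derivative isN up down u x) ->
  (forall x, I x -> bw_derivative isN up down v x) ->
  forall t x, 0 <= t -> I x -> u t x = v t x.
Proof.
  intros Hb Bu Bv H0 Ru Rv Du Dv.
  assert (Hmain : forall (f g : R -> Z -> R),
    (forall t x, 0 <= t -> I x -> Rabs (f t x) <= b) ->
    (forall t x, 0 <= t -> I x -> Rabs (g t x) <= b) ->
    (forall x, I x -> f 0 x = g 0 x) ->
    (forall x, I x -> right_cont0 (fun t => f t x)) ->
    (forall x, I x -> right_cont0 (fun t => g t x)) ->
    (forall x, I x -> bw_derivative isN up down f x) ->
    (forall x, I x -> bw_derivative isN up down g x) ->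
    forall t x, 0 <= t -> I x -> g t x <= f t x).
  { intros f g Bf Bg E0 Rf Rg Df Dg t x Ht Ix.
    enough (0 <= 1 * f t x + -1 * g t x) by lra.
    apply (bounded_nonneg (fun t x => 1 * f t x + -1 * g t x) (2 * b)); auto; [lra| | | |].
    - intros s z Hs Iz. specialize (Bf s z Hs Iz). specialize (Bg s z Hs Iz).
      apply Rabs_le_between in Bf. apply Rabs_le_between in Bg. apply Rabs_le. lra.
    - intros z Iz. rewrite E0 by auto. lra.
    - intros z Iz. apply right_cont0_plus; apply right_cont0_mult; try apply right_cont0_const; auto.
    - intros z Iz s Hs. rewrite gen_linear.
      apply (derivable_pt_lim_plus (fun s => 1 * f s z) (fun s => -1 * g s z));
        apply derivable_pt_lim_scal; [now apply Df|now apply Dg]. }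
  intros t x Ht Ix. apply Rle_antisym; apply Hmain; auto. intros; symmetry; auto.
Qed.

(** The missing mass is dominated by [(V x + t) / b] if [V] is at least [b] outside the truncation:
    this function is a supersolution and is at least 1 where the truncated chain is killed. *)
Lemma tp_mass_lim t x : (forall z, I z -> gen (fun _ => 1) z = 0) -> 0 <= t -> I x ->
  is_lim_seq (fun N => sum_list (tp isN up down N t x) (zlist (- Z.of_nat N) (Z.of_nat N))) 1.
Proof.
  intros Hcons Ht Ix. destruct HV as (V0 & Vgen & Vinf).
  apply is_lim_seq_spec. intros eps. simpl.
  (* Makes [(V x + t) / b] smaller than [eps]. *)
  set (b := (V x + t + 1) / eps).
  assert (Hb : 0 < b).
  { apply Rdiv_lt_0_compat; [|apply cond_pos]. specialize (V0 x Ix). lra. }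
  destruct (Vinf b) as [N0 HN0]. exists N0. intros N HN.
  set (E := zlist (- Z.of_nat N) (Z.of_nat N)).
  assert (Hle : sum_list (tp isN up down N t x) E <= 1).
  { apply (tp_sum_le_1 isN up down Hr N t x E Ht Ix). apply zlist_NoDup. }
  assert (HD : forall s z, inD isN N z = true -> derivable_pt_lim
    (fun t => / b * (V z + 1 * t) - (1 - sum_list (fun y => tp isN up down N t z y) E)) s
    (/ b * (0 + 1 * 1) - (0 - sum_list (fun y => gen (fun z => tp isN up down N s z y) z) E))).
  { intros s z Hz. apply (derivable_pt_lim_minus (fun t => / b * (V z + 1 * t))).
    - apply derivable_pt_lim_scal. apply (derivable_pt_lim_plus (fun _ => V z)).
      + apply derivable_pt_lim_const.
      + apply (derivable_pt_lim_scal id), derivable_pt_lim_id.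
    - apply (derivable_pt_lim_minus (fun _ => 1)); [apply derivable_pt_lim_const|].
      apply (derivable_pt_lim_sum_list E (fun y s => tp isN up down N s z y)). intros; now apply tp_derive. }
  assert (Hge : 0 <= / b * (V x + 1 * t) - (1 - sum_list (fun y => tp isN up down N t x y) E)).
  { apply (trunc_principle isN up down Hr N
      (fun t x => / b * (V x + 1 * t) - (1 - sum_list (fun y => tp isN up down N t x y) E))
      (fun t x => / b * (0 + 1 * 1) - (0 - sum_list (fun y => gen (fun z => tp isN up down N t z y) x) E))); auto.
    - intros z Hz. rewrite (sum_list_ext _ (fun y => if Z.eq_dec z y then 1 else 0))
        by (intros; now apply tp_0).
      assert (1 <= sum_list (fun y => if Z.eq_dec z y then 1 else 0) E).
      { replace 1 with (sum_list (fun y => if Z.eq_dec z y then 1 else 0) [z]) at 1.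
        - apply sum_list_incl; [repeat constructor; auto| |intros w _; destruct (Z.eq_dec z w); lra].
          intros w [<-|[]]. apply zlist_In. apply inD_abs in Hz. lia.
        - unfold sum_list; simpl. destruct (Z.eq_dec z z); [ring|congruence]. }
      assert (0 <= / b * (V z + 1 * 0)).
      { apply Rmult_le_pos; [left; now apply Rinv_0_lt_compat|]. specialize (V0 z (inD_I _ _ _ Hz)). lra. }
      lra.
    - intros z Hz. eapply right_cont0_derivable. now apply HD.
    - intros s z Hs Hz. rewrite <- gen_sum_list.
      rewrite (gen_ext isN up down _ (fun z => 1 * (/ b * V z + (/ b * s - 1) * 1) +
         1 * sum_list (fun w => tp isN up down N s z w) E))
        by (first [now apply (inD_I _ N)|intros; ring]).
      rewrite (gen_linear isN up down 1 1 (fun z => / b * V z + (/ b * s - 1) * 1)).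
      rewrite (gen_linear isN up down (/ b) (/ b * s - 1) V (fun _ => 1)).
      rewrite Hcons by now apply (inD_I _ N).
      specialize (Vgen z (inD_I _ _ _ Hz)).
      assert (/ b * gen V z <= / b * 1) by (apply Rmult_le_compat_l; auto; left; now apply Rinv_0_lt_compat).
      lra.
    - intros s z Hs Iz Hz. rewrite sum_list_zero by (intros; now apply tp_out).
      apply inD_false in Hz; auto. specialize (HN0 z Iz ltac:(lia)).
      assert (/ b * b <= / b * (V z + 1 * s)).
      { apply Rmult_le_compat_l; [left; now apply Rinv_0_lt_compat|lra]. }
      rewrite Rinv_l in H by lra. lra. }
  assert (/ b * (V x + 1 * t) < eps).
  { unfold b. rewrite Rinv_div. specialize (V0 x Ix). pose proof (cond_pos eps).
    apply Rmult_lt_reg_r with (V x + t + 1); [lra|].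
    replace (eps / (V x + t + 1) * (V x + 1 * t) * (V x + t + 1)) with (eps * (V x + t)) by (field; lra).
    nra. }
  change (fun y => tp isN up down N t x y) with (tp isN up down N t x) in Hge.
  apply Rabs_def1; lra.
Qed.

End Lyapunov.

(** * Forward evolution of distribution functions *)

Section Distribution.

Context (isN : bool) (up down : Z -> R) (Hr : nonneg_rates isN up down).
Context (V : Z -> R) (HV : lyapunov isN up down V).
Context (m : Z -> R) (Hm : forall x, inI isN x = true -> 0 < m x)
  (Hrev : forall x, inI isN x = true -> m x * up x = m (x + 1)%Z * down (x + 1)%Z).
Context (Hcons : forall z, inI isN z = true -> gen isN up down (fun _ => 1) z = 0).
Context (p : R -> Z -> Z -> R) (Hp : is_chain_tf isN up down p).
Notation I x := (inI isN x = true).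
Notation gen := (gen isN up down).
Notation tp := (tp isN up down).

(** The net downward flow across the bond between [w] and [w + 1], hence the rate of change of the
    mass on sites up to [w]. *)
Definition flux (f : Z -> R) (w : Z) : R := down (w + 1)%Z * f (w + 1)%Z - up w * f w.

(** The forward equation is the backward equation of the transposed kernel, carried over by detailed
    balance. *)
Lemma tp_forward N t x z : inD isN N x = true -> inD isN N z = true ->
  derivable_pt_lim (fun s => tp N s x z) t (flux (tp N t x) z - flux (tp N t x) (z - 1)).
Proof.
  intros Hx Hz.
  assert (mx : 0 < m x) by (apply Hm; now apply (inD_I _ N)).
  assert (mz : 0 < m z) by (apply Hm; now apply (inD_I _ N)).
  assert (H : derivable_pt_lim (fun s => m z / m x * tp N s z x) t
     (m z / m x * gen (fun w => tp N t w x) z)).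
  { apply derivable_pt_lim_scal. now apply tp_derive. }
  assert (Hs : forall s w, inD isN N w = true -> m w / m x * tp N s w x = tp N s x w).
  { intros s w Hw. pose proof (tp_sym isN up down m Hrev N s x w Hx Hw).
    apply Rmult_eq_reg_l with (m x); [|lra]. rewrite H0. field. lra. }
  replace (flux (tp N t x) z - flux (tp N t x) (z - 1)) with (m z / m x * gen (fun w => tp N t w x) z).
  - intros eps He. destruct (H eps He) as [d Hd]. exists d. intros h Hh0 Hh.
    specialize (Hd h Hh0 Hh). now rewrite !Hs in Hd by auto.
  - unfold Defs.gen. rewrite !ext_tp. unfold flux. replace (z - 1 + 1)%Z with z by lia.
    assert (H1 : m z / m x * (up z * tp N t (z + 1) x) = down (z + 1)%Z * tp N t x (z + 1)).
    { destruct (inD isN N (z + 1)) eqn:E.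
      - rewrite <- (Hs t (z + 1)%Z E). transitivity (m z * up z / m x * tp N t (z + 1) x); [field; lra|].
        rewrite Hrev by now apply (inD_I _ N). field. lra.
      - rewrite tp_out, tp_out_target by auto. ring. }
    assert (H2 : m z / m x * (down z * tp N t (z - 1) x) = up (z - 1)%Z * tp N t x (z - 1)).
    { destruct (inD isN N (z - 1)) eqn:E.
      - rewrite <- (Hs t (z - 1)%Z E). transitivity (m z * down z / m x * tp N t (z - 1) x); [field; lra|].
        replace (m z * down z) with (m (z - 1)%Z * up (z - 1)%Z); [field; lra|].
        rewrite Hrev by now apply (inD_I _ N). now replace (z - 1 + 1)%Z with z by lia.
      - rewrite tp_out, tp_out_target by auto. ring. }
    rewrite !Rmult_minus_distr_l, Rmult_plus_distr_l, !Rmult_minus_distr_l, H1, H2.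
    rewrite <- (Hs t z Hz). field. lra.
Qed.

Definition lowest (N : nat) : Z := if isN then 0%Z else (- Z.of_nat N)%Z.

Lemma lowest_inD N z : (lowest N <= z <= Z.of_nat N)%Z -> inD isN N z = true.
Proof.
  unfold lowest. intros H. apply inD_intro.
  - unfold inI. destruct isN; auto. apply Z.leb_le. lia.
  - destruct isN; lia.
Qed.

Lemma lowest_outD N : inD isN N (lowest N - 1) = false.
Proof.
  destruct (inD isN N (lowest N - 1)) eqn:E; auto. exfalso.
  pose proof (inD_I _ _ _ E) as E1. pose proof (inD_abs _ _ _ E) as E2.
  unfold lowest, inI in *. destruct isN; [apply Z.leb_le in E1|]; lia.
Qed.

Lemma lowest_le N z : inD isN N z = true -> (lowest N <= z)%Z.
Proof.
  intros H. pose proof (inD_I _ _ _ H) as E1. pose proof (inD_abs _ _ _ H) as E2.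
  unfold lowest, inI in *. destruct isN; [apply Z.leb_le in E1|]; lia.
Qed.

Definition tp_cdf (N : nat) (t : R) (x w : Z) : R := sumZ (lowest N) w (tp N t x).

(** The forward equation telescopes to the flux at [w] and the mass killed at the lower end. *)
Lemma tp_cdf_derive N t x w : inD isN N x = true -> inD isN N w = true ->
  derivable_pt_lim (fun s => tp_cdf N s x w) t
    (flux (tp N t x) w - down (lowest N) * tp N t x (lowest N)).
Proof.
  intros Hx Hw. pose proof (lowest_le N w Hw). pose proof (inD_abs _ _ _ Hw).
  replace (_ - _) with (sum_list (fun z => flux (tp N t x) z - flux (tp N t x) (z - 1))
     (zlist (lowest N) w)).
  - pose proof (derivable_pt_lim_sum_list (zlist (lowest N) w) (fun z s => tp N s x z)
      (fun z => flux (tp N t x) z - flux (tp N t x) (z - 1)) t) as HD.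
    intros eps He. destruct (HD ltac:(intros z Hz; apply zlist_In in Hz; apply tp_forward; auto;
      apply lowest_inD; lia) eps He) as [d Hd].
    exists d. intros h Hh0 Hh. unfold tp_cdf. rewrite !sumZ_list. now apply Hd.
  - rewrite <- sumZ_list, (sumZ_telescope (flux (tp N t x))) by lia. f_equal.
    unfold flux. rewrite (tp_out_target isN up down N t x (lowest N - 1)) by apply lowest_outD.
    replace (lowest N - 1 + 1)%Z with (lowest N) by lia. ring.
Qed.

Definition cdf (t : R) (x w : Z) : R := tsum (fun z => I z /\ (z <= w)%Z) (p t x).

Lemma cdf_has_sum t x w : 0 <= t -> I x -> has_sum (fun z => I z /\ (z <= w)%Z) (p t x) (cdf t x w).
Proof. intros Ht Ix. apply (chain_tf_mass isN up down Hr p Hp); tauto. Qed.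

Lemma cdf_bounds t x w : 0 <= t -> I x -> 0 <= cdf t x w <= 1.
Proof. intros Ht Ix. apply (chain_tf_mass isN up down Hr p Hp); tauto. Qed.

Lemma cdf_step t x w : 0 <= t -> I x -> I w -> cdf t x w = cdf t x (w - 1) + p t x w.
Proof.
  intros Ht Ix Iw. eapply has_sum_unique; [now apply cdf_has_sum|].
  apply (has_sum_disjoint_union (fun z => I z /\ (z <= w - 1)%Z) (fun z => z = w));
    [lia| |now apply cdf_has_sum|].
  - intros z. split; [intros [Iz Hz]; destruct (Z.eq_dec z w); [auto|left; split; auto; lia]|].
    intros [[Iz Hz]| ->]; split; auto; lia.
  - apply has_sum_singleton; tauto.
Qed.

Lemma cdf_below_zero t x w : 0 <= t -> I x -> ~ I w -> cdf t x w = 0.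
Proof.
  intros Ht Ix Iw. eapply has_sum_unique; [now apply cdf_has_sum|].
  eapply has_sum_ext; [| |apply (has_sum_zero (fun _ : Z => False))]; simpl; [|tauto].
  intros z. split; [tauto|]. intros [Iz Hz]. apply Iw. now apply (inI_le isN z).
Qed.

Lemma cdf_0 x w : I x -> I w -> cdf 0 x w = if Z.leb x w then 1 else 0.
Proof.
  intros Ix Iw. unfold cdf. rewrite (chain_tf_mass_0 isN up down p Hp) by tauto.
  destruct (Z.leb_spec x w) as [H|H].
  - now rewrite (proj2 (decb_true (I x /\ (x <= w)%Z)) (conj Ix H)).
  - destruct (decb _) eqn:E; auto. apply -> decb_true in E. lia.
Qed.

Lemma tp_cdf_lim t x w : 0 <= t -> I x -> I w -> is_lim_seq (fun N => tp_cdf N t x w) (cdf t x w).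
Proof.
  intros Ht Ix Iw.
  set (E := fun N : nat => filter (inI isN) (zlist (- Z.of_nat N) w)).
  apply (is_lim_seq_ext_loc (fun N => sum_list (tp N t x) (E N))).
  - exists (Z.to_nat (Z.abs w)). intros N HN. unfold E, tp_cdf.
    rewrite sum_list_filter_zero.
    + rewrite <- sumZ_list. unfold lowest. destruct isN eqn:EN; auto.
      unfold inI in Iw. apply Z.leb_le in Iw.
      rewrite (sumZ_split (- Z.of_nat N) (-1) w) by lia.
      rewrite sumZ_zero; [simpl; ring|]. intros z Hz. apply tp_out_target.
      unfold inD, inI. destruct (Z.leb_spec 0 z); auto; lia.
    + intros z Hz Hn. apply tp_out_target. unfold inD. now rewrite Hn.
  - apply (monotone_sum_lim (fun z => I z /\ (z <= w)%Z) (fun N => tp N t x) (p t x)).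
    + intros N z [Iz _]. split; [now apply tp_nonneg|].
      apply (is_lim_seq_incr_compare (fun N => tp N t x z) (p t x z)).
      * now apply chain_tf_lim.
      * intros; now apply tp_mono.
    + intros z [Iz _]. now apply chain_tf_lim.
    + intros N. split; [apply NoDup_filter, zlist_NoDup|]. apply Forall_forall. intros z Hz.
      apply filter_In in Hz. destruct Hz as [Hz Iz]. apply zlist_In in Hz. split; auto; lia.
    + intros z [Iz Hz]. exists (Z.to_nat (Z.abs z)). intros n Hn. apply filter_In. split; auto.
      apply zlist_In. lia.
    + now apply cdf_has_sum.
Qed.

Lemma tp_total_lim t x : 0 <= t -> I x -> is_lim_seq (fun N => tp_cdf N t x (Z.of_nat N)) 1.
Proof.
  intros Ht Ix. eapply is_lim_seq_ext; [|apply (tp_mass_lim isN up down Hr V HV t x Hcons Ht Ix)].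
  intros N. cbv beta. unfold tp_cdf. rewrite <- sumZ_list. unfold lowest. destruct isN; auto.
  rewrite (sumZ_split (- Z.of_nat N) (-1) (Z.of_nat N)) by lia.
  rewrite sumZ_zero; [simpl; ring|]. intros z Hz. apply tp_out_target.
  unfold inD, inI. destruct (Z.leb_spec 0 z); auto; lia.
Qed.

Definition flux_norm (w : Z) : R := Rabs (down (w + 1)%Z) + Rabs (up w).

Lemma flux_bound f w b : Rabs (f (w + 1)%Z) <= b -> Rabs (f w) <= b -> Rabs (flux f w) <= flux_norm w * b.
Proof.
  intros H1 H2. unfold flux, flux_norm, Rminus. eapply Rle_trans; [apply Rabs_triang|].
  rewrite Rabs_Ropp, !Rabs_mult.
  pose proof (Rmult_le_compat_l _ _ _ (Rabs_pos (down (w + 1)%Z)) H1).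
  pose proof (Rmult_le_compat_l _ _ _ (Rabs_pos (up w)) H2). lra.
Qed.

Lemma flux_norm_nonneg w : 0 <= flux_norm w.
Proof. unfold flux_norm. pose proof (Rabs_pos (down (w + 1)%Z)). pose proof (Rabs_pos (up w)). lra. Qed.

(* The mass lost by the truncated chain through its lower end is at most its
   total loss, which tends to [0]; hence no flux at minus infinity. *)
Lemma tp_cdf_sandwich N t x w : 0 <= t -> inD isN N x = true -> inD isN N w = true ->
  let a := flux (tp N t x) w - down (lowest N) * tp N t x (lowest N) in
  let b := flux (tp N t x) w - flux (tp N t x) (Z.of_nat N) in
  derivable_pt_lim (fun s => tp_cdf N s x w) t a /\
  derivable_pt_lim (fun s => tp_cdf N s x w - tp_cdf N s x (Z.of_nat N)) t b /\
  a <= flux (tp N t x) w <= b.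
Proof.
  intros Ht Hx Hw a b. pose proof (inD_I _ _ _ Hx) as Ix.
  assert (HN : inD isN N (Z.of_nat N) = true).
  { apply lowest_inD. unfold lowest. destruct isN; lia. }
  split; [now apply tp_cdf_derive|]. split.
  - replace b with (a - (flux (tp N t x) (Z.of_nat N) - down (lowest N) * tp N t x (lowest N)))
      by (unfold a, b; ring).
    apply (derivable_pt_lim_minus (fun s => tp_cdf N s x w)); now apply tp_cdf_derive.
  - assert (0 <= down (lowest N) * tp N t x (lowest N)).
    { apply Rmult_le_pos; [|now apply tp_nonneg].
      apply (Hr (lowest N)). apply (inD_I _ N). apply lowest_inD. unfold lowest; destruct isN; lia. }
    assert (flux (tp N t x) (Z.of_nat N) <= 0).
    { unfold flux. rewrite (tp_out_target isN up down N t x (Z.of_nat N + 1)).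
      - assert (0 <= up (Z.of_nat N) * tp N t x (Z.of_nat N)); [|lra].
        apply Rmult_le_pos; [|now apply tp_nonneg]. apply (Hr _ (inD_I _ _ _ HN)).
      - destruct (inD isN N (Z.of_nat N + 1)) eqn:E; auto. apply inD_abs in E. lia. }
    unfold a, b. lra.
Qed.

Lemma eventually_inD x w : I x -> I w -> exists n0, forall n, (n0 <= n)%nat ->
  inD isN n x = true /\ inD isN n w = true.
Proof.
  intros Ix Iw. exists (Z.to_nat (Z.abs x) + Z.to_nat (Z.abs w))%nat.
  intros n Hn. split; apply inD_intro; auto; lia.
Qed.

(** The truncated distribution function and its difference with the truncated total mass have
    derivatives on either side of the flux. Their limits differ by a constant, the total mass 1, so
    [limit_derivative] applies with [-1] as the offset. *)
Lemma cdf_derivative t x w : 0 < t -> I x -> I w ->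
  derivable_pt_lim (fun s => cdf s x w) t (flux (p t x) w).
Proof.
  intros Ht Ix Iw. destruct (eventually_inD x w Ix Iw) as [n0 HD].
  assert (HS : forall n s, (n0 <= n)%nat -> 0 < s -> _) by
    (intros n s Hn Hs; destruct (HD n Hn); exact (tp_cdf_sandwich n s x w (Rlt_le _ _ Hs) H H0)).
  cbv zeta in HS.
  apply (limit_derivative (fun n s => tp_cdf n s x w)
    (fun n s => tp_cdf n s x w - tp_cdf n s x (Z.of_nat n))
    (fun n s => flux (tp n s x) w - down (lowest n) * tp n s x (lowest n))
    (fun n s => flux (tp n s x) w - flux (tp n s x) (Z.of_nat n))
    (fun n s => flux (tp n s x) w) (fun s => cdf s x w) (fun s => flux (p s x) w) (-1)
    (flux_norm w * gen_norm up down x) n0); auto.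
  - apply Rmult_le_pos; [apply flux_norm_nonneg|apply gen_norm_nonneg].
  - intros; now apply HS.
  - intros; now apply HS.
  - intros; now apply HS.
  - intros n s r Hn Hs Hr'.
    replace (_ - _) with (flux (fun z => tp n s x z - tp n r x z) w) by (unfold flux; ring).
    rewrite Rmult_assoc.
    (* The kernel solves the backward equation in its source [x], so one Lipschitz constant in time
       serves all targets and all truncations. *)
    assert (HL : forall z, Rabs (tp n s x z - tp n r x z) <= gen_norm up down x * Rabs (s - r)).
    { intros z. rewrite <- (Rmult_1_r (gen_norm up down x)).
      apply (bw_lipschitz isN up down (fun t x => tp n t x z) x 1); auto; [| lra|].
      - intros q Hq. apply tp_derive; auto. now apply HD.
      - intros q y Hq Iy. rewrite Rabs_pos_eq; [now apply tp_le_1|now apply tp_nonneg]. }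
    apply flux_bound; apply HL.
  - intros; apply tp_cdf_lim; auto; lra.
  - intros s Hs. apply is_lim_seq_minus'; [apply tp_cdf_lim; auto; lra|].
    apply tp_total_lim; auto; lra.
  - unfold flux. apply is_lim_seq_minus'.
    + apply (is_lim_seq_scal_l _ (down (w + 1)%Z) (p t x (w + 1)%Z)).
      apply chain_tf_lim; auto; [lra|now apply inI_succ].
    + apply (is_lim_seq_scal_l _ (up w) (p t x w)). apply chain_tf_lim; auto; lra.
Qed.

(** The flux is bounded by [flux_norm w], so increments over [[0, t]] are at most [flux_norm w * t]
    in modulus; each of the two bracketing functions supplies one sign. *)
Lemma cdf_right_cont0 x w : I x -> I w -> right_cont0 (fun t => cdf t x w).
Proof.
  intros Ix Iw.
  assert (HK : forall t, 0 < t -> Rabs (cdf t x w - cdf 0 x w) <= flux_norm w * t).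
  { intros t Ht. destruct (eventually_inD x w Ix Iw) as [n0 HD].
    assert (Hfl : forall n s, 0 <= s -> Rabs (flux (tp n s x) w) <= flux_norm w).
    { intros n s Hs. rewrite <- (Rmult_1_r (flux_norm w)).
      apply flux_bound; rewrite Rabs_pos_eq; try apply tp_le_1; try apply tp_nonneg; auto. }
    assert (L0 : 0 <= 0) by lra. assert (Lt : 0 <= t) by lra.
    apply Rabs_le. split.
    - assert (HL : is_lim_seq (fun n => (tp_cdf n t x w - tp_cdf n t x (Z.of_nat n)) -
         (tp_cdf n 0 x w - tp_cdf n 0 x (Z.of_nat n))) ((cdf t x w - 1) - (cdf 0 x w - 1))).
      { apply is_lim_seq_minus'; apply is_lim_seq_minus'; (now apply tp_cdf_lim) || now apply tp_total_lim. }
      replace (cdf t x w - cdf 0 x w) with ((cdf t x w - 1) - (cdf 0 x w - 1)) by ring.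
      eapply (is_lim_seq_le_eventually (fun _ => - (flux_norm w * t)) _ _ _ n0);
        [|apply is_lim_seq_const|exact HL].
      intros n Hn. destruct (HD n Hn) as [Hx Hw].
      rewrite <- Ropp_mult_distr_l_reverse.
      apply (increment_ge (fun s => tp_cdf n s x w - tp_cdf n s x (Z.of_nat n))); auto.
      intros s Hs. destruct (tp_cdf_sandwich n s x w Hs Hx Hw) as (_ & H2 & H3).
      eexists. split; [exact H2|]. specialize (Hfl n s Hs). apply Rabs_le_between in Hfl. lra.
    - assert (HL : is_lim_seq (fun n => tp_cdf n t x w - tp_cdf n 0 x w) (cdf t x w - cdf 0 x w))
        by (apply is_lim_seq_minus'; now apply tp_cdf_lim).
      eapply (is_lim_seq_le_eventually _ (fun _ => flux_norm w * t) _ _ n0);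
        [|exact HL|apply is_lim_seq_const].
      intros n Hn. destruct (HD n Hn) as [Hx Hw]. apply (increment_le (fun s => tp_cdf n s x w)); auto.
      intros s Hs. destruct (tp_cdf_sandwich n s x w Hs Hx Hw) as (H1 & _ & H3).
      eexists. split; [exact H1|]. specialize (Hfl n s Hs). apply Rabs_le_between in Hfl. lra. }
  intros eps He. exists (eps / (flux_norm w + 1)). pose proof (flux_norm_nonneg w).
  split; [apply Rdiv_lt_0_compat; lra|]. intros t Ht.
  eapply Rle_lt_trans; [apply HK; lra|].
  assert (t * (flux_norm w + 1) < eps / (flux_norm w + 1) * (flux_norm w + 1)) by (apply Rmult_lt_compat_r; lra).
  replace (eps / (flux_norm w + 1) * (flux_norm w + 1)) with eps in H0 by (field; lra). lra.
Qed.

End Distribution.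

(** * Lyapunov functions from natural boundaries *)

Lemma sumZ_shift a b f : sumZ (a + 1) (b + 1) f = sumZ a b (fun j => f (j + 1)%Z).
Proof.
  unfold sumZ. replace (b + 1 - (a + 1) + 1)%Z with (b - a + 1)%Z by lia.
  generalize (Z.to_nat (b - a + 1)) as n. intros n. revert a.
  induction n as [|n IH]; intros a; simpl; [reflexivity|]. now rewrite IH.
Qed.

Section Construction.

Context (isN : bool) (up down m : Z -> R).
Notation I x := (inI isN x = true).
Context (Hup : forall x, I x -> 0 < up x) (Hdown : forall x, I x -> 0 <= down x)
  (Hm : forall x, I x -> 0 < m x)
  (Hrev : forall x, I x -> m x * up x = m (x + 1)%Z * down (x + 1)%Z).

(** The starting points of the upward sums in [natural_boundaries]. *)
Definition base : Z := if isN then 0%Z else 1%Z.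

(** Feller's double sum of resistances against the speed measure [m]: it solves [gen V = 1] from
    [base] on, and vanishes up to [base]. [Vminus] is its mirror image on the negative sites. *)
Definition Vplus (x : Z) : R := sumZ base (x - 1) (fun j => / (up j * m j) * sumZ base j m).
Definition Vminus (x : Z) : R :=
  if isN then 0 else sumZ x (-1) (fun j => / (up j * m j) * sumZ (j + 1) (-1) m).

Lemma base_I x : (base <= x)%Z -> I x.
Proof. unfold base, inI. destruct isN; auto. intros; now apply Z.leb_le. Qed.

Lemma weight_pos x : I x -> 0 < / (up x * m x).
Proof. intros Ix. apply Rinv_0_lt_compat, Rmult_lt_0_compat; auto. Qed.

Lemma Vplus_term_nonneg j : (base <= j)%Z -> 0 <= / (up j * m j) * sumZ base j m.
Proof.
  intros Hj. apply Rmult_le_pos; [left; apply weight_pos; now apply base_I|].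
  apply sumZ_nonneg. intros z Hz. left. apply Hm, base_I. lia.
Qed.

Lemma Vminus_term_nonneg j : isN = false -> 0 <= / (up j * m j) * sumZ (j + 1) (-1) m.
Proof.
  intros HN. assert (HI : forall z, I z) by (intros; unfold inI; now rewrite HN).
  apply Rmult_le_pos; [left; apply weight_pos; auto|].
  apply sumZ_nonneg. intros z Hz. left. now apply Hm.
Qed.

Lemma Vplus_nonneg x : 0 <= Vplus x.
Proof. apply sumZ_nonneg. intros z Hz. apply Vplus_term_nonneg. lia. Qed.

Lemma Vminus_nonneg x : 0 <= Vminus x.
Proof.
  unfold Vminus. assert (isN = true \/ isN = false) as [HN|HN] by (destruct isN; auto);
    rewrite HN; [lra|].
  apply sumZ_nonneg. intros z Hz. now apply Vminus_term_nonneg.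
Qed.

(** By detailed balance the outward and inward increments times their rates are the inner sums up to
    [x] and up to its inner neighbour, both divided by [m x]; they differ by 1. On [Z] the site 0 is
    exceptional, with value 0. *)
Lemma gen_V_le_1 x : I x -> gen isN up down (fun z => Vplus z + Vminus z) x <= 1.
Proof.
  intros Ix. unfold gen. rewrite ext_in by now apply inI_succ.
  pose proof (Hm x Ix) as mx. pose proof (Hup x Ix) as ux.
  assert (Hdm : I (x - 1)%Z -> down x * / (up (x - 1)%Z * m (x - 1)%Z) = / m x).
  { intros I1. pose proof (Hrev (x - 1)%Z I1) as E. replace (x - 1 + 1)%Z with x in E by lia.
    pose proof (Hm _ I1). pose proof (Hup _ I1).
    assert (0 < m (x - 1)%Z * up (x - 1)%Z) by now apply Rmult_lt_0_compat.
    rewrite Rmult_comm in E. apply Rmult_eq_reg_r with (m x * (up (x - 1)%Z * m (x - 1)%Z)); [|nra].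
    transitivity (m x * down x); [field; lra|]. rewrite <- E. field. lra. }
  destruct (Z_le_gt_dec base x) as [Hb|Hb].
  - assert (Hv : forall z, (base - 1 <= z)%Z -> Vminus z = 0).
    { unfold Vminus, base. intros z Hz. destruct isN; auto. apply sumZ_empty. lia. }
    assert (V1 : Vplus (x + 1) - Vplus x = / (up x * m x) * sumZ base x m).
    { unfold Vplus. replace (x + 1 - 1)%Z with x by lia. rewrite (sumZ_last base x) by auto. ring. }
    assert (V0 : down x * (ext isN (fun z => Vplus z + Vminus z) (x - 1) - (Vplus x + Vminus x)) =
       - / m x * sumZ base (x - 1) m).
    (* At [base] the downward jump contributes nothing: [V] vanishes there and at the left
       neighbour, whether or not that neighbour is a killing site. *)
    { destruct (Z.eq_dec x base) as [->|Hne].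
      - rewrite (sumZ_empty base (base - 1)) by lia.
        replace (Vplus base) with 0 by (symmetry; apply sumZ_empty; lia). rewrite Hv by lia.
        unfold ext. replace (Vplus (base - 1)) with 0 by (symmetry; apply sumZ_empty; lia).
        rewrite Hv by lia. destruct (inI isN (base - 1)); ring.
      - assert (I1 : I (x - 1)%Z) by (apply base_I; lia). rewrite ext_in by auto.
        rewrite !Hv by lia. rewrite <- (Hdm I1). unfold Vplus at 2.
        rewrite (sumZ_last base (x - 1)) by lia. unfold Vplus. ring. }
    rewrite V0, !Hv by lia.
    replace (Vplus (x + 1) + 0 - (Vplus x + 0)) with (Vplus (x + 1) - Vplus x) by ring.
    rewrite V1, (sumZ_last base x) by auto. right. field. lra.
  - assert (HN : isN = false).
    { destruct isN eqn:E; auto. unfold base, inI in *. rewrite E in *. apply Z.leb_le in Ix. lia. }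
    assert (HI : forall z, I z) by (intros; unfold inI; now rewrite HN).
    assert (Hbase : base = 1%Z) by (unfold base; now rewrite HN).
    assert (Hv : forall z, (z <= base)%Z -> Vplus z = 0).
    { intros z Hz. apply sumZ_empty. lia. }
    rewrite ext_in by auto. rewrite !Hv by lia.
    assert (V1 : Vminus (x - 1) - Vminus x = / (up (x - 1)%Z * m (x - 1)%Z) * sumZ x (-1) m).
    { unfold Vminus. rewrite HN, (sumZ_first (x - 1) (-1)) by lia.
      replace (x - 1 + 1)%Z with x by lia. ring. }
    assert (V2 : down x * (Vminus (x - 1) - Vminus x) = / m x * sumZ x (-1) m).
    { rewrite V1, <- Hdm by auto. ring. }
    replace (0 + Vminus (x - 1) - (0 + Vminus x)) with (Vminus (x - 1) - Vminus x) by ring.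
    rewrite V2. destruct (Z.eq_dec x 0) as [->|Hne].
    + unfold Vminus. rewrite HN, !sumZ_empty by lia. lra.
    + unfold Vminus. rewrite HN, (sumZ_first x (-1) (fun j => _)), (sumZ_first x (-1) m) by lia.
      right. field. lra.
Qed.

Lemma lyapunov_construction :
  (forall B, exists N, sumZ base N (fun j => / (up j * m j) * sumZ base j m) > B) ->
  (isN = false -> forall B, exists N,
     sumZ (- N) (-1) (fun j => / (up j * m j) * sumZ (j + 1) (-1) m) > B) ->
  lyapunov isN up down (fun x => Vplus x + Vminus x).
Proof.
  intros HU HL. split; [|split].
  - intros x _. pose proof (Vplus_nonneg x). pose proof (Vminus_nonneg x). lra.
  - exact gen_V_le_1.
  - intros b. destruct (HU b) as [N1 H1].
    assert (P1 : forall x, (N1 < x)%Z -> (base < x)%Z -> b <= Vplus x).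
    { intros x Hx Hbx. left. eapply Rlt_le_trans; [apply Rgt_lt, H1|].
      destruct (Z_lt_le_dec N1 (base - 1)).
      - rewrite sumZ_empty by lia. apply Vplus_nonneg.
      - unfold Vplus. rewrite (sumZ_split base N1 (x - 1)) by lia.
        pose proof (sumZ_nonneg (N1 + 1) (x - 1) (fun j => / (up j * m j) * sumZ base j m)
          ltac:(intros; apply Vplus_term_nonneg; lia)). lra. }
    assert (P2 : exists N2, isN = false -> forall x, (x < - N2)%Z -> (x < 0)%Z -> b <= Vminus x).
    { assert (isN = true \/ isN = false) as [HN|HN] by (destruct isN; auto);
        [exists 0%Z; congruence|].
      destruct (HL HN b) as [N2 H2]. exists N2. intros _ x Hx Hx0.
      left. eapply Rlt_le_trans; [apply Rgt_lt, H2|]. unfold Vminus. rewrite HN.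
      destruct (Z_lt_le_dec (-1) (- N2)).
      - rewrite sumZ_empty by lia. apply sumZ_nonneg. intros z Hz. now apply Vminus_term_nonneg.
      - rewrite (sumZ_split x (- N2 - 1) (-1)) by lia. replace (- N2 - 1 + 1)%Z with (- N2)%Z by lia.
        pose proof (sumZ_nonneg x (- N2 - 1) (fun j => / (up j * m j) * sumZ (j + 1) (-1) m)
          ltac:(intros; now apply Vminus_term_nonneg)). lra. }
    destruct P2 as [N2 P2].
    exists (Z.to_nat (Z.abs N1 + Z.abs N2 + 2)). intros x Ix Hx.
    pose proof (Vplus_nonneg x). pose proof (Vminus_nonneg x).
    destruct (Z_lt_le_dec x 0) as [Hneg|Hpos].
    + assert (HN : isN = false).
      { unfold inI in Ix. destruct isN; auto. apply Z.leb_le in Ix. lia. }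
      specialize (P2 HN x ltac:(lia) Hneg). lra.
    + specialize (P1 x ltac:(lia)). unfold base in P1. destruct isN; specialize (P1 ltac:(lia)); lra.
Qed.

End Construction.

(** * Reversing measures and the two Lyapunov functions *)

Lemma prod_from_shift a k f : prod_from (a + 1) k f = prod_from a k (fun i => f (i + 1)%Z).
Proof. revert a. induction k; intros a; simpl; [reflexivity|]. now rewrite IHk. Qed.

Lemma prod_from_S a k f : prod_from a (S k) f = prod_from a k f * f (a + Z.of_nat k)%Z.
Proof.
  revert a. induction k; intros a.
  - simpl. rewrite Z.add_0_r. ring.
  - change (prod_from a (S (S k)) f) with (f a * prod_from (a + 1) (S k) f).
    rewrite IHk. simpl prod_from.
    replace (a + 1 + Z.of_nat k)%Z with (a + Z.of_nat (S k))%Z by lia. ring.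
Qed.

Lemma prod_from_ext a k f g : (forall i, f i = g i) -> prod_from a k f = prod_from a k g.
Proof. intros H. revert a. induction k; intros a; simpl; [reflexivity|]. now rewrite H, IHk. Qed.

Section Rates.

Context (isN : bool) (lam mu : Z -> R) (Hok : rates_ok isN lam mu).
Notation I x := (inI isN x = true).
Notation pi := (piZ lam mu).

Lemma mu_succ_pos x : I x -> 0 < mu (x + 1)%Z.
Proof.
  intros Ix. apply Hok; [now apply inI_succ|]. intros HN. unfold inI in Ix. rewrite HN in Ix.
  apply Z.leb_le in Ix. lia.
Qed.

Lemma lam_pos x : I x -> 0 < lam x.
Proof. apply Hok. Qed.

Lemma piZ_rev x : I x -> pi x * lam x = pi (x + 1)%Z * mu (x + 1)%Z.
Proof.
  intros Ix. pose proof (lam_pos x Ix). pose proof (mu_succ_pos x Ix).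
  unfold piZ. destruct (Z.leb_spec 0 x) as [Hx|Hx].
  - destruct (Z.leb_spec 0 (x + 1)); [|lia]. unfold prodZ.
    replace (Z.to_nat (x + 1 - 1 + 1)) with (S (Z.to_nat (x - 1 + 1))) by lia.
    rewrite prod_from_S. replace (1 + Z.of_nat (Z.to_nat (x - 1 + 1)))%Z with (x + 1)%Z by lia.
    replace (x + 1 - 1)%Z with x by lia. field. lra.
  - assert (E : prodZ 1 (- x) (fun i => mu (x + i)%Z / lam (x + i - 1)%Z) =
       mu (x + 1)%Z / lam x * prodZ 1 (- (x + 1)) (fun i => mu (x + 1 + i)%Z / lam (x + 1 + i - 1)%Z)).
    { unfold prodZ. replace (Z.to_nat (- x - 1 + 1)) with (S (Z.to_nat (- (x + 1) - 1 + 1))) by lia.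
      cbn [prod_from]. rewrite prod_from_shift. replace (x + 1 - 1)%Z with x by lia. f_equal.
      apply prod_from_ext. intros i. f_equal; f_equal; [lia|]. f_equal. lia. }
    rewrite E. destruct (Z.leb_spec 0 (x + 1)) as [Hx1|Hx1].
    (* The two branches of [piZ] meet between -1 and 0. *)
    + assert (x = (-1)%Z) by lia. subst x. simpl. unfold prodZ. simpl. field. simpl in *. lra.
    + field. lra.
Qed.

Lemma piZ_pos x : I x -> 0 < pi x.
Proof.
  assert (Hp : forall k, 0 < pi (Z.of_nat k)).
  { induction k as [|k IH]; [change (0 < 1); lra|].
    assert (Ik : I (Z.of_nat k)) by (unfold inI; destruct isN; auto; apply Z.leb_le; lia).
    pose proof (piZ_rev _ Ik) as E. pose proof (lam_pos _ Ik). pose proof (mu_succ_pos _ Ik).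
    replace (Z.of_nat (S k)) with (Z.of_nat k + 1)%Z by lia.
    apply Rmult_lt_reg_r with (mu (Z.of_nat k + 1)%Z); auto. rewrite <- E, Rmult_0_l.
    now apply Rmult_lt_0_compat. }
  intros Ix. destruct (Z_le_gt_dec 0 x) as [Hx|Hx].
  - replace x with (Z.of_nat (Z.to_nat x)) by lia. apply Hp.
  - assert (HN : isN = false).
    { unfold inI in Ix. destruct isN; auto. apply Z.leb_le in Ix. lia. }
    assert (HI : forall z, I z) by (intros; unfold inI; now rewrite HN).
    replace x with (- Z.of_nat (Z.to_nat (- x)))%Z by lia.
    induction (Z.to_nat (- x)) as [|k IH]; [change (0 < 1); lra|].
    pose proof (piZ_rev (- Z.of_nat (S k))%Z (HI _)) as E.
    pose proof (lam_pos _ (HI (- Z.of_nat (S k))%Z)). pose proof (mu_succ_pos _ (HI (- Z.of_nat (S k))%Z)).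
    replace (- Z.of_nat (S k) + 1)%Z with (- Z.of_nat k)%Z in * by lia.
    apply Rmult_lt_reg_r with (lam (- Z.of_nat (S k))%Z); auto. rewrite E, Rmult_0_l.
    now apply Rmult_lt_0_compat.
Qed.

Lemma nonneg_rates_D : nonneg_rates isN lam mu.
Proof.
  intros x Ix. split; [left; now apply lam_pos|].
  destruct (Z.eq_dec x 0) as [->|Hx].
  - assert (isN = true \/ isN = false) as [HN|HN] by (destruct isN; auto).
    + right; symmetry; now apply Hok.
    + left. apply Hok; auto. intros HN'. congruence.
  - left. apply Hok; auto.
Qed.

Lemma nonneg_rates_Dhat : nonneg_rates isN (fun x => mu (x + 1)%Z) lam.
Proof. intros x Ix. split; left; [now apply mu_succ_pos|now apply lam_pos]. Qed.

Lemma conservative_D z : I z -> gen isN lam mu (fun _ => 1) z = 0.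
Proof.
  intros Iz. unfold gen. rewrite ext_in by now apply inI_succ.
  unfold ext. destruct (inI isN (z - 1)) eqn:E; [ring|].
  assert (isN = true /\ z = 0%Z) as [HN ->].
  { unfold inI in *. destruct isN; [|discriminate]. apply Z.leb_le in Iz. apply Z.leb_gt in E. lia. }
  destruct Hok as (_ & _ & H). rewrite (H HN). ring.
Qed.

Context (Hnat : natural_boundaries isN lam mu).
Notation w := (fun j => / (lam j * pi j)).

Lemma lyapunov_D : exists V, lyapunov isN lam mu V.
Proof.
  eexists. apply (lyapunov_construction isN lam mu pi).
  - exact lam_pos.
  - intros x Ix. now apply nonneg_rates_D.
  - exact piZ_pos.
  - exact piZ_rev.
  - unfold base. unfold natural_boundaries in Hnat. destruct isN; apply Hnat.
  - intros HN. unfold natural_boundaries in Hnat. rewrite HN in Hnat. apply Hnat.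
Qed.

Lemma w_pos x : I x -> 0 < w x.
Proof.
  intros Ix. apply Rinv_0_lt_compat, Rmult_lt_0_compat; [now apply lam_pos|now apply piZ_pos].
Qed.

(** Detailed balance for the dual rates: [1 / (lam pi)] reverses the dual chain. *)
Lemma w_rev x : I x -> w x * mu (x + 1)%Z = w (x + 1)%Z * lam (x + 1)%Z.
Proof.
  intros Ix. pose proof (piZ_rev x Ix) as E. rewrite Rmult_comm in E. cbv beta. rewrite E.
  pose proof (mu_succ_pos x Ix). pose proof (lam_pos _ (inI_succ isN x Ix)).
  pose proof (piZ_pos _ (inI_succ isN x Ix)). field. lra.
Qed.

(** Duality swaps speed measure and resistance: [pi], shifted by one, is the resistance of the dual
    chain. *)
Lemma conductance_dual x : I x -> / (mu (x + 1)%Z * w x) = pi (x + 1)%Z.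
Proof.
  intros Ix. pose proof (piZ_rev x Ix) as E. rewrite Rmult_comm in E.
  cbv beta. rewrite E. pose proof (mu_succ_pos x Ix). pose proof (piZ_pos _ (inI_succ isN x Ix)). field. lra.
Qed.

(** On [N] the second boundary condition has inner sums of [pi] over later sites, while the Lyapunov
    function of the dual chain has inner sums of [w] over earlier ones. *)
Lemma double_sum_exchange K : (0 <= K)%Z ->
  sumZ 0 K (fun j => w j * sumZ (j + 1) K pi) = sumZ 0 (K - 1) (fun j => pi (j + 1)%Z * sumZ 0 j w).
Proof.
  intros HK. assert (HK1 : (0 - 1 <= K)%Z) by lia. clear HK. revert K HK1.
  apply (sumZ_ind (fun K => sumZ 0 K (fun j => w j * sumZ (j + 1) K pi) =
     sumZ 0 (K - 1) (fun j => pi (j + 1)%Z * sumZ 0 j w))).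
  - rewrite !sumZ_empty by lia. reflexivity.
  - intros K HK IH. rewrite (sumZ_last 0 K) by auto. rewrite (sumZ_empty (K + 1) K) by lia.
    destruct (Z.eq_dec K 0) as [->|Hne].
    { rewrite !sumZ_empty by lia. ring. }
    rewrite (sumZ_last 0 (K - 1) (fun j => pi (j + 1)%Z * _)) by lia. rewrite <- IH.
    replace (K - 1 + 1)%Z with K by lia.
    rewrite <- sumZ_scal, <- sumZ_plus. rewrite Rmult_0_r, Rplus_0_r. apply sumZ_ext.
    intros z Hz. rewrite (sumZ_last (z + 1) K) by lia. ring.
Qed.

(** With [w] as speed measure and the shifted [pi] as resistance, Feller's sums are those of the
    boundary conditions that [lyapunov_D] leaves over. *)
Lemma lyapunov_Dhat : exists V, lyapunov isN (fun x => mu (x + 1)%Z) lam V.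
Proof.
  eexists. apply (lyapunov_construction isN (fun x => mu (x + 1)%Z) lam w).
  - exact mu_succ_pos.
  - intros x Ix. now apply nonneg_rates_Dhat.
  - exact w_pos.
  - exact w_rev.
  - intros B. unfold base. unfold natural_boundaries in Hnat.
    assert (isN = true \/ isN = false) as [HN|HN] by (destruct isN; auto);
      rewrite HN in Hnat |- *.
    + destruct Hnat as [_ H2]. destruct (H2 B) as (N & M & H).
      (* The triangle up to [K] contains all pairs with [0 <= j <= N] and [j < i <= j + M]; the
         exchange of sums lowers the outer end to [K - 1]. *)
      set (K := (Z.max 0 N + Z.max 0 M)%Z). exists (K - 1)%Z.
      rewrite (sumZ_ext _ _ _ (fun j => pi (j + 1)%Z * sumZ 0 j w)).
      2: { intros z Hz. rewrite conductance_dual; auto. unfold inI. rewrite HN. apply Z.leb_le. lia. }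
      rewrite <- double_sum_exchange by lia. eapply Rge_gt_trans; [|exact H]. apply Rle_ge.
      assert (HI : forall z, (0 <= z)%Z -> I z) by (intros; unfold inI; rewrite HN; now apply Z.leb_le).
      assert (Hn : forall j, (0 <= j)%Z -> 0 <= w j * sumZ (j + 1) K pi).
      { intros j Hj. apply Rmult_le_pos; [left; apply w_pos; auto|].
        apply sumZ_nonneg. intros z Hz. left. apply piZ_pos, HI. lia. }
      destruct (Z_lt_le_dec N 0) as [HNn|HNn].
      { rewrite sumZ_empty by lia. apply sumZ_nonneg. intros; apply Hn; lia. }
      rewrite (sumZ_split 0 N K) by lia.
      pose proof (sumZ_nonneg (N + 1) K (fun j => w j * sumZ (j + 1) K pi) ltac:(intros; apply Hn; lia)).
      enough (sumZ 0 N (fun j => w j * sumZ (j + 1) (j + M) pi) <=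
              sumZ 0 N (fun j => w j * sumZ (j + 1) K pi)) by lra.
      apply sumZ_le. intros z Hz. apply Rmult_le_compat_l; [left; apply w_pos, HI; lia|].
      destruct (Z_lt_le_dec M 0).
      * rewrite (sumZ_empty (z + 1) (z + M)) by lia. apply sumZ_nonneg.
        intros; left; apply piZ_pos, HI; lia.
      * rewrite (sumZ_split (z + 1) (z + M) K) by lia.
        pose proof (sumZ_nonneg (z + M + 1) K pi ltac:(intros; left; apply piZ_pos, HI; lia)). lra.
    + destruct Hnat as (_ & H2 & _). destruct (H2 B) as (N & H). exists (N - 1)%Z.
      rewrite (sumZ_ext _ _ _ (fun j => (fun i => pi i * sumZ 1 (i - 1) w) (j + 1)%Z)).
      2: { intros z Hz. rewrite conductance_dual by (unfold inI; now rewrite HN).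
           now replace (z + 1 - 1)%Z with z by lia. }
      rewrite <- (sumZ_shift 1 (N - 1) (fun i => pi i * sumZ 1 (i - 1) w)).
      replace (N - 1 + 1)%Z with N by lia.
      destruct (Z_lt_le_dec N 1).
      * rewrite sumZ_empty in * by lia. exact H.
      (* The term at 1 has an empty inner sum, so the shift by one loses nothing. *)
      * rewrite (sumZ_first 1 N) in H by lia. rewrite (sumZ_empty 1 (1 - 1)) in H by lia.
        rewrite Rmult_0_r, Rplus_0_l in H. exact H.
  - intros HN B. unfold natural_boundaries in Hnat. rewrite HN in Hnat.
    destruct Hnat as (_ & _ & _ & H4). destruct (H4 B) as (N & H). exists (N + 1)%Z.
    rewrite (sumZ_ext _ _ _ (fun j => (fun i => pi i * sumZ i (-1) w) (j + 1)%Z)).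
    2: { intros z Hz. now rewrite conductance_dual by (unfold inI; now rewrite HN). }
    rewrite <- (sumZ_shift (- (N + 1)) (-1) (fun i => pi i * sumZ i (-1) w)).
    replace (- (N + 1) + 1)%Z with (- N)%Z by lia. replace (-1 + 1)%Z with 0%Z by lia.
    destruct (Z_lt_le_dec 0 (- N)).
    + rewrite sumZ_empty in * by lia. exact H.
    (* Here the shift adds a term at 0, whose inner sum is empty. *)
    + rewrite (sumZ_last (- N) 0) by lia. rewrite (sumZ_empty 0 (-1)) by lia.
      rewrite Rmult_0_r, Rplus_0_r. exact H.
Qed.

End Rates.

(** * Tails of the dual chain *)

Section Tail.

Context (isN : bool) (up down : Z -> R) (Hr : nonneg_rates isN up down).
Context (q : R -> Z -> Z -> R) (Hq : is_chain_tf isN up down q).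
Notation I x := (inI isN x = true).

Lemma Phat_tail_has_sum t x y : 0 <= t -> I x ->
  has_sum (fun w => I w /\ (y <= w)%Z) (q t x) (Phat_tail isN q t x y).
Proof. intros Ht Ix. apply (chain_tf_mass isN up down Hr q Hq); tauto. Qed.

Lemma Phat_tail_bounds t x y : 0 <= t -> I x -> 0 <= Phat_tail isN q t x y <= 1.
Proof. intros Ht Ix. apply (chain_tf_mass isN up down Hr q Hq); tauto. Qed.

Lemma Phat_tail_step t x y : 0 <= t -> I x -> I y ->
  Phat_tail isN q t x y = Phat_tail isN q t x (y + 1) + q t x y.
Proof.
  intros Ht Ix Iy. eapply has_sum_unique; [now apply Phat_tail_has_sum|].
  apply (has_sum_disjoint_union (fun z => I z /\ (y + 1 <= z)%Z) (fun z => z = y));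
    [lia| |now apply Phat_tail_has_sum|].
  - intros z. split; [intros [Iz Hz]; destruct (Z.eq_dec z y); [auto|left; split; auto; lia]|].
    intros [[Iz Hz]| ->]; split; auto; lia.
  - apply has_sum_singleton; tauto.
Qed.

Lemma Phat_tail_0 x y : I x -> I y -> Phat_tail isN q 0 x y = if Z.leb y x then 1 else 0.
Proof.
  intros Ix Iy. transitivity (tsum (fun w => I w /\ (y <= w)%Z) (q 0 x)); [reflexivity|].
  rewrite (chain_tf_mass_0 isN up down q Hq) by tauto.
  destruct (Z.leb_spec y x) as [H|H].
  - now rewrite (proj2 (decb_true (I x /\ (y <= x)%Z)) (conj Ix H)).
  - destruct (decb _) eqn:E; auto. apply -> decb_true in E. lia.
Qed.

(** Sums over finite windows starting at [y] are backward solutions bounded by 1, and the tail is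
    their limit. *)
Lemma Phat_tail_backward y x : I y -> I x ->
  bw_derivative isN up down (fun t x => Phat_tail isN q t x y) x /\
  right_cont0 (fun t => Phat_tail isN q t x y).
Proof.
  intros Iy Ix.
  set (E := fun n : nat => zlist y (y + Z.of_nat n)).
  assert (HE : forall n, Forall (fun z => I z) (E n)).
  { intros n. apply Forall_forall. intros z Hz. apply zlist_In in Hz. apply (inI_le isN y); auto; lia. }
  destruct Hq as [(H0 & Hpos & Hrc & Hd) _].
  revert x Ix. apply (backward_limit isN up down (fun n t x => sum_list (q t x) (E n)) _ 1); [lra| | | |].
  - intros n t x Ht Ix. pose proof (HE n) as HEn. rewrite Forall_forall in HEn.
    rewrite Rabs_pos_eq; [|apply sum_list_nonneg; intros; apply Hpos; auto].
    apply (chain_tf_sum_le_1 isN up down Hr q Hq); auto. apply zlist_NoDup.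
  - intros x Ix. exists O. intros n _ t Ht. pose proof (HE n) as HEn. rewrite Forall_forall in HEn.
    rewrite (gen_sum_list isN up down (E n) (fun w z => q t z w)).
    apply (derivable_pt_lim_sum_list (E n) (fun w s => q s x w)). intros w Hw. apply Hd; auto.
  - intros n x Ix. pose proof (HE n) as HEn. rewrite Forall_forall in HEn.
    apply (right_cont0_sum_list (E n) (fun w s => q s x w)). intros w Hw. exact (Hrc x w Ix (HEn w Hw)).
  - intros t x Ht Ix.
    apply (monotone_sum_lim (fun w => I w /\ (y <= w)%Z) (fun _ => q t x) (q t x)).
    + intros _ z [Iz _]. split; [apply Hpos; auto|lra].
    + intros; apply is_lim_seq_const.
    + intros n. split; [apply zlist_NoDup|]. apply Forall_forall. intros z Hz. apply zlist_In in Hz.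
      split; [apply (inI_le isN y); auto; lia|lia].
    + intros z [Iz Hz]. exists (Z.to_nat (z - y)). intros n Hn. apply zlist_In. lia.
    + now apply Phat_tail_has_sum.
Qed.

End Tail.

(** * Positivity of Karlin-McGregor determinants *)

Lemma incrb_spec l : incrb l = true <->
  forall i, (S i < length l)%nat -> (xi l i < xi l (S i))%Z.
Proof.
  induction l as [|a [|b l] IH].
  - split; auto. simpl; intros; lia.
  - split; auto. simpl; intros; lia.
  - change (incrb (a :: b :: l)) with (Z.ltb a b && incrb (b :: l))%bool.
    rewrite andb_true_iff, IH, Z.ltb_lt. split.
    + intros [H1 H2] [|i] Hi; [exact H1|]. apply (H2 i). simpl in *; lia.
    + intros H. split; [apply (H O); simpl; lia|]. intros i Hi. apply (H (S i)). simpl in *; lia.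
Qed.

Lemma Wb_spec isN n x : Wb isN n x = true <->
  length x = n /\ (forall i, (i < n)%nat -> inI isN (xi x i) = true) /\
  (forall i, (S i < n)%nat -> (xi x i < xi x (S i))%Z).
Proof.
  unfold Wb. rewrite !andb_true_iff, Nat.eqb_eq, incrb_spec, forallb_forall. split.
  - intros [[<- H1] H2]. split; auto. split; auto. intros i Hi. apply H1. now apply nth_In.
  - intros (<- & H1 & H2). split; auto. split; auto. intros z Hz.
    destruct (In_nth x z 0%Z Hz) as (i & Hi & <-). now apply H1.
Qed.

Lemma strictly_increasing (f : nat -> Z) n : (forall i, (S i < n)%nat -> (f i < f (S i))%Z) ->
  forall i j, (i < j < n)%nat -> (f i < f j)%Z.
Proof.
  intros H i j [Hij Hj]. induction j; [lia|].
  destruct (Nat.eq_dec i j) as [->|]; [apply H; lia|].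
  specialize (IHj ltac:(lia) ltac:(lia)). specialize (H j ltac:(lia)). lia.
Qed.

Lemma det_zero_first_row n M : (forall j, (j < S n)%nat -> M O j = 0) -> det (S n) M = 0.
Proof.
  intros H. rewrite det_gdet, gdet_S. apply sumN_zero. intros j Hj. rewrite H by auto. ring.
Qed.

Lemma det_zero_row n M k : (k < n)%nat -> (forall j, (j < n)%nat -> M k j = 0) -> det n M = 0.
Proof.
  intros Hk H. rewrite <- (det_row_set_id n M k).
  rewrite (det_ext n _ (row_set M k (fun j => 0 * M k j + 0 * M k j))).
  - rewrite det_row_set_linear by auto. ring.
  - intros i j Hi Hj. unfold row_set. destruct (Nat.eqb i k); auto. rewrite H by auto. ring.
Qed.

(** The initial value of a Karlin-McGregor determinant. If the first entries differ, the smaller one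
    is missing from the other sequence and gives a zero row or column; if they agree, the first row
    is a unit vector. *)
Lemma det_identity_nonneg n (f g : nat -> Z) :
  (forall i, (S i < n)%nat -> (f i < f (S i))%Z) ->
  (forall i, (S i < n)%nat -> (g i < g (S i))%Z) ->
  0 <= det n (fun i j => if Z.eq_dec (f i) (g j) then 1 else 0).
Proof.
  revert f g. induction n; intros f g Hf Hg; [simpl; lra|].
  pose proof (strictly_increasing f _ Hf) as Mf. pose proof (strictly_increasing g _ Hg) as Mg.
  destruct (Z_lt_le_dec (f O) (g O)) as [Hlt|Hle].
  { right. symmetry. apply det_zero_first_row. intros j Hj. destruct (Z.eq_dec (f O) (g j)); auto.
    destruct j; [lia|]. specialize (Mg O (S j) ltac:(lia)). lia. }
  destruct (Z_lt_le_dec (g O) (f O)) as [Hlt|Hle'].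
  { right. symmetry. rewrite <- DetBridge.det_tr. apply det_zero_first_row. intros j Hj.
    destruct (Z.eq_dec (f j) (g O)); auto. destruct j; [lia|]. specialize (Mf O (S j) ltac:(lia)). lia. }
  assert (E : f O = g O) by lia.
  rewrite det_gdet, gdet_S, sumN_first, sumN_zero.
  - rewrite <- det_gdet. destruct (Z.eq_dec (f O) (g O)); [|congruence].
    pose proof (IHn (fun i => f (S i)) (fun i => g (S i)) ltac:(intros; apply Hf; lia)
      ltac:(intros; apply Hg; lia)) as H.
    rewrite (det_ext n _ (fun i j => if Z.eq_dec (f (S i)) (g (S j)) then 1 else 0)).
    + simpl. lra.
    + intros i j _ _. reflexivity.
  - intros j Hj. destruct (Z.eq_dec (f O) (g (S j))) as [e|]; [|ring].
    specialize (Mg O (S j) ltac:(lia)). lia.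
Qed.

Fixpoint upd (l : list Z) (k : nat) (z : Z) : list Z :=
  match l, k with
  | [], _ => []
  | _ :: l', O => z :: l'
  | a :: l', S k' => a :: upd l' k' z
  end.

Lemma upd_length l k z : length (upd l k z) = length l.
Proof. revert k. induction l; intros [|k]; simpl; auto. Qed.

Lemma xi_upd l k z i : (k < length l)%nat -> xi (upd l k z) i = if Nat.eqb i k then z else xi l i.
Proof.
  revert k i. induction l; intros [|k] [|i] Hk; simpl in *; try lia; auto.
  apply IHl. lia.
Qed.

Lemma sumN_upd n (f : nat -> R) k v : (k < n)%nat ->
  sumN n (fun i => if Nat.eqb i k then v else f i) = sumN n f + v - f k.
Proof.
  induction n; intros Hk; [lia|]. simpl. destruct (Nat.eq_dec k n) as [->|Hne].
  - rewrite Nat.eqb_refl. rewrite (sumN_ext n _ f); [ring|].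
    intros j Hj. destruct (Nat.eqb_spec j n); auto; lia.
  - rewrite IHn by lia. destruct (Nat.eqb_spec n k); [lia|]. ring.
Qed.

Fixpoint lists_over (n : nat) (E : list Z) : list (list Z) :=
  match n with
  | O => [[]]
  | S m => flat_map (fun a => map (cons a) (lists_over m E)) E
  end.

Lemma lists_over_In n E l : length l = n -> (forall i, (i < n)%nat -> In (xi l i) E) ->
  In l (lists_over n E).
Proof.
  revert l. induction n; intros [|a l] Hl H; try discriminate; [left; auto|].
  simpl. apply in_flat_map. exists a. split; [apply (H O); lia|].
  apply in_map. apply IHn; [simpl in *; lia|]. intros i Hi. apply (H (S i)). lia.
Qed.

Lemma det_derivable_right_cont0 n (M : R -> nat -> nat -> R) :
  (forall i j, (i < n)%nat -> (j < n)%nat -> right_cont0 (fun t => M t i j)) ->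
  right_cont0 (fun t => det n (M t)).
Proof.
  revert M. induction n; intros M H; [exact (right_cont0_const 1)|].
  assert (Hs : forall k (f : nat -> R -> R), (forall j, (j < k)%nat -> right_cont0 (f j)) ->
    right_cont0 (fun t => sumN k (fun j => f j t))).
  { induction k; intros f Hf; simpl; [exact (right_cont0_const 0)|].
    apply right_cont0_plus; [apply IHk; auto|apply Hf; auto]. }
  apply (Hs (S n) (fun j t => (-1) ^ j * M t O j *
             det n (fun i k => M t (S i) (if Nat.ltb k j then k else S k)))).
  intros j Hj. apply right_cont0_mult.
  - apply right_cont0_mult; [apply right_cont0_const|apply H; lia].
  - apply (IHn (fun t i k => M t (S i) (if Nat.ltb k j then k else S k))).
    intros i k Hi Hk. apply H; [lia|]. now apply skip_lt.
Qed.

Section KarlinMcGregor.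

Context (isN : bool) (up down : Z -> R) (Hr : nonneg_rates isN up down).
Context (V : Z -> R) (HV : lyapunov isN up down V).
Context (q : R -> Z -> Z -> R) (Hq : is_chain_tf isN up down q).
Notation I x := (inI isN x = true).

Lemma KM_bound n t x y : 0 <= t -> Wb isN n x = true -> Wb isN n y = true ->
  Rabs (KM n q t x y) <= gdet 1 n (fun _ _ => 1).
Proof.
  intros Ht Hx Hy. apply Wb_spec in Hx, Hy. destruct Hx as (_ & Ix & _), Hy as (_ & Iy & _).
  unfold KM. rewrite det_gdet. eapply Rle_trans; [apply gdet_abs; rewrite Rabs_left; lra|].
  apply perm_le. intros i j Hi Hj. split; [apply Rabs_pos|].
  pose proof (chain_tf_bounds isN up down Hr q Hq t (xi x i) (xi y j) Ht (Ix i Hi) (Iy j Hj)).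
  rewrite Rabs_pos_eq; lra.
Qed.

(* The determinant solves the backward equation of [n] independent particles
   on the Weyl chamber and vanishes on its walls, because two rows coincide
   there; the maximum principle then applies. *)
Lemma KM_nonneg n t x y : 0 <= t -> Wb isN n x = true -> Wb isN n y = true -> 0 <= KM n q t x y.
Proof.
  intros Ht Hx Hy. pose proof Hy as Hy'. apply Wb_spec in Hy'. destruct Hy' as (Ly & Iy & My).
  destruct HV as (V0 & Vgen & Vinf). destruct Hq as [(Q0 & Qpos & Qrc & Qd) Qmin].
  (* Each particle contributes at most 1 to the generator of [W], hence the growth constant
     [INR n]. *)
  set (W := fun x => sumN n (fun i => V (xi x i))).
  set (Mx := fun t (x : list Z) i j => q t (xi x i) (xi y j)).
  assert (HWpart : forall x, Wb isN n x = true -> forall k, (k < n)%nat -> 0 <= W x - V (xi x k)).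
  { intros z Hz k Hk. apply Wb_spec in Hz. destruct Hz as (Lz & Iz & Mz).
    pose proof (sumN_upd n (fun i => V (xi z i)) k 0 Hk) as E.
    assert (0 <= sumN n (fun i => if Nat.eqb i k then 0 else V (xi z i))).
    { apply sumN_nonneg. intros i Hi. destruct (Nat.eqb i k); [lra|auto]. }
    unfold W. lra. }
  revert t x Ht Hx.
  apply (lyapunov_principle (fun x => Wb isN n x = true) W (INR n) (gdet 1 n (fun _ _ => 1))
    (fun t x => KM n q t x y)
    (fun t x => sumN n (fun k => det n (row_set (Mx t x) k
        (fun j => gen isN up down (fun z => q t z (xi y j)) (xi x k)))))).
  - apply pos_INR.
  - apply perm_nonneg. intros; lra.
  - intros x Hx. apply Wb_spec in Hx. destruct Hx as (Lx & Ix & _).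
    apply sumN_nonneg. auto.
  - intros b. destruct (Vinf (b + 1)) as [N HN].
    exists (lists_over n (zlist (- Z.of_nat N) (Z.of_nat N))). intros x Hx Hb.
    pose proof (HWpart x Hx) as Hp.
    assert (Hsum : forall k, (k < n)%nat -> V (xi x k) <= b).
    { intros k Hk. specialize (Hp k Hk). lra. }
    apply Wb_spec in Hx. destruct Hx as (Lx & Ix & _). apply lists_over_In; auto.
    intros i Hi. apply zlist_In. destruct (Z_lt_le_dec (Z.of_nat N) (Z.abs (xi x i))); [|lia].
    specialize (HN _ (Ix i Hi) l). specialize (Hsum i Hi). lra.
  - intros t x Ht Hx. pose proof (KM_bound n t x y Ht Hx Hy) as B. apply Rabs_le_between in B. lra.
  - intros x Hx. apply Wb_spec in Hx. destruct Hx as (Lx & Ix & Mxx). unfold KM.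
    rewrite (det_ext n _ (fun i j => if Z.eq_dec (xi x i) (xi y j) then 1 else 0)) by (intros; apply Q0; auto).
    now apply det_identity_nonneg.
  - intros x Hx. apply Wb_spec in Hx. destruct Hx as (Lx & Ix & _).
    apply (det_derivable_right_cont0 n (fun t => Mx t x)). intros i j Hi Hj.
    exact (Qrc _ _ (Ix i Hi) (Iy j Hj)).
  - intros t x Ht Hx. apply Wb_spec in Hx. destruct Hx as (Lx & Ix & _).
    apply (det_derive n (fun t => Mx t x) (fun k j => gen isN up down (fun z => q t z (xi y j)) (xi x k))).
    intros i j Hi Hj. apply Qd; auto.
  - intros e t x He Ht Hx Hneg Hmin. pose proof Hx as Hx'. apply Wb_spec in Hx'.
    destruct Hx' as (Lx & Ix & Mxx). pose proof (HWpart x Hx) as Hpart.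
    assert (Hent : 0 <= e * (INR n * t)).
    { apply Rmult_le_pos; [lra|]. apply Rmult_le_pos; [apply pos_INR|lra]. }
    (* The determinant after particle [k] jumps to [z], meaningful also when [z] is occupied or
       outside [I]. *)
    set (side := fun k z => det n (row_set (Mx t x) k (fun j => ext isN (fun w => q t w (xi y j)) z))).
    (* On an occupied or killing site [side] vanishes, which suffices because the tilted value at
       [x] is negative and the other particles have nonnegative [V]. Otherwise the new configuration
       lies in the chamber and minimality applies. *)
    assert (Hnb : forall k z, (k < n)%nat ->
       ((exists i, (i < n)%nat /\ i <> k /\ xi x i = z) \/ inI isN z = false \/ Wb isN n (upd x k z) = true) ->
       KM n q t x y + e * V (xi x k) <= side k z + e * ext isN V z).
    { intros k z Hk Hz.
      assert (Hzero : side k z = 0 -> KM n q t x y + e * V (xi x k) <= side k z + e * ext isN V z).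
      { intros ->. specialize (Hpart k Hk).
        assert (0 <= ext isN V z) by (unfold ext; destruct (inI isN z) eqn:E; [auto|lra]).
        assert (0 <= e * ext isN V z) by (apply Rmult_le_pos; lra).
        assert (e * V (xi x k) <= e * W x) by (apply Rmult_le_compat_l; lra). lra. }
      destruct Hz as [(i & Hi & Hik & Hiz)|[Hz|Hz]].
      - apply Hzero. apply (DetBridge.det_equal_rows n _ i k); auto. intros j Hj.
        unfold row_set. rewrite Nat.eqb_refl. destruct (Nat.eqb_spec i k); [contradiction|].
        rewrite ext_in by (rewrite <- Hiz; auto). unfold Mx. now rewrite Hiz.
      - apply Hzero. apply (det_zero_row n _ k Hk). intros j Hj. unfold row_set.
        rewrite Nat.eqb_refl. unfold ext. now rewrite Hz.
      - specialize (Hmin _ Hz).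
        assert (EW : W (upd x k z) = W x + V z - V (xi x k)).
        { unfold W. rewrite <- (sumN_upd n (fun i => V (xi x i)) k (V z) Hk). apply sumN_ext.
          intros i Hi. rewrite xi_upd by lia. now destruct (Nat.eqb i k). }
        assert (EK : side k z = KM n q t (upd x k z) y).
        { unfold side, KM. apply det_ext. intros i j Hi Hj. unfold row_set, Mx.
          rewrite xi_upd by lia. destruct (Nat.eqb_spec i k) as [->|]; auto.
          apply Wb_spec in Hz. destruct Hz as (_ & Iz & _). specialize (Iz k Hk).
          rewrite xi_upd, Nat.eqb_refl in Iz by lia. now rewrite ext_in. }
        assert (Iz : I z).
        { apply Wb_spec in Hz. destruct Hz as (_ & Iz & _). specialize (Iz k Hk).
          now rewrite xi_upd, Nat.eqb_refl in Iz by lia. }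
        rewrite ext_in by auto. rewrite EK. rewrite EW in Hmin. lra. }
    assert (Hterm : forall k, (k < n)%nat ->
       - e <= det n (row_set (Mx t x) k (fun j => gen isN up down (fun z => q t z (xi y j)) (xi x k)))).
    { intros k Hk.
      assert (Hplus : KM n q t x y + e * V (xi x k) <= side k (xi x k + 1)%Z + e * ext isN V (xi x k + 1)).
      { apply Hnb; auto.
        (* A unit jump cannot cross a particle: unless the site is taken, the order is preserved. *)
        destruct (classic (exists i, (i < n)%nat /\ i <> k /\ xi x i = (xi x k + 1)%Z)) as [H|H]; [auto|].
        right; right. apply Wb_spec. split; [now rewrite upd_length|]. split.
        - intros i Hi. rewrite xi_upd by lia. destruct (Nat.eqb i k); auto. apply inI_succ; auto.
        - intros i Hi. rewrite !xi_upd by lia. specialize (Mxx i Hi).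
          destruct (Nat.eqb_spec i k), (Nat.eqb_spec (S i) k); subst; try lia.
          assert (xi x (S k) <> (xi x k + 1)%Z) by (intros E; apply H; exists (S k); auto). lia. }
      assert (Hminus : KM n q t x y + e * V (xi x k) <= side k (xi x k - 1)%Z + e * ext isN V (xi x k - 1)).
      { apply Hnb; auto.
        destruct (classic (exists i, (i < n)%nat /\ i <> k /\ xi x i = (xi x k - 1)%Z)) as [H|H]; [auto|].
        destruct (inI isN (xi x k - 1)) eqn:E; [|auto].
        right; right. apply Wb_spec. split; [now rewrite upd_length|]. split.
        - intros i Hi. rewrite xi_upd by lia. destruct (Nat.eqb i k); auto.
        - intros i Hi. rewrite !xi_upd by lia. specialize (Mxx i Hi).
          destruct (Nat.eqb_spec i k), (Nat.eqb_spec (S i) k); subst; try lia.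
          assert (xi x i <> (xi x (S i) - 1)%Z) by (intros E'; apply H; exists i; repeat split; auto; lia). lia. }
      destruct (Hr (xi x k) (Ix k Hk)) as [Hu Hd].
      replace (det n (row_set (Mx t x) k _)) with
        (up (xi x k) * (side k (xi x k + 1)%Z - KM n q t x y) + down (xi x k) * (side k (xi x k - 1)%Z - KM n q t x y)).
      - specialize (Vgen (xi x k) (Ix k Hk)). unfold gen in Vgen.
        apply (Rmult_le_compat_l e) in Vgen; [|lra].
        assert (A1 : up (xi x k) * (e * V (xi x k) - e * ext isN V (xi x k + 1)) <=
                up (xi x k) * (side k (xi x k + 1)%Z - KM n q t x y)) by (apply Rmult_le_compat_l; lra).
        assert (A2 : down (xi x k) * (e * V (xi x k) - e * ext isN V (xi x k - 1)) <=
                down (xi x k) * (side k (xi x k - 1)%Z - KM n q t x y)) by (apply Rmult_le_compat_l; lra).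
        lra.
      - symmetry.
        set (r1 := fun j => ext isN (fun w => q t w (xi y j)) (xi x k + 1)).
        set (r2 := fun j => ext isN (fun w => q t w (xi y j)) (xi x k - 1)).
        rewrite (det_ext n _ (row_set (Mx t x) k (fun j => 1 * (up (xi x k) * r1 j + down (xi x k) * r2 j)
           + - (up (xi x k) + down (xi x k)) * Mx t x k j))).
        + rewrite (det_row_set_linear n (Mx t x) k 1 (- (up (xi x k) + down (xi x k)))
            (fun j => up (xi x k) * r1 j + down (xi x k) * r2 j) (Mx t x k)) by auto.
          rewrite det_row_set_linear, det_row_set_id by auto.
          change (det n (row_set (Mx t x) k r1)) with (side k (xi x k + 1)%Z).
          change (det n (row_set (Mx t x) k r2)) with (side k (xi x k - 1)%Z).
          change (det n (Mx t x)) with (KM n q t x y). ring.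
        + intros i j Hi Hj. unfold row_set. destruct (Nat.eqb_spec i k); auto.
          unfold gen, r1, r2, Mx. ring. }
    assert (Hsum : sumN n (fun _ => - e) <= sumN n (fun k => det n (row_set (Mx t x) k
        (fun j => gen isN up down (fun z => q t z (xi y j)) (xi x k))))) by (apply sumN_le; auto).
    assert (Hconst : forall m, sumN m (fun _ => - e) = - (e * INR m)).
    { induction m; [simpl; ring|]. rewrite S_INR. simpl sumN. rewrite IHm. ring. }
    rewrite Hconst in Hsum. lra.
Qed.

End KarlinMcGregor.

(** * Interlacing configurations *)

Lemma interlaceb_spec x y : length x = length y ->
  interlaceb x y = true <->
  (forall i, (i < length x)%nat -> (xi y i <= xi x i)%Z) /\
  (forall i, (S i < length x)%nat -> (xi x i < xi y (S i))%Z).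
Proof.
  revert y. induction x as [|a [|b x] IH]; intros [|a' [|b' y]] Hl; try discriminate.
  - split; auto. intros _. split; simpl; intros; lia.
  - change (interlaceb [a] [a']) with (Z.leb a' a). rewrite Z.leb_le. split.
    + intros H. split; [|simpl; intros; lia]. intros [|i] Hi; [exact H|simpl in Hi; lia].
    + intros [H _]. apply (H O). simpl; lia.
  - change (interlaceb (a :: b :: x) (a' :: b' :: y)) with
      (Z.leb a' a && Z.ltb a b' && interlaceb (b :: x) (b' :: y))%bool.
    rewrite !andb_true_iff, Z.leb_le, Z.ltb_lt, IH by (simpl in *; lia). split.
    + intros [[H1 H2] [H3 H4]]. split; intros [|i] Hi; auto; simpl in *;
        [apply (H3 i)|apply (H4 i)]; lia.
    + intros [H1 H2]. split; [split; [apply (H1 O)|apply (H2 O)]; simpl; lia|].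
      split; intros i Hi; [apply (H1 (S i))|apply (H2 (S i))]; simpl in *; lia.
Qed.

Lemma Wnnb_Wb isN n x y : Wnnb isN n x y = true -> Wb isN n x = true /\ Wb isN n y = true.
Proof. unfold Wnnb. rewrite !andb_true_iff. tauto. Qed.

(* [y_i] ranges over [(x_(i-1), x_i]] when [x] is fixed. *)
Definition below (isN : bool) (x : list Z) (i : nat) (z : Z) : Prop :=
  inI isN z = true /\ match i with O => True | S j => (xi x j < z)%Z end /\ (z <= xi x i)%Z.

(* [x_i] ranges over [[y_i, y_(i+1))] when [y] is fixed. *)
Definition above (isN : bool) (n : nat) (y : list Z) (i : nat) (z : Z) : Prop :=
  inI isN z = true /\ (xi y i <= z)%Z /\ ((S i < n)%nat -> (z < xi y (S i))%Z).

(** Interlacing already forces [y] to increase, so the admissible [y] form a product of intervals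
    and determinants can be summed row by row. *)
Lemma Wnnb_below isN n x y : Wb isN n x = true -> Wnnb isN n x y = true <-> box n (below isN x) y.
Proof.
  intros Hx. pose proof Hx as Hx'. apply Wb_spec in Hx'. destruct Hx' as (Lx & Ix & Mx).
  unfold Wnnb. rewrite !andb_true_iff. split.
  - intros [[_ Hy] Hi]. apply Wb_spec in Hy. destruct Hy as (Ly & Iy & My).
    apply interlaceb_spec in Hi; [|lia]. destruct Hi as [H1 H2]. rewrite Lx in *.
    split; auto. intros i Hi. split; [auto|]. split; [|auto]. destruct i; auto.
  - intros [Ly H]. split; [split; auto|].
    + apply Wb_spec. split; auto. split; [intros; now apply H|]. intros i Hi.
      destruct (H i ltac:(lia)) as (_ & _ & H1). destruct (H (S i) Hi) as (_ & H2 & _). lia.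
    + apply interlaceb_spec; [lia|]. rewrite Lx. split; intros i Hi; [now apply H|].
      now apply (H (S i)).
Qed.

Lemma Wnnb_above isN n x y : Wb isN n y = true -> Wnnb isN n x y = true <-> box n (above isN n y) x.
Proof.
  intros Hy. pose proof Hy as Hy'. apply Wb_spec in Hy'. destruct Hy' as (Ly & Iy & My).
  unfold Wnnb. rewrite !andb_true_iff. split.
  - intros [[Hx _] Hi]. apply Wb_spec in Hx. destruct Hx as (Lx & Ix & Mx).
    apply interlaceb_spec in Hi; [|lia]. destruct Hi as [H1 H2]. rewrite Lx in *.
    split; auto. intros i Hi. split; [auto|]. split; auto.
  - intros [Lx H]. split; [split; auto|].
    + apply Wb_spec. split; auto. split; [intros; now apply H|]. intros i Hi.
      destruct (H i ltac:(lia)) as (_ & _ & H1). destruct (H (S i) Hi) as (_ & H2 & _).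
      specialize (H1 Hi). lia.
    + apply interlaceb_spec; [lia|]. rewrite Lx. split; intros i Hi; [now apply H|].
      apply (H i); auto; lia.
Qed.

Lemma Wnnb_refl isN n x : Wb isN n x = true -> Wnnb isN n x x = true.
Proof.
  intros Hx. apply Wnnb_below; auto. apply Wb_spec in Hx. destruct Hx as (Lx & Ix & Mx).
  split; auto. intros i Hi. split; auto. split; [|lia]. destruct i; auto.
Qed.

(** * Siegmund duality and sums over interlacing configurations *)

Section Intertwining.

Context (isN : bool) (lam mu : Z -> R) (p phat : R -> Z -> Z -> R) (n : nat).
Context (Hok : rates_ok isN lam mu) (Hnat : natural_boundaries isN lam mu).
Context (Hp : is_D_tf isN lam mu p) (Hphat : is_Dhat_tf isN lam mu phat).
Notation I x := (inI isN x = true).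
Notation W x := (Wb isN n x = true).
Notation F := (Phat_tail isN phat).
Notation G := (cdf isN p).
Notation pi := (piZ lam mu).

Lemma p_bounds t x y : 0 <= t -> I x -> I y -> 0 <= p t x y <= 1.
Proof. apply (chain_tf_bounds isN lam mu (nonneg_rates_D isN lam mu Hok) p Hp). Qed.

Lemma p_abs_bounded A t x : 0 <= t -> I x -> (forall z, A z -> I z) -> abs_bounded A (p t x) 1.
Proof.
  intros Ht Ix HA H NH AH. rewrite (sum_list_ext _ (p t x)).
  - apply (chain_tf_sum_le_1 isN lam mu (nonneg_rates_D isN lam mu Hok) p Hp t x H); auto.
    eapply Forall_impl; [|exact AH]; auto.
  - intros z Hz. rewrite Forall_forall in AH. apply Rabs_pos_eq. apply p_bounds; auto.
Qed.

Lemma phat_bounds t x y : 0 <= t -> I x -> I y -> 0 <= phat t x y <= 1.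
Proof. apply (chain_tf_bounds isN _ lam (nonneg_rates_Dhat isN lam mu Hok) phat Hphat). Qed.

Lemma F_bounds t x y : 0 <= t -> I x -> 0 <= F t x y <= 1.
Proof. apply (Phat_tail_bounds isN _ lam (nonneg_rates_Dhat isN lam mu Hok) phat Hphat). Qed.

Lemma siegmund t x y : 0 <= t -> I x -> I y -> F t x y = G t y x.
Proof.
  intros Ht Ix Iy. revert t x Ht Ix.
  destruct (lyapunov_D isN lam mu Hok Hnat) as [V HV].
  destruct (lyapunov_Dhat isN lam mu Hok Hnat) as [Vh HVh].
  pose proof (nonneg_rates_D isN lam mu Hok) as Hr.
  pose proof (nonneg_rates_Dhat isN lam mu Hok) as Hrh.
  pose proof (piZ_pos isN lam mu Hok) as Hpi.
  pose proof (piZ_rev isN lam mu Hok) as Hrev.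
  pose proof (conservative_D isN lam mu Hok) as Hcons.
  apply (bounded_unique isN _ lam Hrh Vh HVh (fun t x => F t x y) (fun t x => G t y x) 1);
    [lra| | | | | | |].
  - intros t x Ht Ix. apply Rabs_le. pose proof (F_bounds t x y Ht Ix). lra.
  - intros t x Ht Ix. apply Rabs_le. pose proof (cdf_bounds isN lam mu Hr p Hp t y x Ht Iy). lra.
  - intros x Ix. rewrite (Phat_tail_0 isN _ lam phat Hphat), (cdf_0 isN lam mu p Hp); auto.
  - intros x Ix. now apply (Phat_tail_backward isN _ lam Hrh phat Hphat).
  - intros x Ix. now apply (cdf_right_cont0 isN lam mu Hr V HV pi Hpi Hrev Hcons p Hp).
  - intros x Ix. now apply (Phat_tail_backward isN _ lam Hrh phat Hphat).
  - intros x Ix t Ht.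
    (* Increments of [G] in [x] are values of [p], so the dual generator applied to [G] is the flux
       of the D-chain. *)
    replace (gen isN _ lam (fun x => G t y x) x) with (flux lam mu (p t y) x);
      [now apply (cdf_derivative isN lam mu Hr V HV pi Hpi Hrev Hcons p Hp)|].
    assert (Ht' : 0 <= t) by lra. unfold flux, gen.
    rewrite ext_in by now apply inI_succ.
    rewrite (cdf_step isN lam mu Hr p Hp t y (x + 1)) by (auto using inI_succ).
    replace (x + 1 - 1)%Z with x by lia.
    (* At the bottom of [N] the killing value 0 agrees with the empty distribution function at
       -1. *)
    replace (ext isN (fun x => G t y x) (x - 1)) with (G t y (x - 1)).
    + rewrite (cdf_step isN lam mu Hr p Hp t y x) by auto. ring.
    + unfold ext. destruct (inI isN (x - 1)) eqn:E; auto.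
      apply (cdf_below_zero isN lam mu Hr p Hp); auto. congruence.
Qed.

Lemma phat_cdf t x w : 0 <= t -> I x -> I w -> phat t x w = G t w x - G t (w + 1)%Z x.
Proof.
  intros Ht Ix Iw. rewrite <- !siegmund by auto using inI_succ.
  rewrite (Phat_tail_step isN _ lam (nonneg_rates_Dhat isN lam mu Hok) phat Hphat t x w) by auto. ring.
Qed.

(** Duality differenced in both variables. It rewrites the block [C] through [p] with [z] as target,
    so that it can be summed over intervals of [z]. *)
Lemma phat_difference t z w : 0 <= t -> I z -> I w ->
  phat_ext isN phat t z w - phat_ext isN phat t (z - 1) w = p t w z - p t (w + 1)%Z z.
Proof.
  intros Ht Iz Iw. pose proof (nonneg_rates_D isN lam mu Hok) as Hr.
  assert (E : forall v, phat_ext isN phat t v w = G t w v - G t (w + 1)%Z v).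
  { intros v. unfold phat_ext. destruct (inI isN v) eqn:Iv; [now apply phat_cdf|].
    rewrite !(cdf_below_zero isN lam mu Hr p Hp); auto using inI_succ; try congruence. ring. }
  rewrite !E, (cdf_step isN lam mu Hr p Hp t w z), (cdf_step isN lam mu Hr p Hp t (w + 1) z)
    by auto using inI_succ. ring.
Qed.

Lemma p_reversible t x y : 0 <= t -> I x -> I y -> pi x * p t x y = pi y * p t y x.
Proof.
  apply (chain_tf_sym isN lam mu (nonneg_rates_D isN lam mu Hok) pi (piZ_rev isN lam mu Hok) p Hp).
Qed.

Lemma KM_p_nonneg t x y : 0 <= t -> W x -> W y -> 0 <= KM n p t x y.
Proof.
  destruct (lyapunov_D isN lam mu Hok Hnat) as [V HV].
  apply (KM_nonneg isN lam mu (nonneg_rates_D isN lam mu Hok) V HV p Hp).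
Qed.

Lemma KM_phat_nonneg t x y : 0 <= t -> W x -> W y -> 0 <= KM n phat t x y.
Proof.
  destruct (lyapunov_Dhat isN lam mu Hok Hnat) as [V HV].
  apply (KM_nonneg isN _ lam (nonneg_rates_Dhat isN lam mu Hok) V HV phat Hphat).
Qed.

Lemma G_has_sum t x w : 0 <= t -> I x -> has_sum (fun z => I z /\ (z <= w)%Z) (p t x) (G t x w).
Proof. apply (cdf_has_sum isN lam mu (nonneg_rates_D isN lam mu Hok) p Hp). Qed.

Lemma below_sum t w x i : 0 <= t -> I w -> W x -> (i < n)%nat ->
  has_sum (below isN x i) (p t w) (G t w (xi x i) - (if Nat.eqb i 0 then 0 else G t w (xi x (Nat.pred i)))).
Proof.
  intros Ht Iw Wx Hi. apply Wb_spec in Wx. destruct Wx as (Lx & Ix & Mx).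
  destruct i as [|i]; simpl Nat.eqb; cbv iota.
  - rewrite Rminus_0_r. eapply has_sum_ext; [|reflexivity|apply G_has_sum; auto].
    intros z. unfold below. tauto.
  - eapply has_sum_ext; [| |apply (has_sum_diff (fun z => I z /\ (z <= xi x (S i))%Z)
      (fun z => I z /\ (z <= xi x i)%Z));
      [|apply (G_has_sum t w (xi x (S i))); auto|apply G_has_sum; auto]].
    + intros z. unfold below. simpl. split.
      * intros [[Iz Hz] Hn]. split; auto. split; auto. apply Z.nle_gt. intros Hle. apply Hn. auto.
      * intros (Iz & H1 & H2). split; auto. intros [_ H3]. lia.
    + reflexivity.
    + simpl. intros z [Iz Hz]. specialize (Mx i Hi). split; auto; lia.
Qed.

Lemma above_sum t x y i : 0 <= t -> I x -> W y -> (i < n)%nat ->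
  has_sum (above isN n y i) (phat t x) (F t x (xi y i) - (if Nat.eqb (S i) n then 0 else F t x (xi y (S i)))).
Proof.
  intros Ht Ix Wy Hi. apply Wb_spec in Wy. destruct Wy as (Ly & Iy & My).
  assert (HF : forall a, has_sum (fun z => I z /\ (a <= z)%Z) (phat t x) (F t x a))
    by (intros a; now apply (Phat_tail_has_sum isN _ lam (nonneg_rates_Dhat isN lam mu Hok) phat Hphat)).
  destruct (Nat.eqb_spec (S i) n) as [Hn|Hn].
  - rewrite Rminus_0_r. eapply has_sum_ext; [|reflexivity|apply HF].
    intros z. unfold above. split; [intros [H1 H2]; split; auto; split; auto; lia|tauto].
  - eapply has_sum_ext; [| |apply (has_sum_diff (fun z => I z /\ (xi y i <= z)%Z)
      (fun z => I z /\ (xi y (S i) <= z)%Z));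
      [|apply HF|apply HF]].
    + intros z. unfold above. simpl. split.
      * intros [[Iz Hz] Hn']. split; auto. split; auto. intros _. apply Z.nle_gt. intros Hle. apply Hn'. auto.
      * intros (Iz & H1 & H2). split; auto. intros [_ H3]. specialize (H2 ltac:(lia)). lia.
    + reflexivity.
    + simpl. intros z [Iz Hz]. specialize (My i ltac:(lia)). split; auto; lia.
Qed.

(** The pivot of the second intertwining and of the eigenfunction property: both one-sided sums over
    interlacing points reduce to it. *)
Definition tail_det (t : R) (x y : list Z) : R := det n (fun i j => F t (xi x i) (xi y j)).

Lemma KM_phat_sum t x y : 0 <= t -> W x -> W y ->
  has_sum (fun z => Wnnb isN n z y = true) (fun z => KM n phat t x z) (tail_det t x y).
Proof.
  intros Ht Wx Wy. pose proof Wx as Wx'. apply Wb_spec in Wx'. destruct Wx' as (Lx & Ix & Mx).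
  (* Transposed because the summation variables label columns of [KM], whereas sums are taken row by
     row. *)
  unfold tail_det. rewrite <- DetBridge.det_tr.
  rewrite <- (DetBridge.det_rowdiff_up n (fun i j => F t (xi x j) (xi y i))).
  rewrite det_gdet.
  eapply has_sum_ext; [| |apply (has_sum_gdet (-1) n (above isN n y) (fun j z i => phat t (xi x i) z))].
  - intros z. symmetry. now apply Wnnb_above.
  - intros z _. simpl. rewrite <- det_gdet. unfold KM.
    apply (DetBridge.det_tr n (fun i j => phat t (xi x i) (xi z j))).
  - intros i j Hi Hj. apply above_sum; auto.
Qed.

(** Detailed balance in every entry moves the weights from [y] to [y'] and makes the points to be
    summed targets of [p], where distribution functions are available. *)
Lemma weighted_KM y y' t : 0 <= t -> W y -> W y' ->
  prodpi lam mu y * KM n p t y y' =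
  prodpi lam mu y' * det n (fun i j => p t (xi y' j) (xi y i)).
Proof.
  intros Ht Wy Wy'. apply Wb_spec in Wy, Wy'. destruct Wy as (Ly & Iy & _), Wy' as (Ly' & Iy' & _).
  change (prodpi lam mu y) with (weight pi y). change (prodpi lam mu y') with (weight pi y').
  rewrite <- !prodN_weight, Ly, Ly'. unfold KM.
  rewrite <- det_scale_rows, <- det_scale_cols. apply det_ext. intros i j Hi Hj.
  apply p_reversible; auto.
Qed.

Lemma KM_p_sum t x y' : 0 <= t -> W x -> W y' ->
  has_sum (fun y => Wnnb isN n x y = true) (fun y => prodpi lam mu y * KM n p t y y')
    (prodpi lam mu y' * tail_det t x y').
Proof.
  intros Ht Wx Wy. pose proof Wx as Wx'. apply Wb_spec in Wx'. destruct Wx' as (Lx & Ix & Mx).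
  pose proof Wy as Wy'. apply Wb_spec in Wy'. destruct Wy' as (Ly & Iy & My).
  eapply has_sum_eq; [|apply (has_sum_scal _ (fun y => det n (fun i j => p t (xi y' j) (xi y i))))].
  - intros y Hy. symmetry. apply weighted_KM; auto. now apply (Wnnb_Wb isN n x).
  - unfold tail_det. rewrite (det_ext n _ (fun i j => G t (xi y' j) (xi x i)))
      by (intros; apply siegmund; auto).
    rewrite <- (DetBridge.det_rowdiff n (fun i j => G t (xi y' j) (xi x i))).
    rewrite det_gdet.
    eapply has_sum_ext; [| |apply (has_sum_gdet (-1) n (below isN x) (fun i z j => p t (xi y' j) z))].
    + intros y. symmetry. now apply Wnnb_below.
    + intros y _. simpl. rewrite <- det_gdet. reflexivity.
    + intros i j Hi Hj. apply below_sum; auto.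
Qed.

(* The block matrix of [qnn] after multiplying its bottom rows by [pi (y_i)]
   and dividing its right columns by [pi (y'_j)]. *)
Definition scaled_top (t : R) (x x' y' : list Z) (i j : nat) : R :=
  if Nat.ltb j n then phat t (xi x i) (xi x' j)
  else F t (xi x i) (xi y' (j - n)) - (if Nat.leb (j - n) i then 1 else 0).

Definition scaled_bottom (t : R) (x' y' : list Z) (z : Z) (j : nat) : R :=
  if Nat.ltb j n then p t (xi x' j) z - p t (xi x' j + 1)%Z z
  else p t (xi y' (j - n)) z.

Lemma weighted_qnn t x y x' y' : 0 <= t -> W y -> W x' -> W y' ->
  prodpi lam mu y * qnn isN lam mu p phat n t (x, y) (x', y') =
  prodpi lam mu y' * det (n + n) (fun i j =>
    if Nat.ltb i n then scaled_top t x x' y' i j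
    else scaled_bottom t x' y' (xi y (i - n)) j).
Proof.
  intros Ht Wy Wx' Wy'. apply Wb_spec in Wy, Wy', Wx'.
  destruct Wy as (Ly & Iy & _), Wy' as (Ly' & Iy' & _), Wx' as (Lx' & Ix' & _).
  change (prodpi lam mu y) with (weight pi y). change (prodpi lam mu y') with (weight pi y').
  rewrite <- !prodN_weight, Ly, Ly'.
  rewrite <- (prodN_tail n n (fun i => pi (xi y i))), <- (prodN_tail n n (fun i => pi (xi y' i))).
  unfold qnn. replace (2 * n)%nat with (n + n)%nat by lia.
  rewrite <- det_scale_rows, <- det_scale_cols. apply det_ext. intros i j Hi Hj.
  unfold scaled_top, scaled_bottom.
  destruct (Nat.ltb_spec i n), (Nat.ltb_spec j n); try ring.
  - assert (I1 : I (xi y (i - n))) by (apply Iy; lia).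
    rewrite phat_difference by auto. pose proof (piZ_pos isN lam mu Hok _ I1). field. lra.
  - apply p_reversible; auto; [apply Iy|apply Iy']; lia.
Qed.

Lemma weighted_qnn_sum t x x' y' : 0 <= t -> W x -> W x' -> W y' ->
  has_sum (fun y => Wnnb isN n x y = true)
    (fun y => prodpi lam mu y * qnn isN lam mu p phat n t (x, y) (x', y'))
    (prodpi lam mu y' * KM n phat t x x').
Proof.
  intros Ht Wx Wx' Wy'. pose proof Wx as Wx0. pose proof Wx' as Wx1. pose proof Wy' as Wy1.
  apply Wb_spec in Wx0, Wx1, Wy1.
  destruct Wx0 as (Lx & Ix & Mx), Wx1 as (Lx' & Ix' & Mx'), Wy1 as (Ly' & Iy' & My').
  eapply has_sum_eq; [|apply (has_sum_scal _ (fun y => det (n + n) (fun i j =>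
    if Nat.ltb i n then scaled_top t x x' y' i j
    else scaled_bottom t x' y' (xi y (i - n)) j)))].
  - intros y Hy. symmetry. apply weighted_qnn; auto. now apply (Wnnb_Wb isN n x).
  - unfold KM. rewrite <- (DetBridge.det_block_rowdiff n (fun i j => phat t (xi x i) (xi x' j))
      (fun i j => F t (xi x i) (xi y' j))).
    replace (2 * n)%nat with (n + n)%nat by lia. rewrite det_gdet.
    (* The summed bottom rows are differences of consecutive top rows without their indicators, the
       shape that [det_block_rowdiff] evaluates. *)
    set (L := fun i j => if Nat.ltb j n
       then phat t (xi x i) (xi x' j) - (if Nat.eqb i 0 then 0 else phat t (xi x (Nat.pred i)) (xi x' j))
       else F t (xi x i) (xi y' (j - n)) - (if Nat.eqb i 0 then 0 else F t (xi x (Nat.pred i)) (xi y' (j - n)))).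
    pose proof (has_sum_gdet_bottom (-1) n n (below isN x) (scaled_top t x x' y')
      (fun i z j => scaled_bottom t x' y' z j) L) as H.
    eapply has_sum_ext; [| |apply H].
    + intros y. symmetry. now apply Wnnb_below.
    + intros y _. simpl. rewrite <- det_gdet. reflexivity.
    + intros i j Hi Hj. unfold scaled_bottom, L.
      destruct (Nat.ltb_spec j n) as [Hjn|Hjn].
      * assert (Iw : I (xi x' j)) by auto. assert (Ip : I (xi x (Nat.pred i))) by (apply Ix; lia).
        replace (_ - _) with
          ((G t (xi x' j) (xi x i) - (if Nat.eqb i 0 then 0 else G t (xi x' j) (xi x (Nat.pred i)))) +
           -1 * (G t (xi x' j + 1)%Z (xi x i) -
             (if Nat.eqb i 0 then 0 else G t (xi x' j + 1)%Z (xi x (Nat.pred i))))).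
        -- apply (has_sum_eq _ (fun z => p t (xi x' j) z + -1 * p t (xi x' j + 1)%Z z));
             [intros; ring|].
           apply has_sum_plus; [|apply has_sum_scal]; apply below_sum; auto. now apply inI_succ.
        -- rewrite !phat_cdf by auto. destruct (Nat.eqb i 0); ring.
      * assert (I1 : I (xi y' (j - n))) by (apply Iy'; lia).
        replace (_ - _) with (G t (xi y' (j - n)) (xi x i) -
          (if Nat.eqb i 0 then 0 else G t (xi y' (j - n)) (xi x (Nat.pred i)))).
        -- now apply below_sum.
        -- rewrite !siegmund; auto. apply Ix. lia.
Qed.

(** The 2 comes from the bottom left block, where two transition functions are subtracted; elsewhere
    1 would do. *)
Definition qnn_bound : R := gdet 1 (n + n) (fun _ _ => 2).

Lemma weighted_qnn_abs_bounded t x x' y' : 0 <= t -> W x -> W x' -> W y' ->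
  abs_bounded (fun y => Wnnb isN n x y = true)
    (fun y => prodpi lam mu y * qnn isN lam mu p phat n t (x, y) (x', y'))
    (Rabs (prodpi lam mu y') * qnn_bound).
Proof.
  intros Ht Wx Wx' Wy'. pose proof Wx as Wx0. pose proof Wx' as Wx1. pose proof Wy' as Wy1.
  apply Wb_spec in Wx0, Wx1, Wy1.
  destruct Wx0 as (Lx & Ix & Mx), Wx1 as (Lx' & Ix' & Mx'), Wy1 as (Ly' & Iy' & My').
  eapply abs_bounded_le; [|eapply abs_bounded_sub; [|apply abs_bounded_scal,
    (det_bottom_abs_bounded n n (below isN x) (scaled_top t x x' y')
      (fun i z j => scaled_bottom t x' y' z j) 2)]].
  - intros y Hy. right. f_equal. apply weighted_qnn; auto. now apply (Wnnb_Wb isN n x).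
  - intros y Hy. now apply Wnnb_below.
  - intros i j Hi Hj. unfold scaled_top. destruct (Nat.ltb_spec j n).
    + pose proof (phat_bounds t (xi x i) (xi x' j) Ht (Ix i Hi) (Ix' j H)). rewrite Rabs_pos_eq; lra.
    + pose proof (F_bounds t (xi x i) (xi y' (j - n)) Ht (Ix i Hi)). apply Rabs_le.
      destruct (Nat.leb (j - n) i); lra.
  - intros i j Hi Hj. unfold scaled_bottom. destruct (Nat.ltb_spec j n).
    + intros H0 NH AH.
      assert (HB : forall w, I w -> sum_list (fun z => Rabs (p t w z)) H0 <= 1).
      { intros w Iw. apply (p_abs_bounded (below isN x i) t w); auto. intros z Hz. apply Hz. }
      pose proof (HB _ (Ix' j H)). pose proof (HB _ (inI_succ isN _ (Ix' j H))).
      eapply Rle_trans; [apply (sum_list_le _ (fun z => Rabs (p t (xi x' j) z) + Rabs (p t (xi x' j + 1)%Z z)))|].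
      * intros z _. unfold Rminus. eapply Rle_trans; [apply Rabs_triang|]. rewrite Rabs_Ropp. lra.
      * rewrite sum_list_plus. lra.
    + intros H0 NH AH. assert (I1 : I (xi y' (j - n))) by (apply Iy'; lia).
      pose proof (p_abs_bounded (below isN x i) t _ Ht I1 ltac:(intros z Hz; apply Hz) H0 NH AH). lra.
Qed.

End Intertwining.

(** * Intertwinings and the Markov property *)

Section Coupling.

Context (isN : bool) (lam mu : Z -> R) (p phat : R -> Z -> Z -> R) (n : nat) (c : R) (g hg : list Z -> R).
Context (Hok : rates_ok isN lam mu) (Hnat : natural_boundaries isN lam mu).
Context (Hp : is_D_tf isN lam mu p) (Hphat : is_Dhat_tf isN lam mu phat).
Notation W x := (Wb isN n x = true).
Notation WW x y := (Wnnb isN n x y = true).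
Context (g_pos : forall x, W x -> 0 < g x)
  (g_eigen : forall t x, 0 <= t -> W x ->
     has_sum (fun y => W y) (fun y => KM n p t x y * g y) (exp (c * t) * g x))
  (hg_def : forall x, W x -> has_sum (fun y => WW x y) (fun y => prodpi lam mu y * g y) (hg x)).
Notation PhG := (PnG n phat c hg).
Notation PG := (PnG n p c g).
Notation QG := (QnnG isN lam mu p phat n c g).
Notation Lam := (LamG isN lam mu n g hg).
Notation Pi := (prodpi lam mu).

Lemma prodpi_pos y : W y -> 0 < Pi y.
Proof.
  intros Wy. apply Wb_spec in Wy. destruct Wy as (Ly & Iy & _). rewrite <- Ly in Iy.
  assert (H : forall z, In z y -> 0 < piZ lam mu z).
  { intros z Hz. destruct (In_nth y z 0%Z Hz) as (i & Hi & <-).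
    apply (piZ_pos isN lam mu Hok). now apply Iy. }
  clear Iy Ly. induction y as [|z y IH]; simpl; [lra|].
  apply Rmult_lt_0_compat; [apply H; left; auto|apply IH; intros; apply H; right; auto].
Qed.

(** The point [x] interlaces with itself, and this single term is positive. *)
Lemma hg_pos x : W x -> 0 < hg x.
Proof.
  intros Wx. apply Rlt_le_trans with (sum_list (fun y => Pi y * g y) [x]).
  - unfold sum_list; simpl. rewrite Rplus_0_r.
    apply Rmult_lt_0_compat; [now apply prodpi_pos|now apply g_pos].
  - apply (has_sum_partial_le (fun y => WW x y)); [|now apply hg_def|repeat constructor; auto|].
    + intros y Hy. apply Wnnb_Wb in Hy. destruct Hy as [_ Wy].
      apply Rmult_le_pos; left; [now apply prodpi_pos|now apply g_pos].
    + repeat constructor. now apply Wnnb_refl.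
Qed.

(** Since [g] may be unbounded, the double sums are built by Tonelli from nonnegative
    Karlin-McGregor determinants. Their finite value comes from the eigenfunction property of [g]
    and is kept through all rearrangements. *)
Lemma hg_eigen t x : 0 <= t -> W x ->
  has_sum (fun z => W z) (fun z => KM n phat t x z * hg z) (exp (c * t) * hg x).
Proof.
  intros Ht Wx.
  assert (Hgp : forall y, W y -> 0 <= Pi y * g y).
  { intros y Wy. apply Rmult_le_pos; left; [now apply prodpi_pos|now apply g_pos]. }
  assert (S1 : has_sum (sigma_set (fun y => WW x y) (fun _ y' => W y'))
     (fun yy => Pi (fst yy) * (KM n p t (fst yy) (snd yy) * g (snd yy))) (exp (c * t) * hg x)).
  { apply (has_sum_sigma_nonneg _ _ _ (fun y => Pi y * (exp (c * t) * g y))).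
    - intros y y' Hy Wy'. apply Wnnb_Wb in Hy. destruct Hy as [_ Wy]. simpl.
      apply Rmult_le_pos; [left; now apply prodpi_pos|].
      apply Rmult_le_pos; [|left; now apply g_pos].
      now apply (KM_p_nonneg isN lam mu p n Hok Hnat Hp).
    - intros y Hy. apply Wnnb_Wb in Hy. simpl. apply has_sum_scal. now apply g_eigen.
    - apply (has_sum_eq _ (fun y => exp (c * t) * (Pi y * g y))); [intros; ring|].
      apply has_sum_scal. now apply hg_def. }
  apply has_sum_swap in S1.
  assert (S2 : has_sum (fun y' => W y') (fun y' => Pi y' * tail_det isN phat n t x y' * g y')
     (exp (c * t) * hg x)).
  { apply (has_sum_sigma_outer (fun y' => W y') (fun _ y => WW x y)
      (fun ba => Pi (snd ba) * (KM n p t (snd ba) (fst ba) * g (fst ba)))).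
    - eapply has_sum_ext; [| |exact S1].
      + intros [y' y]. unfold sigma_set. simpl. tauto.
      + reflexivity.
    - intros y' Wy'. simpl. rewrite Rmult_comm.
      apply (has_sum_eq _ (fun y => g y' * (Pi y * KM n p t y y'))); [intros; ring|].
      apply has_sum_scal. now apply (KM_p_sum isN lam mu p phat n Hok Hnat Hp Hphat). }
  (* The tail determinant obtained by summing out [y] is expanded again, now over the [z]
     interlacing with [y']. *)
  assert (S3 : has_sum (sigma_set (fun y' => W y') (fun y' z => WW z y'))
     (fun yz => KM n phat t x (snd yz) * (Pi (fst yz) * g (fst yz))) (exp (c * t) * hg x)).
  { apply (has_sum_sigma_nonneg _ _ _ (fun y' => Pi y' * tail_det isN phat n t x y' * g y')); auto.
    - intros y' z Wy' Hz. apply Wnnb_Wb in Hz. simpl. apply Rmult_le_pos; [|auto].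
      now apply (KM_phat_nonneg isN lam mu phat n Hok Hnat Hphat).
    - intros y' Wy'. simpl.
      replace (Pi y' * tail_det isN phat n t x y' * g y') with
        (Pi y' * g y' * tail_det isN phat n t x y') by ring.
      apply (has_sum_eq _ (fun z => Pi y' * g y' * KM n phat t x z)); [intros; ring|].
      apply has_sum_scal. now apply (KM_phat_sum isN lam mu phat n Hok Hphat). }
  apply has_sum_swap in S3.
  apply (has_sum_sigma_outer (fun z => W z) (fun z y' => WW z y')
      (fun zy => KM n phat t x (fst zy) * (Pi (snd zy) * g (snd zy)))).
  - eapply has_sum_ext; [| |exact S3].
    + intros [z y']. unfold sigma_set. simpl. split; intros [H1 H2]; split; auto;
        apply Wnnb_Wb in H2; tauto.
    + reflexivity.
  - intros z Wz. simpl. apply has_sum_scal. now apply hg_def.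
Qed.

Lemma Lam_same x y : WW x y -> Lam x (x, y) = Pi y * g y / hg x.
Proof.
  intros H. unfold LamG. simpl. destruct (list_eq_dec Z.eq_dec x x); [|congruence]. now rewrite H.
Qed.

Lemma Lam_zero x ab : ~ (fst ab = x /\ WW x (snd ab)) -> Lam x ab = 0.
Proof.
  intros H. unfold LamG. destruct (list_eq_dec Z.eq_dec x (fst ab)); auto.
  destruct (Wnnb isN n x (snd ab)) eqn:E; auto. exfalso. auto.
Qed.

Lemma Lam_nonneg x ab : W x -> 0 <= Lam x ab.
Proof.
  intros Wx. destruct (classic (fst ab = x /\ WW x (snd ab))) as [[H1 H2]|H].
  - destruct ab as [a y]. simpl in *. subst a. rewrite Lam_same by auto.
    pose proof (hg_pos x Wx). apply Wnnb_Wb in H2. apply Rdiv_le_0_compat; auto.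
    apply Rmult_le_pos; left; [now apply prodpi_pos|now apply g_pos].
  - rewrite Lam_zero; auto. lra.
Qed.

Lemma Lam_total x : W x -> has_sum (fun y => WW x y) (fun y => Lam x (x, y)) 1.
Proof.
  intros Wx. pose proof (hg_pos x Wx). replace 1 with (/ hg x * hg x) by (field; lra).
  apply (has_sum_eq _ (fun y => / hg x * (Pi y * g y))).
  - intros y Hy. rewrite Lam_same by auto. unfold Rdiv. ring.
  - apply has_sum_scal. now apply hg_def.
Qed.

Lemma Lam_QG t x y x' y' : WW x y -> WW x' y' ->
  Lam x (x, y) * QG t (x, y) (x', y') =
  exp (- c * t) * g y' / hg x * (Pi y * qnn isN lam mu p phat n t (x, y) (x', y')).
Proof.
  intros Hy Hy'. rewrite Lam_same by auto. unfold QnnG. simpl snd.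
  destruct (Wnnb_Wb _ _ _ _ Hy) as [Wx Wy].
  pose proof (hg_pos x Wx). pose proof (g_pos y Wy). field. lra.
Qed.

Lemma Lam_QG_sum t x x' y' : 0 <= t -> W x -> WW x' y' ->
  has_sum (fun y => WW x y) (fun y => Lam x (x, y) * QG t (x, y) (x', y'))
    (PhG t x x' * Lam x' (x', y')).
Proof.
  intros Ht Wx Hy'. destruct (Wnnb_Wb _ _ _ _ Hy') as [Wx' Wy'].
  rewrite Lam_same by auto. pose proof (hg_pos x Wx). pose proof (hg_pos x' Wx').
  replace (PhG t x x' * (Pi y' * g y' / hg x')) with
    (exp (- c * t) * g y' / hg x * (Pi y' * KM n phat t x x')) by (unfold PnG; field; lra).
  apply (has_sum_eq _ (fun y => exp (- c * t) * g y' / hg x * (Pi y * qnn isN lam mu p phat n t (x, y) (x', y')))).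
  - intros y Hy. symmetry. now apply Lam_QG.
  - apply has_sum_scal. now apply (weighted_qnn_sum isN lam mu p phat n Hok Hnat Hp Hphat).
Qed.

(** The constant does not depend on [y'], and the bound is proportional to [Lam x' (x', y')], the
    factor with which the weight of the remaining path begins; it can therefore be summed over that
    path. *)
Lemma Lam_QG_abs_bounded t x x' : 0 <= t -> W x -> W x' -> exists B, forall y', WW x' y' ->
  abs_bounded (fun y => WW x y) (fun y => Lam x (x, y) * QG t (x, y) (x', y'))
    (B * Lam x' (x', y')).
Proof.
  intros Ht Wx Wx'. pose proof (hg_pos x Wx). pose proof (hg_pos x' Wx').
  exists (exp (- c * t) * hg x' / hg x * qnn_bound n). intros y' Hy'.
  destruct (Wnnb_Wb _ _ _ _ Hy') as [_ Wy'].
  pose proof (exp_pos (- c * t)). pose proof (g_pos y' Wy'). pose proof (prodpi_pos y' Wy').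
  rewrite Lam_same by auto.
  replace (exp (- c * t) * hg x' / hg x * qnn_bound n * (Pi y' * g y' / hg x')) with
    (Rabs (exp (- c * t) * g y' / hg x) * (Rabs (Pi y') * qnn_bound n)).
  - eapply abs_bounded_le; [|apply abs_bounded_scal;
      apply (weighted_qnn_abs_bounded isN lam mu p phat n Hok Hnat Hp Hphat t x x' y')]; auto.
    intros y Hy. right. f_equal. now apply Lam_QG.
  - rewrite !Rabs_pos_eq; [field; lra|lra|].
    apply Rdiv_le_0_compat; [apply Rmult_le_pos; lra|lra].
Qed.

Lemma first_intertwining_left t x xy' : Wnn_pair isN n xy' ->
  has_sum (fun z => W z) (fun z => PhG t x z * Lam z xy') (PhG t x (fst xy') * Lam (fst xy') xy').
Proof.
  intros Hxy. destruct (Wnnb_Wb _ _ _ _ Hxy) as [Wx' _].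
  apply (has_sum_singleton _ (fun z => PhG t x z * Lam z xy')); auto.
  intros z Wz Hne. rewrite Lam_zero; [ring|]. intros [H _]. congruence.
Qed.

Lemma first_intertwining_right t x xy' : 0 <= t -> W x -> Wnn_pair isN n xy' ->
  has_sum (Wnn_pair isN n) (fun ab => Lam x ab * QG t ab xy') (PhG t x (fst xy') * Lam (fst xy') xy').
Proof.
  intros Ht Wx Hxy. destruct xy' as [x' y'].
  apply (has_sum_support (fun ab => fst ab = x /\ WW x (snd ab))).
  - intros [a y] [H1 H2]. simpl in *. subst a. exact H2.
  - intros ab _ H. rewrite Lam_zero by exact H. ring.
  - pose proof (Lam_QG_sum t x x' y' Ht Wx Hxy) as H.
    apply (has_sum_reindex (fun ab : list Z * list Z => fst ab = x /\ WW x (snd ab)) _ snd (fun y => (x, y))) in H.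
    + eapply has_sum_eq; [|exact H]. intros [a y] [H1 H2]. simpl in *. now subst a.
    + intros [a y] [H1 H2]. simpl in *. now subst a.
    + intros y Hy. simpl. auto.
Qed.

(** Both sides equal the same multiple of the tail determinant of [x] and [y'], one by summing over
    [z], the other over [y]. *)
Lemma second_intertwining t x y' : 0 <= t -> W x -> W y' ->
  exists l,
    has_sum (fun z => W z) (fun z => PhG t x z * Lam z (z, y')) l /\
    has_sum (fun y => W y) (fun y => Lam x (x, y) * PG t y y') l.
Proof.
  intros Ht Wx Wy'. pose proof (hg_pos x Wx).
  exists (exp (- c * t) * g y' / hg x * (Pi y' * tail_det isN phat n t x y')). split.
  - apply (has_sum_support (fun z => WW z y')).
    + intros z Hz. now apply Wnnb_Wb in Hz.
    + intros z _ Hz. rewrite Lam_zero; [ring|]. simpl. tauto.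
    + replace (exp (- c * t) * g y' / hg x * (Pi y' * tail_det isN phat n t x y')) with
        (exp (- c * t) * g y' / hg x * Pi y' * tail_det isN phat n t x y') by ring.
      apply (has_sum_eq _ (fun z => exp (- c * t) * g y' / hg x * Pi y' * KM n phat t x z)).
      * intros z Hz. rewrite Lam_same by auto. unfold PnG.
        destruct (Wnnb_Wb _ _ _ _ Hz) as [Wz _]. pose proof (hg_pos z Wz). field. lra.
      * apply has_sum_scal. now apply (KM_phat_sum isN lam mu phat n Hok Hphat).
  - apply (has_sum_support (fun y => WW x y)).
    + intros y Hy. now apply Wnnb_Wb in Hy.
    + intros y _ Hy. rewrite Lam_zero; [ring|]. simpl. tauto.
    + apply (has_sum_eq _ (fun y => exp (- c * t) * g y' / hg x * (Pi y * KM n p t y y'))).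
      * intros y Hy. rewrite Lam_same by auto. unfold PnG.
        destruct (Wnnb_Wb _ _ _ _ Hy) as [_ Wy]. pose proof (g_pos y Wy). field. lra.
      * apply has_sum_scal. now apply (KM_p_sum isN lam mu p phat n Hok Hnat Hp Hphat).
Qed.

Definition path_set (x : list Z) (xs ys : list (list Z)) : Prop :=
  match ys with
  | [] => False
  | y0 :: ys' => WW x y0 /\ length ys' = length xs /\
      forall i, (i < length xs)%nat -> WW (nth i xs []) (nth i ys' [])
  end.

Definition path_weight (ss : list R) (x : list Z) (xs ys : list (list Z)) : R :=
  match ys with
  | [] => 0
  | y0 :: ys' => Lam x (x, y0) * pathQ QG ss x y0 xs ys'
  end.

(* The first [y] is summed out by [Lam_QG_sum], which turns the weight into that
   of the path started afresh from [Lam x1]. *)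
Lemma path_distribution ss : forall x xs, W x -> length xs = length ss ->
  Forall (fun s => 0 <= s) ss -> Forall (fun z => W z) xs ->
  has_sum (path_set x xs) (path_weight ss x xs) (pathP PhG ss x xs).
Proof.
  induction ss as [|s ss IH]; intros x [|x1 xs] Wx Hlen Hss Hxs; try discriminate.
  - pose proof (Lam_total x Wx) as H.
    apply (has_sum_reindex (path_set x []) _ (hd []) (fun y => [y])) in H.
    + simpl. eapply has_sum_eq; [|exact H]. intros [|y [|y1 ys]] Hy; simpl in *; try tauto.
      * ring.
      * destruct Hy as (_ & Hl & _). discriminate.
    + intros [|y [|y1 ys]] Hy; simpl in *; try tauto. destruct Hy as (_ & Hl & _). discriminate.
    + intros y Hy. simpl. split; auto. split; auto. split; auto. intros; lia.
  - inversion Hss as [|s' ss' Hs Hss']; subst. inversion Hxs as [|x1' xs' Wx1 Hxs']; subst.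
    specialize (IH x1 xs Wx1 ltac:(simpl in Hlen; lia) Hss' Hxs').
    destruct (Lam_QG_abs_bounded s x x1 Hs Wx Wx1) as [B HB].
    (* The path weight with [y0] split off as inner variable. The empty list is not in [path_set],
       so its value 0 is a default. *)
    set (f := fun yy : list (list Z) * list Z => match fst yy with
       | [] => 0
       | y1 :: ys => Lam x (x, snd yy) * QG s (x, snd yy) (x1, y1) * pathQ QG ss x1 y1 xs ys
       end).
    destruct (has_sum_abs_bounded _ _ _ IH) as [M HM].
    assert (HS : has_sum (sigma_set (path_set x1 xs) (fun _ y0 => WW x y0)) f
       (PhG s x x1 * pathP PhG ss x1 xs)).
    { apply (has_sum_sigma _ _ f (fun ys => PhG s x x1 * path_weight ss x1 xs ys) (Rabs B * M)).
      (* Summing absolute values over [y0] yields at most [B] times the modulus of the remaining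
         path weight, which is absolutely summable by the induction hypothesis. *)
      - apply (sigma_abs_bounded _ _ _ (fun ys => Rabs (B * path_weight ss x1 xs ys))).
        + intros [|y1 ys] Hys; [destruct Hys|]. destruct Hys as [Hy1 _]. unfold f; simpl.
          intros L NL AL.
          rewrite (sum_list_ext _ (fun y0 => Rabs (pathQ QG ss x1 y1 xs ys) *
             Rabs (Lam x (x, y0) * QG s (x, y0) (x1, y1))))
            by (intros; rewrite !Rabs_mult; ring).
          rewrite sum_list_scal.
          specialize (HB y1 Hy1 L NL AL).
          eapply Rle_trans; [apply Rmult_le_compat_l; [apply Rabs_pos|exact HB]|].
          rewrite !Rabs_mult, (Rabs_pos_eq (Lam x1 (x1, y1))) by now apply Lam_nonneg.
          rewrite (Rmult_comm (Rabs (pathQ _ _ _ _ _ _))), Rmult_assoc.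
          rewrite <- !Rmult_assoc, !(Rmult_assoc _ (Lam x1 (x1, y1))).
          apply Rmult_le_compat_r; [|apply Rle_abs].
          apply Rmult_le_pos; [now apply Lam_nonneg|apply Rabs_pos].
        + eapply abs_bounded_le; [|apply abs_bounded_scal; exact HM].
          intros ys _. rewrite Rabs_Rabsolu. lra.
      - intros [|y1 ys] Hys; [destruct Hys|]. destruct Hys as [Hy1 _]. unfold f; simpl.
        apply (has_sum_eq _ (fun y0 => pathQ QG ss x1 y1 xs ys *
           (Lam x (x, y0) * QG s (x, y0) (x1, y1)))); [intros; ring|].
        replace (PhG s x x1 * (Lam x1 (x1, y1) * pathQ QG ss x1 y1 xs ys)) with
          (pathQ QG ss x1 y1 xs ys * (PhG s x x1 * Lam x1 (x1, y1))) by ring.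
        apply has_sum_scal. now apply Lam_QG_sum.
      - now apply has_sum_scal. }
    apply (has_sum_reindex (path_set x (x1 :: xs)) _ (fun ys => (tl ys, hd [] ys))
      (fun yy => snd yy :: fst yy)) in HS.
    + simpl pathP. eapply has_sum_eq; [|exact HS].
      intros [|y0 [|y1 ys]] Hys; simpl in Hys; [tauto|destruct Hys as (_ & Hl & _); discriminate|].
      unfold f; simpl. ring.
    + intros [|y0 [|y1 ys]] Hys; simpl in Hys; [tauto|destruct Hys as (_ & Hl & _); discriminate|].
      destruct Hys as (H0 & Hl & Hi). split; [|reflexivity]. split; [|exact H0]. simpl.
      split; [apply (Hi O); lia|]. split; [lia|]. intros i Hilt. apply (Hi (S i)). lia.
    + intros [[|y1 ys] y0] [Hys H0]; [destruct Hys|]. simpl in Hys, H0. destruct Hys as (H1 & Hl & Hi).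
      split; [|reflexivity]. simpl. split; auto. split; [lia|]. intros [|i] Hilt; auto.
      apply Hi. lia.
Qed.

(** The path law with a single time: summing over the terminal [y] too gives the probability of
    [X(T) = x'], the normalisation in the conditional law. *)
Lemma joint_law T x x' y' : 0 <= T -> W x -> WW x' y' ->
  has_sum (fun abc : (list Z * list Z) * list Z => Wnn_pair isN n (fst abc) /\ WW x' (snd abc))
    (fun abc => Lam x (fst abc) * QG T (fst abc) (x', snd abc)) (PhG T x x').
Proof.
  intros HT Wx Hy'. destruct (Wnnb_Wb _ _ _ _ Hy') as [Wx' _].
  pose proof (path_distribution [T] x [x'] Wx eq_refl ltac:(auto) ltac:(auto)) as H.
  simpl pathP in H. rewrite Rmult_1_r in H.
  apply (has_sum_support (fun abc => (fst (fst abc) = x /\ WW x (snd (fst abc))) /\ WW x' (snd abc))).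
  - intros [[a y] y1] [[H1 H2] H3]. simpl in *. subst a. split; auto.
  - intros abc [H1 H2] H3. rewrite Lam_zero; [ring|]. intros H4. apply H3. auto.
  - apply (has_sum_reindex (fun abc => (fst (fst abc) = x /\ WW x (snd (fst abc))) /\ WW x' (snd abc)) _
      (fun abc => [snd (fst abc); snd abc]) (fun ys => ((x, hd [] ys), hd [] (tl ys)))) in H.
    + eapply has_sum_eq; [|exact H]. intros [[a y] y1] [[H1 H2] H3]. simpl in *. subst a. ring.
    + intros [[a y] y1] [[H1 H2] H3]. simpl in *. subst a. split; auto. split; auto. split; auto.
      intros [|i] Hi; auto; lia.
    + intros [|y0 [|y1 [|y2 ys]]] Hys; simpl in Hys; try tauto;
        destruct Hys as (H1 & Hl & Hi); try discriminate.
      simpl. split; auto. split; auto. apply (Hi O). lia.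
Qed.

End Coupling.

Theorem theorem2p10 (isN : bool) (lam mu : Z -> R) (p phat : R -> Z -> Z -> R)
    (n : nat) (c : R) (g hg : list Z -> R) :
  rates_ok isN lam mu ->
  natural_boundaries isN lam mu ->
  is_D_tf isN lam mu p ->
  is_Dhat_tf isN lam mu phat ->
  (1 <= n)%nat ->
  (* g_n strictly positive eigenfunction of P^n_t with eigenvalue e^{ct} *)
  (forall x, Wb isN n x = true -> 0 < g x) ->
  (forall t x, 0 <= t -> Wb isN n x = true ->
     has_sum (fun y => Wb isN n y = true) (fun y => KM n p t x y * g y) (exp (c * t) * g x)) ->
  (* hat g_n = Lambda_{n,n} g_n, finite on W^n *)
  (forall x, Wb isN n x = true ->
     has_sum (fun y => Wnnb isN n x y = true) (fun y => prodpi lam mu y * g y) (hg x)) ->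
  let PhG := PnG n phat c hg in
  let PG := PnG n p c g in
  let QG := QnnG isN lam mu p phat n c g in
  let Lam := LamG isN lam mu n g hg in
  (* hat g_n is a strictly positive eigenfunction of hat P^n_t *)
  ((forall x, Wb isN n x = true -> 0 < hg x) /\
   (forall t x, 0 <= t -> Wb isN n x = true ->
      has_sum (fun y => Wb isN n y = true) (fun y => KM n phat t x y * hg y)
              (exp (c * t) * hg x))) /\
  (* first intertwining: hat P^{n,hg}_t Lambda^g = Lambda^g Q^{n,n,g}_t *)
  (forall t x xy', 0 <= t -> Wb isN n x = true -> Wnn_pair isN n xy' ->
     exists l,
       has_sum (fun z => Wb isN n z = true) (fun z => PhG t x z * Lam z xy') l /\
       has_sum (Wnn_pair isN n) (fun ab => Lam x ab * QG t ab xy') l) /\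
  (* second intertwining, Lambda^g viewed as a kernel W^n -> W^n *)
  (forall t x y', 0 <= t -> Wb isN n x = true -> Wb isN n y' = true ->
     exists l,
       has_sum (fun z => Wb isN n z = true) (fun z => PhG t x z * Lam z (z, y')) l /\
       has_sum (fun y => Wb isN n y = true) (fun y => Lam x (x, y) * PG t y y') l) /\
  (* X is Markov with semigroup hat P^{n,hg} started at x: finite-dimensional
     distributions of X under the Q^{n,n,g}-process started from Lambda^g(x,.),
     at times t_k = s_1 + ... + s_k *)
  (forall x (ss : list R) (xs : list (list Z)),
     Wb isN n x = true -> length xs = length ss ->
     Forall (fun s => 0 <= s) ss -> Forall (fun z => Wb isN n z = true) xs ->
     has_sum
       (fun ys : list (list Z) => match ys with
          | [] => False
          | y0 :: ys' => Wnnb isN n x y0 = true /\ length ys' = length xs /\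
              forall i, (i < length xs)%nat ->
                Wnnb isN n (nth i xs []) (nth i ys' []) = true
          end)
       (fun ys => match ys with
          | [] => 0
          | y0 :: ys' => Lam x (x, y0) * pathQ QG ss x y0 xs ys'
          end)
       (pathP PhG ss x xs)) /\
  (* conditional law of (X(T),Y(T)) given X(T) is Lambda^g(X(T), .) :
     P((X,Y)(T) = (x',y')) = P(X(T) = x') * Lambda^g(x', (x',y')) *)
  (forall T x xy', 0 <= T -> Wb isN n x = true -> Wnn_pair isN n xy' ->
     exists J m,
       has_sum (Wnn_pair isN n) (fun ab => Lam x ab * QG T ab xy') J /\
       has_sum (fun abc : (list Z * list Z) * list Z =>
                  Wnn_pair isN n (fst abc) /\ Wnnb isN n (fst xy') (snd abc) = true)
               (fun abc => Lam x (fst abc) * QG T (fst abc) (fst xy', snd abc)) m /\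
       J = m * Lam (fst xy') xy').
Proof.
  intros Hok Hnat Hp Hphat _ g_pos g_eigen hg_def. cbv zeta.
  split; [split|split; [|split; [|split]]].
  - intros x Wx. eapply hg_pos; eauto.
  - intros t x Ht Wx. eapply hg_eigen; eauto.
  - intros t x xy' Ht Wx Hxy.
    exists (PnG n phat c hg t x (fst xy') * LamG isN lam mu n g hg (fst xy') xy').
    split; [now apply first_intertwining_left|eapply first_intertwining_right; eauto].
  - intros t x y' Ht Wx Wy'. eapply second_intertwining; eauto.
  - intros x ss xs Wx Hlen Hss Hxs.
    exact (path_distribution isN lam mu p phat n c g hg Hok Hnat Hp Hphat g_pos hg_def ss x xs Wx Hlen Hss Hxs).
  - intros T x [x' y'] HT Wx Hxy.
    (* The first intertwining already factorises the joint weight; its second factor is the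
       conditional law. *)
    exists (PnG n phat c hg T x x' * LamG isN lam mu n g hg x' (x', y')), (PnG n phat c hg T x x').
    split; [|split; [|reflexivity]].
    + exact (first_intertwining_right isN lam mu p phat n c g hg Hok Hnat Hp Hphat g_pos hg_def T x (x', y') HT Wx Hxy).
    + exact (joint_law isN lam mu p phat n c g hg Hok Hnat Hp Hphat g_pos hg_def T x x' y' HT Wx Hxy).
Qed.
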